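(* Let $\Lambda=\Lambda(f)$ be an envelope class whose envelope distribution has non-decreasing hazard rate, let $(m_n)_{n\ge1}$ be its exact threshold sequence, and let $Q_n$ be the coding probability of the ETAC-code. Then, as $n\to\infty$, $$(1/4+o_\Lambda(1))\, m_n\log n\le R^+(\Lambda_n)\le R^+(Q_n,\Lambda_n)\le (2+o_\Lambda(1))\, m_n\log n\log m_n .$$ In particular $R^+(Q_n,\Lambda_n)\le (8+o_\Lambda(1))\log m_n\, R^+(\Lambda_n)$, and the multiplicative factor $\log m_n$ is of order $O_\Lambda(\log\log n)$.
   Context: All logarithms are base 2; $o_\Lambda(1)\to0$ as $n\to\infty$ and may depend on $\Lambda$. Envelope classes: for $f:\mathbb N_+\to(0,1]$ with $1<\sum_j f(j)<\infty$, $\Lambda(f)$ is the set of i.i.d. sources with marginal $\mathbb P_1\{j\}\le f(j)$ for all $j$; $\Lambda_n$ is the set of their $n$-symbol restrictions. The envelope distribution is $F(k)=1-\sum_{j>k}f(j)$ when this sum is $<1$, else $0$; a smoothed envelope distribution (still denoted $F$) is a c.d.f. on $\mathbb R_+$ coinciding with $F$ on $\mathbb N$, with continuous derivative positive wherever $F(\lfloor x\rfloor)\in(0,1)$. Non-decreasing hazard rate means that the hazard rate $-\frac{d}{dx}\log\overline F(x)$ of the smoothed envelope distribution is non-decreasing, where $\overline F=1-F$. The exact threshold $m(t)$ is the solution $x$ of $\overline F(x)=x/t$, and $m_n=m(n)$. Redundancy: $R^+(Q_n,\Lambda_n)=\sup_{\mathbb P\in\Lambda}D(\mathbb P_n,Q_n)$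 (Kullback–Leibler, base 2), $R^+(\Lambda_n)=\inf_{Q_n}R^+(Q_n,\Lambda_n)$. ETAC-code: for $x_{1:n}$ let $x_{1,i}\ge\dots\ge x_{i,i}$ be the order statistics of $x_{1:i}$ and $M_i=\min(i,\min\{k:x_{k,i}\le k\})$. The first symbol is not censored; for $i\ge2$, $x_i$ is censored iff $x_i>M_{i-1}$. The censored sequence (censored symbols replaced by $0$) followed by a terminating $0$ is arithmetic-coded with predictive probabilities $\frac{n_i^j+1/2}{i+(M_i+1)/2}$, $j\in\{0,\dots,M_i\}$ ($n_i^j$ = number of occurrences of $j$ in $x_{1:i}$, $n_i^0=0$); each censored $x_i$ is also encoded by the Elias penultimate code of $x_i-M_{i-1}+1$, codewords interleaved. $Q_n\propto2^{-\ell}$ is the coding probability of the resulting codelength $\ell$. *)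

(* Defs.v *)
From Stdlib Require Import Reals Lra Lia List Arith.
From Stdlib Require Import ClassicalDescription.
From Coquelicot Require Import Coquelicot.
Import ListNotations.
Open Scope R_scope.

Definition log2 (x : R) : R := ln x / ln 2.

(* f : N_+ -> (0,1] ; values of f at 0 are irrelevant *)
Definition is_envelope (f : nat -> R) : Prop :=
  (forall j : nat, (1 <= j)%nat -> 0 < f j <= 1) /\
  ex_series (fun k => f (S k)) /\
  1 < Series (fun k => f (S k)).

(* marginal p of an i.i.d. source on N_+ belonging to Lambda(f) *)
Definition in_Lambda (f : nat -> R) (p : nat -> R) : Prop :=
  (forall j : nat, (1 <= j)%nat -> 0 <= p j <= f j) /\
  is_series (fun k => p (S k)) 1.

Definition env_tail (f : nat -> R) (k : nat) : R := Series (fun i => f (S (k + i))).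

Definition env_cdf (f : nat -> R) (k : nat) : R :=
  if Rlt_dec (env_tail f k) 1 then 1 - env_tail f k else 0.

Definition nfloor (x : R) : nat := Z.to_nat (Int_part x).

Definition smoothed_envelope (f : nat -> R) (Fs dFs : R -> R) : Prop :=
  (forall k : nat, Fs (INR k) = env_cdf f k) /\
  (forall x, 0 <= x -> 0 <= Fs x <= 1) /\
  (forall x y, 0 <= x <= y -> Fs x <= Fs y) /\
  is_lim Fs p_infty 1 /\
  filterlim Fs (at_right 0) (locally (Fs 0)) /\
  (forall x, 0 < x -> is_derive Fs x (dFs x) /\ continuous dFs x) /\
  (forall x, 0 < x -> 0 < env_cdf f (nfloor x) < 1 -> 0 < dFs x).

(* non-decreasing hazard rate  -(d/dx) log (1 - Fs x) = dFs x / (1 - Fs x) *)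
Definition nondecreasing_hazard (Fs dFs : R -> R) : Prop :=
  forall x y, 0 < x <= y -> dFs x / (1 - Fs x) <= dFs y / (1 - Fs y).

Definition is_threshold (Fs : R -> R) (m : nat -> R) : Prop :=
  forall n : nat, (1 <= n)%nat -> 0 <= m n /\ 1 - Fs (m n) = m n / INR n.

Fixpoint boxes (n K : nat) : list (list nat) :=
  match n with
  | O => [nil]
  | S n' => flat_map (fun a => map (cons a) (boxes n' K)) (List.seq 1 K)
  end.

Definition box_sum (n K : nat) (g : list nat -> R) : R :=
  fold_right Rplus 0 (map g (boxes n K)).

(* sum over all x in N_+^n of a nonnegative g (in [0, +oo]) *)
Definition tsum (n : nat) (g : list nat -> R) : Rbar :=
  Sup_seq (fun K => Finite (box_sum n K g)).

Definition is_word (n : nat) (x : list nat) : Prop :=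
  length x = n /\ List.Forall (fun a => (1 <= a)%nat) x.

Definition Pn (p : nat -> R) (x : list nat) : R :=
  fold_right (fun a r => p a * r) 1 x.

Definition is_prob (n : nat) (Q : list nat -> R) : Prop :=
  (forall x, 0 <= Q x) /\ tsum n Q = Finite 1.

Definition kl_term (P Q : list nat -> R) (x : list nat) : R :=
  if Req_EM_T (P x) 0 then 0 else P x * log2 (P x / Q x).

Definition KL (n : nat) (P Q : list nat -> R) : Rbar :=
  if excluded_middle_informative
       (exists x, is_word n x /\ 0 < P x /\ Q x = 0)
  then p_infty
  else Rbar_minus (tsum n (fun x => Rmax (kl_term P Q x) 0))
                  (tsum n (fun x => Rmax (- kl_term P Q x) 0)).

Definition Rmax_red (f : nat -> R) (n : nat) (Q : list nat -> R) : Rbar :=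
  Rbar_lub (fun r => exists p, in_Lambda f p /\ r = KL n (Pn p) Q).

Definition minimax_red (f : nat -> R) (n : nat) : Rbar :=
  Rbar_glb (fun r => exists Q, is_prob n Q /\ r = Rmax_red f n Q).

Fixpoint insert_desc (a : nat) (l : list nat) : list nat :=
  match l with
  | nil => [a]
  | b :: l' => if (b <=? a)%nat then a :: l else b :: insert_desc a l'
  end.

Definition sort_desc (l : list nat) : list nat := fold_right insert_desc nil l.

Fixpoint M_aux (k : nat) (t : list nat) : nat :=
  match t with
  | nil => (k - 1)%nat
  | y :: t' => if (y <=? k)%nat then k else M_aux (S k) t'
  end.

(* M_i = min(i, min{k : x_{k,i} <= k}) for the prefix s = x_{1:i} *)
Definition Mthr (s : list nat) : nat := M_aux 1 (sort_desc s).

Definition cnt (j : nat) (s : list nat) : nat :=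
  if (j =? 0)%nat then 0%nat else count_occ Nat.eq_dec s j.

(* predictive probability of symbol j in {0..M_i} after prefix s = x_{1:i} *)
Definition pred_prob (s : list nat) (j : nat) : R :=
  (INR (cnt j s) + 1/2) / (INR (length s) + (INR (Mthr s) + 1) / 2).

(* the (i+1)-th symbol (0-based index i >= 1) and whether it is censored *)
Definition sym (x : list nat) (i : nat) : nat := nth i x 0%nat.
Definition censored (x : list nat) (i : nat) : bool :=
  (Mthr (firstn i x) <? sym x i)%nat.
Definition cens_sym (x : list nat) (i : nat) : nat :=
  if censored x i then 0%nat else sym x i.

(* probability assigned by the arithmetic coder to the censored sequence
   x~_2 ... x~_n followed by the terminating 0 *)
Definition ac_prob (x : list nat) : R :=
  fold_right Rmult 1
    (map (fun i => pred_prob (firstn i x) (cens_sym x i)) (List.seq 1 (length x - 1)))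
  * pred_prob x 0.

(* Elias penultimate (delta) code length of m >= 1 *)
Definition elias_len (m : nat) : nat :=
  (Nat.log2 m + 2 * Nat.log2 (Nat.log2 m + 1) + 1)%nat.

Definition elias_total (x : list nat) : R :=
  INR (elias_len (hd 0%nat x)) +
  fold_right Rplus 0
    (map (fun i => if censored x i
                   then INR (elias_len (sym x i - Mthr (firstn i x) + 1))
                   else 0) (List.seq 1 (length x - 1))).

Definition arith_coder_len (lac : list nat -> R) : Prop :=
  forall x, (1 <= length x)%nat -> List.Forall (fun a => (1 <= a)%nat) x ->
    - log2 (ac_prob x) <= lac x <= - log2 (ac_prob x) + 2.

Definition etac_len (lac : list nat -> R) (x : list nat) : R :=
  lac x + elias_total x.

Definition etac_prob (lac : list nat -> R) (n : nat) (x : list nat) : R :=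
  Rpower 2 (- etac_len lac x) / real (tsum n (fun y => Rpower 2 (- etac_len lac y))).

(* Main.v *)
(** Upper bound.  With M_i the threshold after i symbols, comparing the
    sequential Krichevsky-Trofimov weights with the multinomial coefficient gives
    P(x) <= 2 (n+1)^(2 M_n) ac(x) prod 2 (M_i + 1), the product being over the
    censored positions.  By exchangeability the probability that symbol i+1 is
    censored is at most E[M_{i+1} + 1] / (i+1), because at most M_{i+1} + 1 of the
    i+1 symbols exceed the threshold of the remaining ones; an exponential moment
    of the number of symbols above m_n bounds M_n by about 1.2 m_n on average.
    A censored symbol thus costs log m_n for the arithmetic coder and
    about 1.2 log m_n for the Elias code, and 2.2 * 1.2 * ln 2 < 2.

    Lower bound.  Each f(j) with j < m_n is quantised into about
    sqrt(n f(j) / m_n) levels that the empirical counts decode correctly with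
    probability close to 1 (Chebyshev); for any Q, some choice of levels has a
    decoding region of small Q-measure (pigeonhole, one symbol at a time), which
    forces a redundancy of nearly sum_j 1/2 log (n f(j)).  A non-decreasing hazard
    rate makes the logarithm of the envelope tail concave, so its chord gives
    log (n f(j)) >= (1 - j / m_n) log n up to a bounded error, and the sum is
    1/4 m_n log n. *)

Require Import Defs.
From Coquelicot Require Import Coquelicot.
From Stdlib Require Import Reals Lra Lia List Arith ClassicalDescription ZArith.
Import ListNotations.
Open Scope R_scope.

(** * Sums over words *)

(** Sums over all words would raise convergence questions at every step, so each inequality is
    proved for words over a finite alphabet [seq 1 K], uniformly in [K], and only [tsum] passes to
    the supremum. The price is that a truncated source has mass at most 1, so expectations are
    bounded from above only. The sources of the lower bound have finite support, so there nothing is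
    truncated.

    In the upper bound the sum of 1 / i over positions gives a natural logarithm, which is where ln
    2 enters. The gap between the leading constant and 2, multiplied by log m_n, absorbs every term
    of order m_n log n, including the whole cost (n+1)^(2 M_n). The upper bound therefore holds for
    large n with constant exactly 2, and 8 is 2 divided by 1/4.

    In the lower bound 1/4 is a product of two halves: a count of mean n f(j) resolves only about
    square-root many levels, and 1 - j / m_n averages to 1/2. Symbols very close to m_n are left
    out, because a margin in the exponent of n is needed to have at least one level. The mass left
    over by the chosen levels goes to the first symbols, whose envelope values sum to at least 1. *)

Definition lsum {A : Type} (g : A -> R) (l : list A) : R :=
  fold_right Rplus 0 (map g l).

Lemma lsum_cons {A} (g : A -> R) a l : lsum g (a :: l) = g a + lsum g l.
Proof. reflexivity. Qed.

Lemma lsum_app {A} (g : A -> R) l1 l2 : lsum g (l1 ++ l2) = lsum g l1 + lsum g l2.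
Proof.
  induction l1 as [|a l1 IH]; simpl.
  - unfold lsum at 2; simpl; ring.
  - rewrite !lsum_cons, IH; ring.
Qed.

Lemma lsum_ext {A} (g h : A -> R) l :
  (forall a, In a l -> g a = h a) -> lsum g l = lsum h l.
Proof.
  induction l as [|a l IH]; intros H; [reflexivity|].
  rewrite !lsum_cons, IH; [rewrite (H a)|]; auto with datatypes.
Qed.

Lemma lsum_le {A} (g h : A -> R) l :
  (forall a, In a l -> g a <= h a) -> lsum g l <= lsum h l.
Proof.
  induction l as [|a l IH]; intros H; [apply Rle_refl|].
  rewrite !lsum_cons; apply Rplus_le_compat; auto with datatypes.
Qed.

Lemma lsum_zero {A} (l : list A) : lsum (fun _ => 0) l = 0.
Proof. induction l as [|a l IH]; [reflexivity|rewrite lsum_cons, IH; ring]. Qed.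

Lemma lsum_nonneg {A} (g : A -> R) l :
  (forall a, In a l -> 0 <= g a) -> 0 <= lsum g l.
Proof. intros H; rewrite <- (lsum_zero l); apply lsum_le, H. Qed.

Lemma lsum_plus {A} (g h : A -> R) l :
  lsum (fun a => g a + h a) l = lsum g l + lsum h l.
Proof.
  induction l as [|a l IH]; [unfold lsum; simpl; ring|].
  rewrite !lsum_cons, IH; ring.
Qed.

Lemma lsum_scal {A} (c : R) (g : A -> R) l :
  lsum (fun a => c * g a) l = c * lsum g l.
Proof.
  induction l as [|a l IH]; [unfold lsum; simpl; ring|].
  rewrite !lsum_cons, IH; ring.
Qed.

Lemma lsum_const {A} (c : R) (l : list A) : lsum (fun _ => c) l = INR (length l) * c.
Proof.
  induction l as [|a l IH]; [unfold lsum; simpl; ring|].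
  rewrite lsum_cons, IH; simpl length; rewrite S_INR; ring.
Qed.

Lemma lsum_swap {A B} (g : A -> B -> R) la lb :
  lsum (fun a => lsum (g a) lb) la = lsum (fun b => lsum (fun a => g a b) la) lb.
Proof.
  induction la as [|a la IH]; [symmetry; apply lsum_zero|].
  rewrite lsum_cons, IH, <- lsum_plus; reflexivity.
Qed.

Lemma lsum_map {A B} (h : A -> B) (g : B -> R) l :
  lsum g (map h l) = lsum (fun a => g (h a)) l.
Proof. unfold lsum; rewrite map_map; reflexivity. Qed.

Lemma lsum_flat_map {A B} (h : A -> list B) (g : B -> R) l :
  lsum g (flat_map h l) = lsum (fun a => lsum g (h a)) l.
Proof.
  induction l as [|a l IH]; [reflexivity|].
  simpl; rewrite lsum_app, lsum_cons, IH; reflexivity.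
Qed.

Lemma lsum_term {A} (g : A -> R) l a :
  (forall b, In b l -> 0 <= g b) -> In a l -> g a <= lsum g l.
Proof.
  induction l as [|b l IH]; intros H Hin; [destruct Hin|].
  rewrite lsum_cons; destruct Hin as [->|Ha].
  - pose proof (lsum_nonneg g l (fun b Hb => H b (or_intror Hb))); lra.
  - pose proof (IH (fun b Hb => H b (or_intror Hb)) Ha).
    pose proof (H b (or_introl eq_refl)); lra.
Qed.

Lemma lsum_indicator (v : R) (a : nat) l :
  NoDup l -> In a l -> lsum (fun b => if (b =? a)%nat then v else 0) l = v.
Proof.
  induction l as [|b l IH]; intros Hnd Hin; [destruct Hin|].
  inversion Hnd as [|? ? Hb Hl]; subst.
  rewrite lsum_cons.
  destruct Hin as [->|Hin].
  - rewrite Nat.eqb_refl, (lsum_ext _ (fun _ => 0)), lsum_zero; [ring|].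
    intros c Hc; destruct (Nat.eqb_spec c a); [subst; contradiction|reflexivity].
  - destruct (Nat.eqb_spec b a); [subst; contradiction|].
    rewrite IH by assumption; ring.
Qed.

Lemma box_sum_lsum n K g : box_sum n K g = lsum g (boxes n K).
Proof. reflexivity. Qed.

Lemma box_sum_0 K g : box_sum 0 K g = g nil.
Proof. unfold box_sum; simpl; ring. Qed.

Lemma box_sum_S n K g :
  box_sum (S n) K g = lsum (fun a => box_sum n K (fun l => g (a :: l))) (seq 1 K).
Proof.
  rewrite box_sum_lsum; simpl; rewrite lsum_flat_map.
  apply lsum_ext; intros a _; apply lsum_map.
Qed.

Lemma in_boxes n K x :
  In x (boxes n K) <-> length x = n /\ Forall (fun a => (1 <= a <= K)%nat) x.
Proof.
  revert x; induction n as [|n IH]; intros x; simpl.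
  - split.
    + intros [<-|[]]; auto.
    + intros [H _]; destruct x; [auto|discriminate].
  - rewrite in_flat_map; split.
    + intros (a & Ha & Hx); apply in_map_iff in Hx; destruct Hx as (l & <- & Hl).
      apply in_seq in Ha; apply IH in Hl; destruct Hl as [Hl1 Hl2].
      split; [simpl; lia|constructor; [lia|assumption]].
    + intros [Hl Hf]; destruct x as [|a l]; [discriminate|].
      inversion Hf; subst. exists a; split; [apply in_seq; lia|].
      apply in_map, IH; split; [simpl in Hl; lia|assumption].
Qed.

Lemma box_sum_ext n K g h :
  (forall x, length x = n -> Forall (fun a => (1 <= a <= K)%nat) x -> g x = h x) ->
  box_sum n K g = box_sum n K h.
Proof. intros H; apply lsum_ext; intros x Hx; apply in_boxes in Hx; destruct Hx; auto. Qed.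

Lemma box_sum_le n K g h :
  (forall x, length x = n -> Forall (fun a => (1 <= a <= K)%nat) x -> g x <= h x) ->
  box_sum n K g <= box_sum n K h.
Proof. intros H; apply lsum_le; intros x Hx; apply in_boxes in Hx; destruct Hx; auto. Qed.

Lemma box_sum_nonneg n K g :
  (forall x, length x = n -> Forall (fun a => (1 <= a <= K)%nat) x -> 0 <= g x) ->
  0 <= box_sum n K g.
Proof. intros H; apply lsum_nonneg; intros x Hx; apply in_boxes in Hx; destruct Hx; auto. Qed.

Lemma box_sum_plus n K g h :
  box_sum n K (fun x => g x + h x) = box_sum n K g + box_sum n K h.
Proof. apply lsum_plus. Qed.

Lemma box_sum_scal n K c g :
  box_sum n K (fun x => c * g x) = c * box_sum n K g.
Proof. apply lsum_scal. Qed.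

(** A sequential code predicts the last symbol from its prefix, so sums over words must also split
    at the end, not only at the head as [boxes] does. *)
Lemma box_sum_snoc n K g :
  box_sum (S n) K g = box_sum n K (fun s => lsum (fun a => g (s ++ [a])) (seq 1 K)).
Proof.
  revert g; induction n as [|n IH]; intros g.
  - rewrite box_sum_S, box_sum_0; apply lsum_ext; intros a _; apply box_sum_0.
  - rewrite box_sum_S, box_sum_S; apply lsum_ext; intros a _; rewrite IH; reflexivity.
Qed.

Lemma box_sum_mono n K L g :
  (K <= L)%nat -> (forall x, 0 <= g x) -> box_sum n K g <= box_sum n L g.
Proof.
  intros HKL; revert g; induction n as [|n IH]; intros g Hg.
  - rewrite !box_sum_0; lra.
  - rewrite !box_sum_S.
    assert (HL : seq 1 L = seq 1 K ++ seq (1 + K) (L - K)).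
    { rewrite <- seq_app; f_equal; lia. }
    rewrite HL, lsum_app.
    assert (0 <= lsum (fun a => box_sum n L (fun l => g (a :: l))) (seq (1 + K) (L - K))).
    { apply lsum_nonneg; intros; apply box_sum_nonneg; auto. }
    assert (lsum (fun a => box_sum n K (fun l => g (a :: l))) (seq 1 K)
            <= lsum (fun a => box_sum n L (fun l => g (a :: l))) (seq 1 K)).
    { apply lsum_le; intros a _; apply (IH (fun l => g (a :: l))); auto. }
    lra.
Qed.

Lemma Pn_cons p a l : Pn p (a :: l) = p a * Pn p l.
Proof. reflexivity. Qed.

Lemma Pn_app p s t : Pn p (s ++ t) = Pn p s * Pn p t.
Proof.
  induction s as [|a s IH].
  - rewrite app_nil_l; change (Pn p nil) with 1; ring.
  - rewrite <- app_comm_cons, !Pn_cons, IH; ring.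
Qed.

Lemma Pn_snoc p s a : Pn p (s ++ [a]) = Pn p s * p a.
Proof. rewrite Pn_app, Pn_cons; change (Pn p nil) with 1; ring. Qed.

Lemma Pn_nonneg p s :
  (forall j, (1 <= j)%nat -> 0 <= p j) -> Forall (fun a => (1 <= a)%nat) s -> 0 <= Pn p s.
Proof.
  intros Hp; induction 1 as [|a l Ha Hl IH]; [unfold Pn; simpl; lra|].
  rewrite Pn_cons; apply Rmult_le_pos; auto.
Qed.

Lemma box_sum_Pn p n K : box_sum n K (Pn p) = (lsum p (seq 1 K)) ^ n.
Proof.
  induction n as [|n IH].
  - rewrite box_sum_0; reflexivity.
  - rewrite box_sum_S; simpl pow; rewrite <- IH, Rmult_comm, <- lsum_scal.
    apply lsum_ext; intros a _; rewrite Rmult_comm, <- box_sum_scal; reflexivity.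
Qed.

(** * The threshold and exchangeability of censoring *)
(** For k up to the length, the k-th largest symbol is at most k exactly when fewer than k symbols
    exceed k. These counts ignore order and add up over concatenation, so they replace the order
    statistics from here on. *)
Definition exceed (k : nat) (s : list nat) : nat :=
  length (filter (fun a => (k <? a)%nat) s).

Lemma exceed_cons k a s :
  exceed k (a :: s) = ((if (k <? a)%nat then 1 else 0) + exceed k s)%nat.
Proof. unfold exceed; simpl; destruct (k <? a)%nat; reflexivity. Qed.

Lemma exceed_app k s t : exceed k (s ++ t) = (exceed k s + exceed k t)%nat.
Proof. unfold exceed; rewrite filter_app, length_app; reflexivity. Qed.

Lemma exceed_antitone k l s : (k <= l)%nat -> (exceed l s <= exceed k s)%nat.
Proof.
  intros H; induction s as [|a s IH]; [reflexivity|].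
  rewrite !exceed_cons; destruct (Nat.ltb_spec l a), (Nat.ltb_spec k a); lia.
Qed.

Lemma exceed_none k s : List.Forall (fun a => (a <= k)%nat) s -> exceed k s = 0%nat.
Proof.
  induction 1 as [|a s Ha Hs IH]; [reflexivity|].
  rewrite exceed_cons, IH; destruct (Nat.ltb_spec k a); lia.
Qed.

Inductive descending : list nat -> Prop :=
| desc_nil : descending nil
| desc_cons a s : List.Forall (fun b => (b <= a)%nat) s -> descending s -> descending (a :: s).

Lemma insert_desc_Forall (P : nat -> Prop) a s :
  P a -> List.Forall P s -> List.Forall P (insert_desc a s).
Proof.
  intros Ha; induction 1 as [|b s Hb Hs IH]; simpl; [auto|].
  destruct (b <=? a)%nat; auto.
Qed.

Lemma insert_desc_descending a s : descending s -> descending (insert_desc a s).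
Proof.
  induction 1 as [|b s Hb Hs IH]; simpl; [repeat constructor|].
  destruct (Nat.leb_spec b a).
  - constructor; [|constructor; assumption].
    constructor; [assumption|].
    eapply Forall_impl; [|exact Hb]; simpl; intros; lia.
  - constructor; [|assumption]. apply insert_desc_Forall; [lia|assumption].
Qed.

Lemma sort_desc_descending s : descending (sort_desc s).
Proof. induction s; simpl; [constructor|apply insert_desc_descending; assumption]. Qed.

Lemma exceed_insert k a s : exceed k (insert_desc a s) = exceed k (a :: s).
Proof.
  induction s as [|b s IH]; simpl; [reflexivity|].
  destruct (b <=? a)%nat; [reflexivity|].
  rewrite !exceed_cons, IH, exceed_cons; lia.
Qed.

Lemma exceed_sort k s : exceed k (sort_desc s) = exceed k s.
Proof. induction s; simpl; [reflexivity|]. rewrite exceed_insert, !exceed_cons; congruence. Qed.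

Lemma length_insert a s : length (insert_desc a s) = S (length s).
Proof. induction s as [|b s IH]; simpl; [|destruct (b <=? a)%nat; simpl]; lia. Qed.

Lemma length_sort s : length (sort_desc s) = length s.
Proof. induction s; simpl; [reflexivity|rewrite length_insert; lia]. Qed.

(** [t] is what remains of the sorted word after [k] leading symbols have been passed; the summand
    [k] counts those as exceeding. The alternative [k + length t] is the cap of the threshold by the
    length of the word. *)
Lemma M_aux_spec t k :
  descending t ->
  (forall j, (k < j)%nat -> (j < M_aux (S k) t)%nat -> (j <= exceed j t + k)%nat) /\
  ((exceed (M_aux (S k) t) t + k < M_aux (S k) t)%nat \/
    M_aux (S k) t = (k + length t)%nat) /\
  (k <= M_aux (S k) t <= k + length t)%nat /\
  (t <> nil -> (S k <= M_aux (S k) t)%nat).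
Proof.
  intros Ht; revert k; induction Ht as [|y t Hy Ht IH]; intros k; cbn [M_aux length].
  - repeat split; try lia; try (right; lia). congruence.
  - destruct (Nat.leb_spec y (S k)) as [Hle|Hlt].
    + repeat split; try lia. left.
      rewrite exceed_none; [lia|]. constructor; [assumption|].
      eapply Forall_impl; [|exact Hy]; simpl; intros; lia.
    + destruct (IH (S k)) as (H1 & H2 & H3 & _).
      repeat split; try lia.
      * intros j Hj1 Hj2. rewrite exceed_cons.
        destruct (Nat.ltb_spec j y).
        -- destruct (Nat.eq_dec j (S k)); [lia|]. specialize (H1 j); lia.
        (* Nothing in [t] exceeds [j >= y], so for [j > S k] the induction hypothesis would give
           [j <= S k]; and [j = S k] contradicts [S k < y]. *)
        -- assert (exceed j t = 0)%nat.
           { apply exceed_none; eapply Forall_impl; [|exact Hy]; simpl; intros; lia. }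
           destruct (Nat.eq_dec j (S k)); [lia|]. specialize (H1 j); lia.
      * rewrite exceed_cons. destruct (M_aux (S (S k)) t <? y)%nat; lia.
Qed.

Lemma Mthr_exceed s j :
  (1 <= j)%nat -> (j < Mthr s)%nat -> (j <= exceed j s)%nat.
Proof.
  intros H1 H2; destruct (M_aux_spec (sort_desc s) 0 (sort_desc_descending s)) as (H & _).
  specialize (H j); rewrite exceed_sort in H; unfold Mthr in H2; lia.
Qed.

Lemma exceed_Mthr s : (exceed (Mthr s) s < Mthr s)%nat \/ Mthr s = length s.
Proof.
  destruct (M_aux_spec (sort_desc s) 0 (sort_desc_descending s)) as (_ & H & _).
  rewrite exceed_sort, length_sort in H; unfold Mthr; lia.
Qed.

Lemma length_exceed k s : (exceed k s <= length s)%nat.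
Proof. apply filter_length_le. Qed.

Lemma exceed_Mthr_le s : (exceed (Mthr s) s <= Mthr s)%nat.
Proof. destruct (exceed_Mthr s) as [H|H]; [lia|]. pose proof (length_exceed (Mthr s) s); lia. Qed.

Lemma Mthr_length s : (Mthr s <= length s)%nat.
Proof.
  destruct (M_aux_spec (sort_desc s) 0 (sort_desc_descending s)) as (_ & _ & H & _).
  rewrite length_sort in H; unfold Mthr; lia.
Qed.

Lemma Mthr_pos s : s <> nil -> (1 <= Mthr s)%nat.
Proof.
  intros Hs; destruct (M_aux_spec (sort_desc s) 0 (sort_desc_descending s)) as (_ & _ & _ & H).
  apply H; intros E; apply Hs, length_zero_iff_nil; rewrite <- length_sort, E; reflexivity.
Qed.

Lemma Mthr_le s k : (1 <= k)%nat -> (exceed k s < k)%nat -> (Mthr s <= k)%nat.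
Proof.
  intros Hk H; destruct (Nat.le_gt_cases (Mthr s) k) as [|Hlt]; [assumption|].
  pose proof (Mthr_exceed s k Hk Hlt); lia.
Qed.

(** Comparing counts instead of prefixes covers the removal of an arbitrary symbol as well as the
    appending of one; exchangeability needs the former. *)
Lemma Mthr_mono s t :
  s <> nil -> (length s <= length t)%nat -> (forall k, (exceed k s <= exceed k t)%nat) ->
  (Mthr s <= Mthr t)%nat.
Proof.
  intros Hs Hl He; destruct (Nat.le_gt_cases (Mthr s) (Mthr t)) as [|Hlt]; [assumption|].
  destruct (exceed_Mthr t) as [H|H].
  - destruct (Nat.eq_dec (Mthr t) 0); [lia|].
    assert (Mthr s <= Mthr t)%nat by (apply Mthr_le; [lia|]; specialize (He (Mthr t)); lia).
    lia.
  - pose proof (Mthr_length s); lia.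
Qed.

Lemma Mthr_snoc s a : s <> nil -> (Mthr s <= Mthr (s ++ [a]))%nat.
Proof.
  intros Hs; apply Mthr_mono; [assumption|rewrite length_app; lia|].
  intros k; rewrite exceed_app; lia.
Qed.

(** Each position in turn is singled out and paired with the remaining word. Averaging over this
    list plays the role of a random permutation. *)
Fixpoint selections (x : list nat) : list (nat * list nat) :=
  match x with
  | nil => nil
  | a :: l => (a, l) :: map (fun bl => (fst bl, a :: snd bl)) (selections l)
  end.

(* Exchangeability: the last of n+1 i.i.d. symbols may be replaced by a
   uniformly chosen one. *)
Lemma box_sum_selections n K (psi : nat -> list nat -> R) :
  box_sum (S n) K (fun x => lsum (fun bl => psi (fst bl) (snd bl)) (selections x)) =
  INR (S n) * lsum (fun a => box_sum n K (psi a)) (seq 1 K).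
Proof.
  revert psi; induction n as [|n IH]; intros psi.
  - rewrite box_sum_S; simpl INR; rewrite Rmult_1_l; apply lsum_ext; intros a _.
    rewrite !box_sum_0; simpl; unfold lsum; simpl; ring.
  - rewrite box_sum_S.
    transitivity (lsum (fun a => box_sum (S n) K (psi a) +
       INR (S n) * lsum (fun b => box_sum n K (fun l => psi b (a :: l))) (seq 1 K)) (seq 1 K)).
    + apply lsum_ext; intros a _.
      rewrite <- IH, <- box_sum_plus. apply box_sum_ext; intros x _ _.
      cbn [selections]; rewrite lsum_cons, lsum_map; reflexivity.
    + rewrite lsum_plus, lsum_scal, lsum_swap, (S_INR (S n)).
      rewrite (lsum_ext (fun b => lsum (fun a => box_sum n K (fun l => psi b (a :: l))) (seq 1 K))
                (fun b => box_sum (S n) K (psi b))); [ring|].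
      intros b _; rewrite box_sum_S; reflexivity.
Qed.

Lemma selections_spec x a l : In (a, l) (selections x) ->
  length x = S (length l) /\
  (forall k, exceed k x = ((if (k <? a)%nat then 1 else 0) + exceed k l)%nat) /\
  (forall p, Pn p x = p a * Pn p l).
Proof.
  revert a l; induction x as [|b x IH]; intros a l H; [destruct H|].
  destruct H as [H|H].
  - injection H as -> ->. repeat split. intros k; apply exceed_cons.
  - apply in_map_iff in H; destruct H as ([c l'] & E & H); simpl in E.
    injection E as -> <-. destruct (IH _ _ H) as (H1 & H2 & H3).
    repeat split.
    + simpl; lia.
    + intros k; rewrite !exceed_cons, H2; lia.
    + intros p; rewrite !Pn_cons, H3; ring.
Qed.

Lemma selections_fst x : map fst (selections x) = x.
Proof.
  induction x as [|a x IH]; [reflexivity|].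
  simpl; rewrite map_map; f_equal; exact IH.
Qed.

Lemma lsum_exceed k x :
  lsum (fun a => if (k <? a)%nat then 1 else 0) x = INR (exceed k x).
Proof.
  induction x as [|a x IH]; [reflexivity|].
  rewrite lsum_cons, IH, exceed_cons; destruct (k <? a)%nat; rewrite ?Nat.add_1_l, ?S_INR; simpl; lra.
Qed.

Lemma min_selection (L : list (nat * list nat)) (P : nat * list nat -> Prop) (g : list nat -> nat) :
  (forall bl, P bl \/ ~ P bl) ->
  (forall bl, In bl L -> ~ P bl) \/
  exists bl, In bl L /\ P bl /\ forall bl', In bl' L -> P bl' -> (g (snd bl) <= g (snd bl'))%nat.
Proof.
  intros Hdec; induction L as [|bl L IH]; [left; intros _ []|].
  destruct IH as [IH|(m & Hm & Pm & Hmin)], (Hdec bl) as [Hb|Hb].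
  - right; exists bl; repeat split; auto with datatypes.
    intros bl' [<-|H'] P'; [lia|]. destruct (IH _ H' P').
  - left; intros bl' [<-|H']; auto.
  - right; destruct (Nat.le_gt_cases (g (snd bl)) (g (snd m))).
    + exists bl; repeat split; auto with datatypes.
      intros bl' [<-|H'] P'; [lia|]. specialize (Hmin _ H' P'); lia.
    + exists m; repeat split; auto with datatypes.
      intros bl' [<-|H'] P'; [lia|]. auto.
  - right; exists m; repeat split; auto with datatypes.
    intros bl' [<-|H'] P'; [contradiction|]. auto.
Qed.

(** Among the positions censored by the rest of the word, take one whose rest [l] has the smallest
    threshold. Every censored symbol then exceeds [Mthr l], and at most [Mthr l + 1] symbols of [x]
    do: at most [Mthr l] within [l], and the removed one. The nondecreasing weight [h] stands for
    the cost of a censored symbol. *)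
Lemma selections_censored x (h : nat -> R) :
  (2 <= length x)%nat ->
  (forall k, 0 <= h k) -> (forall k l, (k <= l)%nat -> h k <= h l) ->
  lsum (fun bl => if (Mthr (snd bl) <? fst bl)%nat then h (Mthr (snd bl)) else 0) (selections x)
  <= (INR (Mthr x) + 1) * h (Mthr x).
Proof.
  intros Hlen Hh Hmono.
  assert (HM : forall a l, In (a, l) (selections x) -> (Mthr l <= Mthr x)%nat).
  { intros a l H; destruct (selections_spec _ _ _ H) as (H1 & H2 & _).
    apply Mthr_mono; [intros ->; simpl in *; lia|lia|].
    intros k; rewrite H2; lia. }
  apply Rle_trans with
    (lsum (fun bl => h (Mthr x) * (if (Mthr (snd bl) <? fst bl)%nat then 1 else 0)) (selections x)).
  { apply lsum_le; intros [a l] H; simpl. pose proof (Hmono _ _ (HM _ _ H)).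
    destruct (Mthr l <? a)%nat; lra. }
  rewrite lsum_scal, (Rmult_comm (_ + 1)).
  apply Rmult_le_compat_l; [apply Hh|].
  destruct (min_selection (selections x) (fun bl => (Mthr (snd bl) < fst bl)%nat) Mthr)
    as [Hno|([a l] & Hin & Hal & Hmin)]; [intros; lia| |].
  - rewrite (lsum_ext _ (fun _ => 0)), lsum_zero.
    + pose proof (pos_INR (Mthr x)); lra.
    + intros bl H; specialize (Hno _ H). destruct (Nat.ltb_spec (Mthr (snd bl)) (fst bl)); [lia|reflexivity].
  - simpl in *.
    apply Rle_trans with (lsum (fun bl : nat * list nat => if (Mthr l <? fst bl)%nat then 1 else 0) (selections x)).
    { apply lsum_le; intros bl H; specialize (Hmin _ H).
      destruct (Nat.ltb_spec (Mthr (snd bl)) (fst bl)), (Nat.ltb_spec (Mthr l) (fst bl)); try lra; lia. }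
    rewrite <- (lsum_map fst (fun a => if (Mthr l <? a)%nat then 1 else 0)), selections_fst, lsum_exceed.
    rewrite <- S_INR; apply le_INR.
    destruct (selections_spec _ _ _ Hin) as (_ & H2 & _); rewrite H2.
    pose proof (exceed_Mthr_le l). pose proof (HM _ _ Hin).
    destruct (Mthr l <? a)%nat; lia.
Qed.

Lemma censoring_expectation n K p (h : nat -> R) :
  (1 <= n)%nat ->
  (forall j, (1 <= j)%nat -> 0 <= p j) ->
  (forall k, 0 <= h k) -> (forall k l, (k <= l)%nat -> h k <= h l) ->
  box_sum n K (fun s => Pn p s *
     lsum (fun a => p a * (if (Mthr s <? a)%nat then h (Mthr s) else 0)) (seq 1 K))
  <= box_sum (S n) K (fun x => Pn p x * ((INR (Mthr x) + 1) * h (Mthr x))) / INR (S n).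
Proof.
  intros Hn Hp Hh Hmono.
  assert (HS : 0 < INR (S n)) by (apply lt_0_INR; lia).
  apply Rle_div_r; [assumption|]. rewrite Rmult_comm.
  rewrite (box_sum_ext _ _ _ (fun s => lsum (fun a =>
     p a * Pn p s * (if (Mthr s <? a)%nat then h (Mthr s) else 0)) (seq 1 K))).
  2:{ intros s _ _; rewrite <- lsum_scal; apply lsum_ext; intros; ring. }
  rewrite box_sum_lsum, lsum_swap.
  change (INR (S n) * lsum (fun a => box_sum n K (fun s =>
     p a * Pn p s * (if (Mthr s <? a)%nat then h (Mthr s) else 0))) (seq 1 K)
    <= box_sum (S n) K (fun x => Pn p x * ((INR (Mthr x) + 1) * h (Mthr x)))).
  rewrite <- (box_sum_selections n K (fun a s => p a * Pn p s * (if (Mthr s <? a)%nat then h (Mthr s) else 0))).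
  apply box_sum_le; intros x Hx Hf.
  rewrite (lsum_ext _ (fun bl => Pn p x * (if (Mthr (snd bl) <? fst bl)%nat then h (Mthr (snd bl)) else 0))).
  2:{ intros [a l] H; destruct (selections_spec _ _ _ H) as (_ & _ & H3); simpl; rewrite H3; ring. }
  rewrite lsum_scal; apply Rmult_le_compat_l.
  - apply Pn_nonneg; [assumption|]. eapply Forall_impl; [|exact Hf]; simpl; intros; lia.
  - apply selections_censored; auto; lia.
Qed.

(** * Kraft inequality of the ETAC-code *)
Definition lprod {A : Type} (g : A -> R) (l : list A) : R :=
  fold_right Rmult 1 (map g l).

Lemma lprod_cons {A} (g : A -> R) a l : lprod g (a :: l) = g a * lprod g l.
Proof. reflexivity. Qed.

Lemma lprod_app {A} (g : A -> R) l1 l2 : lprod g (l1 ++ l2) = lprod g l1 * lprod g l2.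
Proof.
  induction l1 as [|a l1 IH].
  - rewrite app_nil_l; change (lprod g nil) with 1; ring.
  - rewrite <- app_comm_cons, !lprod_cons, IH; ring.
Qed.

Lemma lprod_pos {A} (g : A -> R) l : (forall a, In a l -> 0 < g a) -> 0 < lprod g l.
Proof.
  induction l as [|a l IH]; intros H; [apply Rlt_0_1|].
  rewrite lprod_cons; apply Rmult_lt_0_compat; auto with datatypes.
Qed.

Lemma lprod_ext {A} (g h : A -> R) l :
  (forall a, In a l -> g a = h a) -> lprod g l = lprod h l.
Proof.
  induction l as [|a l IH]; intros H; [reflexivity|].
  rewrite !lprod_cons, IH; [rewrite (H a)|]; auto with datatypes.
Qed.

(** The pairs (past, next symbol) from the second symbol on. Products and sums over this list split
    when a symbol is appended, which expressions indexed by positions of the whole word do not do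
    directly. *)
Definition trace (x : list nat) : list (list nat * nat) :=
  map (fun i => (firstn i x, sym x i)) (seq 1 (length x - 1)).

Lemma trace_snoc s a : s <> nil -> trace (s ++ [a]) = trace s ++ [(s, a)].
Proof.
  intros Hs.
  assert (Hl : (1 <= length s)%nat) by (destruct s; [congruence|simpl; lia]).
  unfold trace; rewrite length_app; simpl length.
  replace (length s + 1 - 1)%nat with (length s - 1 + 1)%nat by lia.
  rewrite seq_app, map_app. f_equal.
  - apply map_ext_in; intros i Hi; apply in_seq in Hi; f_equal.
    + rewrite firstn_app; replace (i - length s)%nat with 0%nat by lia.
      simpl; apply app_nil_r.
    + unfold sym; apply app_nth1; lia.
  - cbn [seq map]. replace (1 + (length s - 1))%nat with (length s) by lia.
    f_equal; f_equal.
    + rewrite firstn_app, Nat.sub_diag, firstn_all; apply app_nil_r.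
    + unfold sym; rewrite app_nth2, Nat.sub_diag by lia; reflexivity.
Qed.

Definition pred_step (sa : list nat * nat) : R :=
  pred_prob (fst sa) (if (Mthr (fst sa) <? snd sa)%nat then 0%nat else snd sa).

Definition elias_step (sa : list nat * nat) : R :=
  if (Mthr (fst sa) <? snd sa)%nat
  then INR (elias_len (snd sa - Mthr (fst sa) + 1)) else 0.

Lemma ac_prob_trace x : ac_prob x = lprod pred_step (trace x) * pred_prob x 0.
Proof. unfold ac_prob, lprod, trace; rewrite map_map; reflexivity. Qed.

Lemma elias_total_trace x :
  elias_total x = INR (elias_len (hd 0%nat x)) + lsum elias_step (trace x).
Proof. unfold elias_total, lsum, trace; rewrite map_map; reflexivity. Qed.

Lemma pred_prob_pos s j : (1 <= length s)%nat -> 0 < pred_prob s j.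
Proof.
  intros Hs; unfold pred_prob; pose proof (pos_INR (cnt j s)); pose proof (pos_INR (Mthr s)).
  assert (1 <= INR (length s)) by (change 1 with (INR 1); apply le_INR, Hs).
  apply Rdiv_lt_0_compat; lra.
Qed.

Lemma trace_length x sa : In sa (trace x) -> (1 <= length (fst sa))%nat.
Proof.
  unfold trace; rewrite in_map_iff; intros (i & <- & Hi); apply in_seq in Hi; simpl.
  rewrite length_firstn; lia.
Qed.

Lemma ac_prob_pos x : (1 <= length x)%nat -> 0 < ac_prob x.
Proof.
  intros Hx; rewrite ac_prob_trace; apply Rmult_lt_0_compat; [|apply pred_prob_pos, Hx].
  apply lprod_pos; intros sa H; apply pred_prob_pos, (trace_length _ _ H).
Qed.

Lemma count_le_sum s M :
  lsum (fun j => INR (count_occ Nat.eq_dec s j)) (seq 1 M) <= INR (length s).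
Proof.
  induction s as [|a s IH].
  - simpl; rewrite lsum_zero; lra.
  - simpl length; rewrite S_INR.
    apply Rle_trans with (lsum (fun j => (if (j =? a)%nat then 1 else 0) +
       INR (count_occ Nat.eq_dec s j)) (seq 1 M)).
    + apply lsum_le; intros j _; simpl.
      destruct (Nat.eq_dec a j), (Nat.eqb_spec j a); try congruence; rewrite ?S_INR; lra.
    + rewrite lsum_plus.
      enough (lsum (fun j => if (j =? a)%nat then 1 else 0) (seq 1 M) <= 1) by lra.
      destruct (in_dec Nat.eq_dec a (seq 1 M)) as [H|H].
      * rewrite lsum_indicator; [lra|apply seq_NoDup|assumption].
      * rewrite (lsum_ext _ (fun _ => 0)), lsum_zero; [lra|].
        intros j Hj; destruct (Nat.eqb_spec j a); [subst; contradiction|reflexivity].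
Qed.

(** [Nat.log2] is constant on each dyadic block from 2^l to 2^(l+1) - 1, which has 2^l elements. *)
Lemma lsum_log2_dyadic (v : nat -> R) k :
  lsum (fun m => v (Nat.log2 m)) (seq 1 (2 ^ k - 1)) =
  lsum (fun l => 2 ^ l * v l) (seq 0 k).
Proof.
  induction k as [|k IH]; [reflexivity|].
  rewrite seq_S, lsum_app, <- IH.
  assert (Hk : (1 <= 2 ^ k)%nat) by (apply Nat.neq_0_lt_0, Nat.pow_nonzero; lia).
  replace (2 ^ S k - 1)%nat with ((2 ^ k - 1) + 2 ^ k)%nat by (simpl; lia).
  rewrite seq_app, lsum_app; f_equal.
  rewrite (lsum_ext _ (fun _ => v k)), lsum_const, length_seq.
  - rewrite pow_INR, Nat.add_0_l, lsum_cons; change (INR 2) with 2.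
    change (lsum (fun l => 2 ^ l * v l) nil) with 0; ring.
  - intros m Hm; apply in_seq in Hm; f_equal; apply Nat.log2_unique; simpl; lia.
Qed.

Lemma geometric_half_le k : lsum (fun l => (/ 2) ^ S l) (seq 0 k) <= 1.
Proof.
  enough (lsum (fun l => (/ 2) ^ S l) (seq 0 k) = 1 - (/ 2) ^ k) as ->.
  { pose proof (pow_lt (/ 2) k); lra. }
  induction k as [|k IH]; [unfold lsum; simpl; ring|].
  rewrite seq_S, lsum_app, IH; unfold lsum; simpl; lra.
Qed.

Lemma lsum_seq_widen (g : nat -> R) i k l :
  (k <= l)%nat -> (forall m, 0 <= g m) -> lsum g (seq i k) <= lsum g (seq i l).
Proof.
  intros H Hg; replace l with (k + (l - k))%nat by lia.
  rewrite seq_app, lsum_app.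
  pose proof (lsum_nonneg g (seq (i + k) (l - k)) (fun a _ => Hg a)); lra.
Qed.

(** The length depends on m only through l = log2 m, and after summation over dyadic blocks the
    remainder depends on l + 1 only through its own log2. Two dyadic summations therefore reduce the
    sum to a geometric series of ratio 1/2; each is preceded by widening the range to full
    blocks. *)
Lemma elias_kraft R : lsum (fun m => (/ 2) ^ elias_len m) (seq 1 R) <= 1.
Proof.
  assert (Hh : forall k, 0 <= (/ 2) ^ k) by (intros; apply pow_le; lra).
  assert (Hpow : forall k, (k <= 2 ^ k - 1)%nat).
  { intros k; pose proof (Nat.pow_gt_lin_r 2 k); lia. }
  assert (H2 : forall k, 2 ^ k * (/ 2) ^ k = 1).
  { intros k; rewrite <- Rpow_mult_distr, Rinv_r, pow1; lra. }
  eapply Rle_trans; [apply (lsum_seq_widen _ 1 R (2 ^ R - 1)); auto|].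
  unfold elias_len.
  rewrite (lsum_log2_dyadic (fun l => (/ 2) ^ (l + 2 * Nat.log2 (l + 1) + 1))).
  rewrite (lsum_ext _ (fun l => (/ 2) ^ (2 * Nat.log2 (S l) + 1))).
  2:{ intros l _; rewrite <- Nat.add_assoc, pow_add, <- Rmult_assoc, H2, Rmult_1_l, (Nat.add_1_r l).
      reflexivity. }
  rewrite <- (lsum_map S (fun m => (/ 2) ^ (2 * Nat.log2 m + 1))), seq_shift.
  eapply Rle_trans; [apply (lsum_seq_widen (fun m => (/ 2) ^ (2 * Nat.log2 m + 1)) 1 R (2 ^ R - 1)); auto|].
  rewrite (lsum_log2_dyadic (fun l => (/ 2) ^ (2 * l + 1))).
  rewrite (lsum_ext _ (fun l => (/ 2) ^ S l)); [apply geometric_half_le|].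
  intros l _; replace (2 * l + 1)%nat with (l + S l)%nat by lia.
  rewrite pow_add, <- Rmult_assoc, H2; ring.
Qed.

(** Each symbol up to the threshold uses its own predictive mass, and all censored symbols share the
    mass of 0 through the Elias code. The M + 1 halves in the numerators are matched by (M + 1) / 2
    in the denominator. *)
Lemma pred_step_kraft s K :
  s <> nil ->
  lsum (fun a => pred_step (s, a) * Rpower 2 (- elias_step (s, a))) (seq 1 K) <= 1.
Proof.
  intros Hs.
  assert (Hl : (1 <= length s)%nat) by (destruct s; [congruence|simpl; lia]).
  assert (Hnn : forall a, 0 <= pred_step (s, a) * Rpower 2 (- elias_step (s, a))).
  { intros a; apply Rmult_le_pos; [apply Rlt_le, pred_prob_pos, Hl|apply Rlt_le, exp_pos]. }
  set (M := Mthr s).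
  eapply Rle_trans; [apply (lsum_seq_widen _ 1 K (M + K)); [lia|assumption]|].
  rewrite seq_app, lsum_app.
  assert (H1 : lsum (fun a => pred_step (s, a) * Rpower 2 (- elias_step (s, a))) (seq 1 M)
             = lsum (fun j => pred_prob s j) (seq 1 M)).
  { apply lsum_ext; intros a Ha; apply in_seq in Ha.
    unfold pred_step, elias_step; simpl fst; simpl snd; fold M.
    destruct (Nat.ltb_spec M a); [lia|]. rewrite Ropp_0, Rpower_O by lra; ring. }
  assert (H2 : lsum (fun a => pred_step (s, a) * Rpower 2 (- elias_step (s, a))) (seq (1 + M) K)
             <= pred_prob s 0).
  { apply Rle_trans with (pred_prob s 0 * lsum (fun a => (/ 2) ^ elias_len (a - M + 1)) (seq (1 + M) K)).
    - rewrite <- lsum_scal; apply Req_le, lsum_ext; intros a Ha; apply in_seq in Ha.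
      unfold pred_step, elias_step; simpl fst; simpl snd; fold M.
      destruct (Nat.ltb_spec M a); [|lia]. f_equal.
      rewrite Rpower_Ropp, Rpower_pow, pow_inv; lra.
    - rewrite <- (Rmult_1_r (pred_prob s 0)) at 2.
      apply Rmult_le_compat_l; [apply Rlt_le, pred_prob_pos, Hl|].
      rewrite <- (lsum_map (fun a => (a - M + 1)%nat) (fun m => (/ 2) ^ elias_len m)).
      (* A censored symbol has [a - M + 1 >= 2], so only the integers from 2 to K + 1 are encoded
         and the codeword of 1 is slack. *)
      eapply Rle_trans; [|apply (elias_kraft (1 + K))].
      rewrite seq_app, lsum_app.
      replace (map (fun a => (a - M + 1)%nat) (seq (1 + M) K)) with (seq (1 + 1) K).
      + enough (0 <= lsum (fun m => (/ 2) ^ elias_len m) (seq 1 1)) by lra.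
        apply lsum_nonneg; intros; apply pow_le; lra.
      + apply nth_ext with 0%nat ((0 - M + 1)%nat); [rewrite length_map, !length_seq; reflexivity|].
        intros i Hi; rewrite length_seq in Hi.
        rewrite (map_nth (fun a => (a - M + 1)%nat)), !seq_nth by lia; lia. }
  rewrite H1.
  enough (lsum (fun j => pred_prob s j) (seq 1 M) + pred_prob s 0 <= 1) by lra.
  unfold pred_prob; fold M; change (cnt 0 s) with 0%nat.
  pose proof (pos_INR M).
  assert (1 <= INR (length s)) by (change 1 with (INR 1); apply le_INR, Hl).
  set (D := INR (length s) + (INR M + 1) / 2). assert (0 < D) by (unfold D; lra).
  apply Rmult_le_reg_l with D; [assumption|]; rewrite Rmult_plus_distr_l, <- lsum_scal.
  rewrite (lsum_ext _ (fun j => INR (count_occ Nat.eq_dec s j) + 1 / 2)).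
  - rewrite lsum_plus, lsum_const, length_seq.
    pose proof (count_le_sum s M). replace (D * ((INR 0 + 1 / 2) / D)) with (1 / 2).
    + unfold D; lra.
    + simpl; field; lra.
  - intros j Hj; apply in_seq in Hj; unfold cnt; destruct (Nat.eqb_spec j 0); [lia|].
    field; lra.
Qed.

(** The ideal weight before the terminating 0: in this form the Kraft sum is stable under appending
    a symbol. The missing factor [pred_prob x 0] is at most 1. *)
Definition code_weight (x : list nat) : R :=
  lprod pred_step (trace x) * Rpower 2 (- elias_total x).

Lemma code_weight_kraft n K : box_sum (S n) K code_weight <= 1.
Proof.
  induction n as [|n IH].
  - rewrite box_sum_S.
    rewrite (lsum_ext _ (fun a => (/ 2) ^ elias_len a)); [apply elias_kraft|].
    intros a _; rewrite box_sum_0; unfold code_weight; rewrite elias_total_trace.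
    change (trace [a]) with (@nil (list nat * nat)).
    change (lprod pred_step nil) with 1; change (lsum elias_step nil) with 0.
    simpl hd; rewrite Rplus_0_r, Rmult_1_l, Rpower_Ropp, Rpower_pow, pow_inv; lra.
  - rewrite box_sum_snoc. eapply Rle_trans; [|exact IH].
    apply box_sum_le; intros s Hs _.
    assert (Hn : s <> nil) by (intros ->; discriminate).
    rewrite (lsum_ext _ (fun a => code_weight s * (pred_step (s, a) * Rpower 2 (- elias_step (s, a))))).
    + rewrite lsum_scal.
      rewrite <- (Rmult_1_r (code_weight s)) at 2.
      apply Rmult_le_compat_l.
      * apply Rmult_le_pos; [|apply Rlt_le, exp_pos].
        apply Rlt_le, lprod_pos; intros sa H; apply pred_prob_pos, (trace_length _ _ H).
      * apply pred_step_kraft, Hn.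
    + intros a _; unfold code_weight; rewrite !elias_total_trace, trace_snoc, lprod_app, lsum_app by assumption.
      replace (hd 0%nat (s ++ [a])) with (hd 0%nat s) by (destruct s; [congruence|reflexivity]).
      rewrite lprod_cons, lsum_cons.
      change (lprod pred_step nil) with 1; change (lsum elias_step nil) with 0.
      rewrite !Ropp_plus_distr, Ropp_0, !Rpower_plus, Rpower_O by lra; ring.
Qed.

(** * Kullback-Leibler divergence and the coding probability *)
Lemma tsum_le n g B : (forall K, box_sum n K g <= B) -> Rbar_le (tsum n g) (Finite B).
Proof.
  intros H. unfold tsum.
  apply (is_sup_seq_lub _ _ (Sup_seq_correct (fun K => Finite (box_sum n K g)))).
  intros x (K & ->); apply H.
Qed.

Lemma box_sum_le_tsum n g K : Rbar_le (Finite (box_sum n K g)) (tsum n g).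
Proof. apply (is_sup_seq_major (fun K => Finite (box_sum n K g))), Sup_seq_correct. Qed.

Lemma tsum_finite n g B : (forall K, box_sum n K g <= B) ->
  exists S, tsum n g = Finite S /\ S <= B /\ forall K, box_sum n K g <= S.
Proof.
  intros H. pose proof (tsum_le n g B H) as H1.
  assert (H2 := box_sum_le_tsum n g).
  destruct (tsum n g) as [S| |]; [|destruct H1|destruct (H2 0%nat)].
  exists S; auto.
Qed.

Lemma box_sum_support n J K g :
  (J <= K)%nat ->
  (forall x, ~ List.Forall (fun a => (a <= J)%nat) x -> g x = 0) ->
  box_sum n K g = box_sum n J g.
Proof.
  intros HJ; revert g; induction n as [|n IH]; intros g Hg.
  - rewrite !box_sum_0; reflexivity.
  - rewrite !box_sum_S.
    assert (HK : seq 1 K = seq 1 J ++ seq (1 + J) (K - J)).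
    { rewrite <- seq_app; f_equal; lia. }
    rewrite HK, lsum_app, (lsum_ext _ (fun _ => 0) (seq (1 + J) (K - J))), lsum_zero, Rplus_0_r.
    + apply lsum_ext; intros a Ha; apply in_seq in Ha; apply (IH (fun l => g (a :: l))).
      intros x Hx; apply Hg; intros Hf; inversion Hf; auto.
    + intros a Ha; apply in_seq in Ha.
      rewrite (box_sum_ext _ _ _ (fun _ => 0)); [apply lsum_zero|].
      intros x _ _; apply Hg; intros Hf; inversion Hf; subst; lia.
Qed.

Lemma tsum_support n J g :
  (forall x, 0 <= g x) ->
  (forall x, ~ List.Forall (fun a => (a <= J)%nat) x -> g x = 0) ->
  tsum n g = Finite (box_sum n J g).
Proof.
  intros Hp Hg; apply Rbar_le_antisym; [|apply box_sum_le_tsum].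
  apply tsum_le; intros K; destruct (Nat.le_ge_cases J K) as [H|H].
  - rewrite (box_sum_support _ _ _ _ H Hg); lra.
  - apply box_sum_mono; assumption.
Qed.

Lemma ln_ge_1_minus_inv x : 0 < x -> 1 - / x <= ln x.
Proof.
  intros Hx. pose proof (exp_ineq1_le (ln (/ x))) as H.
  rewrite exp_ln in H by (apply Rinv_0_lt_compat; assumption).
  rewrite ln_Rinv in H by assumption; lra.
Qed.

Lemma ln_le_minus_1 x : 0 < x -> ln x <= x - 1.
Proof. intros Hx; pose proof (exp_ineq1_le (ln x)) as H; rewrite exp_ln in H; lra. Qed.

Lemma ln2_pos : 0 < ln 2.
Proof. pose proof ln_lt_2; lra. Qed.

(** This is ln t >= 1 - 1 / t at t = p / (q c), that is, the tangent of the logarithm at likelihood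
    ratio c. The free level c allows different tangents on different parts of the space. *)
Lemma kl_term_ge (p q c : R) :
  0 < p -> 0 < q -> 0 < c -> (p * ln c + p - c * q) / ln 2 <= p * log2 (p / q).
Proof.
  intros Hp Hq Hc; unfold log2; pose proof ln2_pos.
  rewrite Rmult_div_assoc. apply Rmult_le_compat_r; [apply Rlt_le, Rinv_0_lt_compat; assumption|].
  assert (0 < p / q) by (apply Rdiv_lt_0_compat; assumption).
  assert (H1 : 1 - / (p / q / c) <= ln (p / q / c)).
  { apply ln_ge_1_minus_inv, Rdiv_lt_0_compat; assumption. }
  rewrite ln_div in H1 by assumption.
  apply Rmult_le_compat_l with (r := p) in H1; [|lra].
  replace (p * (1 - / (p / q / c))) with (p - c * q) in H1 by (field; lra). lra.
Qed.

Lemma kl_term_ge_neg P Q x :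
  0 <= P x -> 0 < Q x -> - kl_term P Q x <= Q x / ln 2.
Proof.
  intros HP HQ; unfold kl_term; pose proof ln2_pos.
  destruct (Req_EM_T (P x) 0) as [E|E].
  - assert (0 < Q x / ln 2) by (apply Rdiv_lt_0_compat; assumption); lra.
  - assert (Hp : 0 < P x) by lra.
    pose proof (kl_term_ge (P x) (Q x) 1 Hp HQ Rlt_0_1) as H1; rewrite ln_1 in H1.
    apply Rle_trans with (- ((P x * 0 + P x - 1 * Q x) / ln 2)); [lra|].
    unfold Rdiv; rewrite Ropp_mult_distr_l.
    apply Rmult_le_compat_r; [apply Rlt_le, Rinv_0_lt_compat; assumption|lra].
Qed.

(** Each negative part is at most [Q x / ln 2], so their total is finite and [KL] is not a
    difference of infinities; signed box sums then control the positive parts. *)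
Lemma KL_le n P Q B :
  (forall x, is_word n x -> 0 <= P x) ->
  (forall x, is_word n x -> 0 < Q x) ->
  (forall K, box_sum n K Q <= 1) ->
  (forall K, box_sum n K (kl_term P Q) <= B) ->
  Rbar_le (KL n P Q) (Finite B).
Proof.
  intros HP HQ HQ1 HB; unfold KL.
  destruct (excluded_middle_informative _) as [(x & Hx & _ & H0)|_].
  { specialize (HQ x Hx); lra. }
  assert (Hw : forall K x, length x = n -> List.Forall (fun a => (1 <= a <= K)%nat) x -> is_word n x).
  { intros K x H1 H2; split; [assumption|].
    eapply Forall_impl; [|exact H2]; simpl; intros; lia. }
  pose proof ln2_pos.
  destruct (tsum_finite n (fun x => Rmax (- kl_term P Q x) 0) (/ ln 2)) as (S & HS & _ & HS2).
  { intros K; apply Rle_trans with (box_sum n K (fun x => / ln 2 * Q x)).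
    - apply box_sum_le; intros x H1 H2; specialize (Hw _ _ H1 H2).
      apply Rmax_lub.
      + pose proof (kl_term_ge_neg P Q x (HP x Hw) (HQ x Hw)); lra.
      + apply Rmult_le_pos; [apply Rlt_le, Rinv_0_lt_compat; assumption|apply Rlt_le, HQ, Hw].
    - rewrite box_sum_scal.
      rewrite <- (Rmult_1_r (/ ln 2)) at 2.
      apply Rmult_le_compat_l; [apply Rlt_le, Rinv_0_lt_compat; assumption|apply HQ1]. }
  rewrite HS.
  assert (H1 : Rbar_le (tsum n (fun x => Rmax (kl_term P Q x) 0)) (Finite (B + S))).
  { apply tsum_le; intros K; specialize (HB K); specialize (HS2 K).
    assert (E : box_sum n K (fun x => Rmax (kl_term P Q x) 0) =
      box_sum n K (kl_term P Q) + box_sum n K (fun x => Rmax (- kl_term P Q x) 0)).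
    { rewrite <- box_sum_plus; apply box_sum_ext; intros x _ _.
      unfold Rmax; repeat destruct (Rle_dec _ _); lra. }
    lra. }
  destruct (tsum n (fun x => Rmax (kl_term P Q x) 0)); simpl in *; lra.
Qed.

(** A region [A] likely under P but of Q-mass at most 1 / L forces divergence about ln L. The
    tangent at ratio L is used on [A] and the one at ratio 1 outside; the additive loss is 1 because
    P has mass 1 while L Q(A) and the total mass of Q are each at most 1. *)
Lemma KL_ge n P Q J (A : list nat -> bool) L eta :
  (forall x, List.Forall (fun a => (1 <= a)%nat) x -> 0 <= P x) ->
  (forall x, ~ List.Forall (fun a => (a <= J)%nat) x -> P x = 0) ->
  box_sum n J P = 1 ->
  (forall x, 0 <= Q x) -> box_sum n J Q <= 1 ->
  1 <= L ->
  box_sum n J (fun x => if A x then Q x else 0) <= / L ->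
  1 - eta <= box_sum n J (fun x => if A x then P x else 0) ->
  Rbar_le (Finite (((1 - eta) * ln L - 1) / ln 2)) (KL n P Q).
Proof.
  intros HP HPJ HP1 HQ HQ1 HL HQA HPA; unfold KL.
  destruct (excluded_middle_informative _) as [_|Hn]; [exact I|].
  assert (Hk0 : forall x, ~ List.Forall (fun a => (a <= J)%nat) x -> kl_term P Q x = 0).
  { intros x Hx; unfold kl_term; rewrite (HPJ x Hx); destruct (Req_EM_T 0 0); congruence. }
  rewrite !(tsum_support n J).
  2, 4: intros; apply Rmax_r.
  2, 3: intros x Hx; rewrite (Hk0 x Hx), ?Ropp_0; unfold Rmax; destruct (Rle_dec _ _); reflexivity.
  simpl.
  rewrite <- (Rmult_1_l (box_sum n J (fun x => Rmax (- _) 0))), Ropp_mult_distr_l,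
    <- box_sum_scal, <- box_sum_plus.
  pose proof ln2_pos as Hln2.
  apply Rle_trans with (box_sum n J (fun x => / ln 2 *
     ((ln L * (if A x then P x else 0) + P x) +
      ((- L) * (if A x then Q x else 0) + (- 1) * Q x)))).
  - rewrite box_sum_scal, !box_sum_plus, !box_sum_scal, HP1.
    unfold Rdiv; rewrite Rmult_comm. apply Rmult_le_compat_l.
    + apply Rlt_le, Rinv_0_lt_compat; assumption.
    + assert (0 <= ln L) by (rewrite <- ln_1; apply ln_le; lra).
      assert (L * box_sum n J (fun x => if A x then Q x else 0) <= 1).
      { apply Rle_trans with (L * / L); [apply Rmult_le_compat_l; lra|rewrite Rinv_r; lra]. }
      pose proof (Rmult_le_compat_l (ln L) _ _ H HPA). lra.
  - apply box_sum_le; intros x Hx Hf.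
    assert (Hf1 : List.Forall (fun a => (1 <= a)%nat) x).
    { eapply Forall_impl; [|exact Hf]; simpl; intros; lia. }
    replace (Rmax (kl_term P Q x) 0 + - (1) * Rmax (- kl_term P Q x) 0) with (kl_term P Q x)
      by (unfold Rmax; repeat destruct (Rle_dec _ _); lra).
    pose proof (HP x Hf1) as HPx. pose proof (HQ x) as HQx.
    assert (Hi : 0 < / ln 2) by (apply Rinv_0_lt_compat; assumption).
    unfold kl_term; destruct (Req_EM_T (P x) 0) as [E|E].
    + rewrite E. assert (0 <= L * Q x) by (apply Rmult_le_pos; lra).
      enough (0 <= / ln 2 * - ((ln L * (if A x then 0 else 0) + 0) +
        ((- L) * (if A x then Q x else 0) + (- 1) * Q x))) by lra.
      apply Rmult_le_pos; [lra|]. destruct (A x); lra.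
    + assert (Hp : 0 < P x) by lra.
      assert (Hq : 0 < Q x).
      { destruct HQx as [H|H]; [assumption|]. exfalso; apply Hn; exists x; repeat split; auto. }
      destruct (A x).
      * eapply Rle_trans; [|apply (kl_term_ge (P x) (Q x) L); lra].
        unfold Rdiv; rewrite (Rmult_comm _ (/ ln 2)); apply Rmult_le_compat_l; [lra|].
        assert (0 <= L * Q x) by (apply Rmult_le_pos; lra). lra.
      * eapply Rle_trans; [|apply (kl_term_ge (P x) (Q x) 1); lra].
        rewrite ln_1; unfold Rdiv; rewrite (Rmult_comm _ (/ ln 2)); apply Rmult_le_compat_l; lra.
Qed.

Lemma pred_prob_0_le_1 s : (1 <= length s)%nat -> pred_prob s 0 <= 1.
Proof.
  intros Hs; unfold pred_prob; change (cnt 0 s) with 0%nat; simpl INR.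
  pose proof (pos_INR (Mthr s)).
  assert (1 <= INR (length s)) by (change 1 with (INR 1); apply le_INR, Hs).
  apply Rle_div_l; lra.
Qed.

Section Normalisation.

Variables (lac : list nat -> R) (n : nat).
Hypotheses (Hlac : arith_coder_len lac) (Hn : (1 <= n)%nat).

Let w (x : list nat) : R := Rpower 2 (- etac_len lac x).

Lemma Rpower_log2 x : 0 < x -> Rpower 2 (log2 x) = x.
Proof.
  intros Hx; unfold Rpower, log2. pose proof ln2_pos.
  replace (ln x / ln 2 * ln 2) with (ln x) by (field; lra). apply exp_ln, Hx.
Qed.

Lemma etac_weight_le x : is_word n x -> w x <= code_weight x.
Proof.
  intros [Hl Hf]; unfold w, etac_len, code_weight.
  destruct (Hlac x ltac:(lia) Hf) as [H _].
  assert (Hac : 0 < ac_prob x) by (apply ac_prob_pos; lia).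
  apply Rle_trans with (ac_prob x * Rpower 2 (- elias_total x)).
  - rewrite Ropp_plus_distr, Rpower_plus; apply Rmult_le_compat_r; [apply Rlt_le, exp_pos|].
    rewrite <- (Rpower_log2 (ac_prob x)) by assumption.
    apply Rle_Rpower; lra.
  - apply Rmult_le_compat_r; [apply Rlt_le, exp_pos|].
    rewrite ac_prob_trace; rewrite <- (Rmult_1_r (lprod pred_step (trace x))) at 2.
    apply Rmult_le_compat_l; [|apply pred_prob_0_le_1; lia].
    apply Rlt_le, lprod_pos; intros sa H1; apply pred_prob_pos, (trace_length _ _ H1).
Qed.

Lemma etac_normalisation :
  exists S, tsum n w = Finite S /\ 0 < S <= 1 /\ forall K, box_sum n K w <= S.
Proof.
  destruct (tsum_finite n w 1) as (S & H1 & H2 & H3).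
  - intros K; pose proof (code_weight_kraft (n - 1) K) as HK.
    replace (S (n - 1)) with n in HK by lia.
    eapply Rle_trans; [|exact HK].
    apply box_sum_le; intros x Hx Hf; apply etac_weight_le; split; [assumption|].
    eapply Forall_impl; [|exact Hf]; simpl; intros; lia.
  - exists S; repeat split; try assumption.
    (* The box over the alphabet {1} contains the word 1...1, whose weight is positive. *)
    eapply Rlt_le_trans; [|apply (H3 1%nat)].
    apply Rlt_le_trans with (w (repeat 1%nat n)); [apply exp_pos|].
    rewrite box_sum_lsum; apply (lsum_term w); [intros; apply Rlt_le, exp_pos|].
    apply in_boxes; split; [apply repeat_length|].
    apply Forall_forall; intros a Ha; apply repeat_spec in Ha; lia.
Qed.

Lemma etac_is_prob : is_prob n (etac_prob lac n).
Proof.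
  destruct etac_normalisation as (S & H1 & H2 & H3).
  unfold is_prob, etac_prob; change (fun y => Rpower 2 (- etac_len lac y)) with w; rewrite H1; simpl.
  split.
  - intros x; apply Rmult_le_pos; [apply Rlt_le, exp_pos|apply Rlt_le, Rinv_0_lt_compat, H2].
  - assert (E : forall K, box_sum n K (fun x => Rpower 2 (- etac_len lac x) / S) = / S * box_sum n K w).
    { intros K; rewrite <- box_sum_scal; apply box_sum_ext; intros; unfold w, Rdiv; ring. }
    assert (Hi : 0 < / S) by (apply Rinv_0_lt_compat, H2).
    destruct (tsum_finite n (fun x => Rpower 2 (- etac_len lac x) / S) 1) as (T & HT1 & HT2 & HT3).
    { intros K; rewrite E, <- (Rinv_l S) by lra. apply Rmult_le_compat_l; [lra|apply H3]. }
    rewrite HT1; f_equal; apply Rle_antisym; [assumption|].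
    assert (HST : Rbar_le (tsum n w) (Finite (S * T))).
    { apply tsum_le; intros K; specialize (HT3 K); rewrite E in HT3.
      apply Rmult_le_compat_l with (r := S) in HT3; [|lra].
      rewrite <- Rmult_assoc, Rinv_r, Rmult_1_l in HT3; lra. }
    rewrite H1 in HST; simpl in HST. apply Rmult_le_reg_l with S; lra.
Qed.

Lemma etac_prob_pos x : 0 < etac_prob lac n x.
Proof.
  destruct etac_normalisation as (S & H1 & H2 & H3).
  unfold etac_prob; change (fun y => Rpower 2 (- etac_len lac y)) with w; rewrite H1; simpl.
  apply Rdiv_lt_0_compat; [apply exp_pos|apply H2].
Qed.

(** The Kraft sum is at most 1, so normalisation can only shorten the code; the 2 is the slack of
    the arithmetic coder. *)
Lemma etac_prob_log2 x : is_word n x ->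
  - log2 (etac_prob lac n x) <= - log2 (ac_prob x) + 2 + elias_total x.
Proof.
  intros [Hl Hf]; destruct etac_normalisation as (S & H1 & H2 & H3).
  destruct (Hlac x ltac:(lia) Hf) as [_ H].
  unfold etac_prob; change (fun y => Rpower 2 (- etac_len lac y)) with w; rewrite H1; simpl real.
  pose proof ln2_pos.
  assert (E : log2 (Rpower 2 (- etac_len lac x) / S) = - etac_len lac x - log2 S).
  { unfold log2; rewrite ln_div by (apply exp_pos || apply H2).
    unfold Rpower; rewrite ln_exp; field; lra. }
  assert (log2 S <= 0).
  { unfold log2; apply Rle_div_l; [assumption|]. rewrite Rmult_0_l, <- ln_1; apply ln_le; lra. }
  rewrite E; unfold etac_len; lra.
Qed.

End Normalisation.

(** * Pointwise bound on the arithmetic coder *)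
Lemma sum_f_R0_term (g : nat -> R) N i :
  (forall k, 0 <= g k) -> (i <= N)%nat -> g i <= sum_f_R0 g N.
Proof.
  intros Hg; induction N as [|N IH]; intros Hi; simpl.
  - replace i with 0%nat by lia; lra.
  - destruct (Nat.eq_dec i (S N)) as [->|].
    + pose proof (cond_pos_sum g N Hg); lra.
    + specialize (IH ltac:(lia)); specialize (Hg (S N)); lra.
Qed.

Lemma binomial_term (x y : R) a b :
  0 <= x -> 0 <= y ->
  x ^ a / INR (fact a) * (y ^ b / INR (fact b)) <= (x + y) ^ (a + b) / INR (fact (a + b)).
Proof.
  intros Hx Hy.
  pose proof (INR_fact_lt_0 a); pose proof (INR_fact_lt_0 b); pose proof (INR_fact_lt_0 (a + b)).
  apply (proj1 (Rle_div_r _ _ _ H1)).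
  rewrite binomial.
  eapply Rle_trans; [|apply (sum_f_R0_term _ (a + b) a); [|lia]].
  - unfold Binomial.C; replace (a + b - a)%nat with b by lia.
    apply Req_le; field; lra.
  - intros k; apply Rmult_le_pos; [|apply pow_le; assumption].
    apply Rmult_le_pos; [|apply pow_le; assumption].
    unfold Binomial.C; apply Rlt_le, Rdiv_lt_0_compat; [apply INR_fact_lt_0|].
    apply Rmult_lt_0_compat; apply INR_fact_lt_0.
Qed.

(** Symbols are merged one at a time, each merge being a single term of a binomial expansion. *)
Lemma multinomial_term (p : nat -> R) (c : nat -> nat) K :
  (forall j, (1 <= j)%nat -> 0 <= p j) ->
  lprod (fun j => p j ^ c j / INR (fact (c j))) (seq 1 K) <=
  (lsum p (seq 1 K)) ^ (list_sum (map c (seq 1 K))) / INR (fact (list_sum (map c (seq 1 K)))).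
Proof.
  intros Hp; induction K as [|K IH].
  - simpl; unfold lprod; simpl; lra.
  - rewrite seq_S, lprod_app, lsum_app, map_app, list_sum_app.
    assert (E1 : lprod (fun j => p j ^ c j / INR (fact (c j))) [1 + K]%nat
              = p (S K) ^ c (S K) / INR (fact (c (S K)))) by (unfold lprod; simpl; ring).
    assert (E2 : lsum p [1 + K]%nat = p (S K)) by (unfold lsum; simpl; ring).
    assert (E3 : list_sum (map c [1 + K]%nat) = c (S K)) by (simpl; lia).
    rewrite E1, E2, E3.
    eapply Rle_trans; [|apply binomial_term].
    + apply Rmult_le_compat_r; [|exact IH].
      apply Rmult_le_pos; [apply pow_le, Hp; lia|apply Rlt_le, Rinv_0_lt_compat, INR_fact_lt_0].
    + apply lsum_nonneg; intros j Hj; apply in_seq in Hj; apply Hp; lia.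
    + apply Hp; lia.
Qed.

Lemma lprod_update (g g' : nat -> R) (c : R) a l :
  NoDup l -> In a l -> g' a = c * g a -> (forall j, j <> a -> g' j = g j) ->
  lprod g' l = c * lprod g l.
Proof.
  induction l as [|b l IH]; intros Hnd Hin Ha Hj; [destruct Hin|].
  inversion Hnd as [|? ? Hb Hl]; subst; rewrite !lprod_cons.
  destruct (Nat.eq_dec b a) as [->|Hba].
  - rewrite Ha, (lprod_ext g' g l); [ring|].
    intros j Hjl; apply Hj; intros ->; contradiction.
  - destruct Hin as [->|Hin]; [congruence|].
    rewrite IH, (Hj b) by assumption; ring.
Qed.

Lemma list_sum_update (c c' : nat -> nat) a l :
  NoDup l -> In a l -> c' a = S (c a) -> (forall j, j <> a -> c' j = c j) ->
  list_sum (map c' l) = S (list_sum (map c l)).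
Proof.
  induction l as [|b l IH]; intros Hnd Hin Ha Hj; [destruct Hin|].
  inversion Hnd as [|? ? Hb Hl]; subst; simpl.
  destruct (Nat.eq_dec b a) as [->|Hba].
  - rewrite Ha, (map_ext_in c' c l); [lia|].
    intros j Hjl; apply Hj; intros ->; contradiction.
  - destruct Hin as [->|Hin]; [congruence|].
    rewrite IH, (Hj b) by assumption; lia.
Qed.

Local Notation count := (count_occ Nat.eq_dec).

Lemma Pn_as_type p s K :
  List.Forall (fun a => (1 <= a <= K)%nat) s ->
  Pn p s = lprod (fun j => p j ^ count s j) (seq 1 K) /\
  list_sum (map (count s) (seq 1 K)) = length s.
Proof.
  induction 1 as [|a s Ha Hs [IH1 IH2]].
  - split.
    + rewrite (lprod_ext _ (fun _ => 1)) by reflexivity.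
      change (Pn p nil) with 1.
      induction (seq 1 K) as [|b l IH]; [reflexivity|]. rewrite lprod_cons, <- IH; ring.
    + induction (seq 1 K) as [|b l IH]; [reflexivity|]. simpl in *; lia.
  - assert (Hin : In a (seq 1 K)) by (apply in_seq; lia).
    split.
    + rewrite Pn_cons, IH1; symmetry; apply lprod_update with a; [apply seq_NoDup|assumption| |].
      * rewrite count_occ_cons_eq; reflexivity.
      * intros j Hj; rewrite count_occ_cons_neq; congruence.
    + simpl length; rewrite <- IH2; apply list_sum_update with a; [apply seq_NoDup|assumption| |].
      * rewrite count_occ_cons_eq; reflexivity.
      * intros j Hj; rewrite count_occ_cons_neq; congruence.
Qed.

(** The denominator of the multinomial coefficient that counts the words with the same symbol counts
    as [s]. *)
Definition type_fact (K : nat) (s : list nat) : R :=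
  lprod (fun j => INR (fact (count s j))) (seq 1 K).

Lemma lprod_div {A} (g h : A -> R) l :
  lprod (fun a => g a / h a) l = lprod g l / lprod h l.
Proof.
  induction l as [|a l IH]; [unfold lprod; simpl; field|].
  rewrite !lprod_cons, IH; unfold Rdiv; rewrite Rinv_mult; ring.
Qed.

Lemma type_fact_pos K s : 0 < type_fact K s.
Proof. apply lprod_pos; intros; apply INR_fact_lt_0. Qed.

(** The class of all rearrangements of [s] has probability at most 1. *)
Lemma Pn_le_type_fact p s K :
  (forall j, (1 <= j)%nat -> 0 <= p j) -> lsum p (seq 1 K) <= 1 ->
  List.Forall (fun a => (1 <= a <= K)%nat) s ->
  Pn p s * INR (fact (length s)) <= type_fact K s.
Proof.
  intros Hp H1 Hs; destruct (Pn_as_type p s K Hs) as [E1 E2].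
  pose proof (multinomial_term p (count s) K Hp) as H.
  rewrite lprod_div, <- E1, E2 in H; fold (type_fact K s) in H.
  pose proof (type_fact_pos K s); pose proof (INR_fact_lt_0 (length s)).
  apply (fun Hc => proj1 (Rle_div_l _ _ _ Hc)) in H; [|assumption].
  assert (lsum p (seq 1 K) ^ length s <= 1).
  { rewrite <- (pow1 (length s)); apply pow_incr; split; [|assumption].
    apply lsum_nonneg; intros j Hj; apply in_seq in Hj; apply Hp; lia. }
  apply Rle_trans with (lsum p (seq 1 K) ^ length s / INR (fact (length s)) * type_fact K s * INR (fact (length s))).
  - apply Rmult_le_compat_r; lra.
  - replace (lsum p (seq 1 K) ^ length s / INR (fact (length s)) * type_fact K s * INR (fact (length s)))
      with (lsum p (seq 1 K) ^ length s * type_fact K s) by (field; lra).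
    rewrite <- (Rmult_1_l (type_fact K s)) at 2. apply Rmult_le_compat_r; lra.
Qed.

Lemma type_fact_snoc K s a : (1 <= a <= K)%nat ->
  type_fact K (s ++ [a]) = (INR (count s a) + 1) * type_fact K s.
Proof.
  intros Ha; apply lprod_update with a; [apply seq_NoDup|apply in_seq; lia| |].
  - rewrite count_occ_app, count_occ_cons_eq by reflexivity; simpl.
    rewrite Nat.add_1_r, fact_simpl, mult_INR, S_INR; reflexivity.
  - intros j Hj; rewrite count_occ_app, count_occ_cons_neq by congruence; simpl.
    rewrite Nat.add_0_r; reflexivity.
Qed.

(** * Krichevsky-Trofimov weights against the multinomial coefficient *)

Definition num_step (sa : list nat * nat) : R :=
  if (Mthr (fst sa) <? snd sa)%nat then 1 / 2 else INR (count (fst sa) (snd sa)) + 1 / 2.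
Definition den (s : list nat) : R := INR (length s) + (INR (Mthr s) + 1) / 2.
(** For a censored symbol the coder's numerator is 1/2, while the factorials contribute up to the
    threshold plus 1; the quotient is the price of censoring. *)
Definition cens_step (sa : list nat * nat) : R :=
  if (Mthr (fst sa) <? snd sa)%nat then 2 * (INR (Mthr (fst sa)) + 1) else 1.
Definition count_prod (M : nat) (s : list nat) : R :=
  lprod (fun j => INR (count s j) + 1) (seq 1 M).

Lemma count_prod_mono M N s t :
  (M <= N)%nat -> (forall j, (count s j <= count t j)%nat) ->
  count_prod M s <= count_prod N t.
Proof.
  intros HMN Hst; unfold count_prod.
  replace N with (M + (N - M))%nat by lia; rewrite seq_app, lprod_app.
  rewrite <- (Rmult_1_r (lprod _ (seq 1 M))) at 1.
  assert (Hc : forall u (l : list nat), 1 <= lprod (fun j => INR (count u j) + 1) l).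
  { intros u l; induction l as [|b l IH]; [apply Rle_refl|]. rewrite lprod_cons.
    pose proof (pos_INR (count u b)). rewrite <- (Rmult_1_r 1) at 1.
    apply Rmult_le_compat; lra. }
  apply Rmult_le_compat; try lra; [pose proof (Hc s (seq 1 M)); lra| |apply Hc].
  induction (seq 1 M) as [|b l IH]; [apply Rle_refl|]. rewrite !lprod_cons.
  pose proof (pos_INR (count s b)). pose proof (Hc s l). pose proof (le_INR _ _ (Hst b)).
  apply Rmult_le_compat; lra.
Qed.

Lemma count_prod_le M s : count_prod M s <= (INR (length s) + 1) ^ M.
Proof.
  assert (H : forall i, lprod (fun j => INR (count s j) + 1) (seq i M) <= (INR (length s) + 1) ^ M).
  { induction M as [|M IH]; intros i; [apply Rle_refl|].
    simpl seq; rewrite lprod_cons; simpl pow.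
    pose proof (pos_INR (count s i)).
    assert (INR (count s i) <= INR (length s)) by (apply le_INR, count_occ_bound).
    apply Rmult_le_compat; [lra| |lra|apply IH].
    apply Rlt_le, lprod_pos; intros j _; pose proof (pos_INR (count s j)); lra. }
  apply H.
Qed.

Lemma count_le_exceed s a k : (k < a)%nat -> (count s a <= exceed k s)%nat.
Proof.
  intros Ha; induction s as [|b s IH]; [simpl; lia|].
  rewrite exceed_cons; simpl; destruct (Nat.eq_dec b a), (Nat.ltb_spec k b); lia.
Qed.

(** One symbol at a time. An uncensored symbol of count c raises [count_prod] by at least (c + 2) /
    (c + 1), and (c + 1)^2 <= (c + 1/2) (c + 2). For a censored one, c is at most the number of
    symbols above the threshold, hence at most [Mthr s]. *)
Lemma type_fact_le K s :
  s <> nil -> List.Forall (fun a => (1 <= a <= K)%nat) s ->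
  type_fact K s <=
  lprod num_step (trace s) * count_prod (Mthr s) s * lprod cens_step (trace s).
Proof.
  induction s as [|a s IH] using rev_ind; [congruence|]; intros _ Hf.
  apply Forall_app in Hf; destruct Hf as [Hf Ha]; inversion Ha as [|? ? Ha1 _]; subst.
  rewrite type_fact_snoc by assumption.
  destruct (list_eq_dec Nat.eq_dec s nil) as [->|Hs].
  { rewrite app_nil_l; change (trace [a]) with (@nil (list nat * nat)).
    assert (E : type_fact K nil = 1).
    { unfold type_fact; induction (seq 1 K) as [|b l IHl]; [reflexivity|].
      rewrite lprod_cons, IHl; simpl; ring. }
    rewrite E; simpl INR.
    pose proof (count_prod_mono 0 (Mthr [a]) nil [a] ltac:(lia) ltac:(intros; simpl; lia)) as H.
    change (count_prod 0 nil) with 1 in H.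
    change (lprod num_step nil) with 1; change (lprod cens_step nil) with 1; lra. }
  specialize (IH Hs Hf).
  rewrite trace_snoc, !lprod_app, !lprod_cons by assumption.
  change (lprod num_step nil) with 1; change (lprod cens_step nil) with 1.
  pose proof (Mthr_snoc s a Hs) as HM.
  set (N := lprod num_step (trace s)) in *. set (H := lprod cens_step (trace s)) in *.
  set (c := count s a) in *. pose proof (pos_INR c) as Hc.
  assert (HN : 0 < N).
  { apply lprod_pos; intros [t b] _; unfold num_step; simpl.
    pose proof (pos_INR (count t b)); destruct (_ <? _)%nat; lra. }
  assert (HH : 0 < H).
  { apply lprod_pos; intros [t b] _; unfold cens_step; simpl.
    pose proof (pos_INR (Mthr t)); destruct (_ <? _)%nat; lra. }
  apply Rle_trans with ((INR c + 1) * (N * count_prod (Mthr s) s * H)).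
  { apply Rmult_le_compat_l; lra. }
  enough (HE : (INR c + 1) * count_prod (Mthr s) s <=
     num_step (s, a) * cens_step (s, a) * count_prod (Mthr (s ++ [a])) (s ++ [a])).
  { apply Rmult_le_compat_l with (r := N * H) in HE; [|apply Rlt_le, Rmult_lt_0_compat; assumption].
    lra. }
  assert (Hcnt : forall j, (count s j <= count (s ++ [a]) j)%nat).
  { intros j; rewrite count_occ_app; lia. }
  assert (HP : 0 < count_prod (Mthr s) s).
  { apply lprod_pos; intros j _; pose proof (pos_INR (count s j)); lra. }
  unfold num_step, cens_step; simpl fst; simpl snd.
  destruct (Nat.ltb_spec (Mthr s) a) as [Hlt|Hge].
  - assert (INR c <= INR (Mthr s)).
    { apply le_INR; pose proof (count_le_exceed s a _ Hlt); pose proof (exceed_Mthr_le s); lia. }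
    replace (1 / 2 * (2 * (INR (Mthr s) + 1))) with (INR (Mthr s) + 1) by field.
    apply Rmult_le_compat; try lra. apply count_prod_mono; assumption.
  - fold c. eapply Rle_trans.
    2:{ apply Rmult_le_compat_l; [lra|].
        apply (count_prod_mono (Mthr s) (Mthr (s ++ [a])) (s ++ [a]) (s ++ [a])); auto. }
    assert (E : count_prod (Mthr s) (s ++ [a]) = (INR c + 2) / (INR c + 1) * count_prod (Mthr s) s).
    { apply lprod_update with a; [apply seq_NoDup|apply in_seq; lia| |].
      - rewrite count_occ_app, count_occ_cons_eq by reflexivity; simpl; fold c.
        rewrite Nat.add_1_r, S_INR; field; lra.
      - intros j Hj; rewrite count_occ_app, count_occ_cons_neq by congruence; simpl.
        rewrite Nat.add_0_r; reflexivity. }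
    rewrite E, <- Rmult_assoc; apply Rmult_le_compat_r; [lra|].
    rewrite Rmult_1_r, Rmult_div_assoc; apply (fun Hc => proj1 (Rle_div_r _ _ _ Hc)); [lra|nra].
Qed.

Lemma den_pos s : (1 <= length s)%nat -> 0 < den s.
Proof.
  intros Hs; unfold den; pose proof (pos_INR (Mthr s)).
  assert (1 <= INR (length s)) by (change 1 with (INR 1); apply le_INR, Hs). lra.
Qed.

(** Bernoulli's inequality, den <= n + M <= n (1 + 1/n)^M, cleared of denominators; (M + 1) / 2 <= M
    because the threshold is at least 1. *)
Lemma den_le s : s <> nil ->
  den s * INR (length s) ^ Mthr s <= INR (length s) * (INR (length s) + 1) ^ Mthr s.
Proof.
  intros Hs; pose proof (Mthr_pos s Hs) as HM; pose proof (Mthr_length s) as HL.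
  assert (H1 : 1 <= INR (Mthr s)) by (change 1 with (INR 1); apply le_INR, HM).
  assert (H2 : 1 <= INR (length s)) by (change 1 with (INR 1); apply le_INR; lia).
  set (n := INR (length s)) in *; set (M := Mthr s) in *.
  pose proof (poly M (/ n) ltac:(apply Rinv_0_lt_compat; lra)) as Hp.
  replace (n + 1) with (n * (1 + / n)) by (field; lra).
  rewrite Rpow_mult_distr.
  assert (Hn : 0 < n ^ M) by (apply pow_lt; lra).
  apply Rle_trans with (n * (1 + INR M * / n) * n ^ M).
  - apply Rmult_le_compat_r; [lra|]. unfold den; fold n M.
    replace (n * (1 + INR M * / n)) with (n + INR M) by (field; lra). lra.
  - replace (n * (n ^ M * (1 + / n) ^ M)) with (n * (1 + / n) ^ M * n ^ M) by ring.
    apply Rmult_le_compat_r; [lra|]. apply Rmult_le_compat_l; lra.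
Qed.

(** Since thresholds do not decrease along the word, the factors (1 + 1/i)^(M_i) telescope under the
    last exponent. *)
Lemma den_prod_le s : s <> nil ->
  lprod (fun sa => den (fst sa)) (trace s) * den s <=
  INR (fact (length s)) * (INR (length s) + 1) ^ Mthr s.
Proof.
  induction s as [|a s IH] using rev_ind; [congruence|]; intros Hn.
  assert (Hl : length (s ++ [a]) = S (length s)) by (rewrite length_app; simpl; lia).
  pose proof (den_le _ Hn) as HD.
  destruct (list_eq_dec Nat.eq_dec s nil) as [->|Hs].
  { rewrite app_nil_l in *; change (trace [a]) with (@nil (list nat * nat)).
    simpl length in *; change (lprod (fun sa : list nat * nat => den (fst sa)) nil) with 1.
    change (INR 1) with 1 in HD; rewrite pow1 in HD; simpl fact; change (INR 1) with 1; lra. }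
  specialize (IH Hs).
  rewrite trace_snoc, lprod_app, lprod_cons by assumption.
  change (lprod (fun sa : list nat * nat => den (fst sa)) nil) with 1; simpl fst.
  rewrite Rmult_1_r, Hl, fact_simpl, mult_INR in *. rewrite S_INR in *.
  pose proof (pos_INR (length s)).
  set (M' := Mthr (s ++ [a])) in *.
  apply Rle_trans with (INR (fact (length s)) * (INR (length s) + 1) ^ M' * den (s ++ [a])).
  - apply Rmult_le_compat_r; [apply Rlt_le, den_pos; rewrite Hl; lia|].
    eapply Rle_trans; [exact IH|]. apply Rmult_le_compat_l; [apply pos_INR|].
    apply Rle_pow; [lra|apply Mthr_snoc, Hs].
  - rewrite Rmult_assoc, (Rmult_comm (_ ^ M')).
    rewrite (Rmult_comm (INR (length s) + 1) (INR (fact _))), Rmult_assoc.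
    apply Rmult_le_compat_l; [apply pos_INR|assumption].
Qed.

(** The leading 2 inverts the numerator 1/2 of the terminating 0. One power (n+1)^M pays for the
    counts, the other for the excess of the denominators over n!. *)
Lemma Pn_le_ac_prob p x K :
  x <> nil -> List.Forall (fun a => (1 <= a <= K)%nat) x ->
  (forall j, (1 <= j)%nat -> 0 <= p j) -> lsum p (seq 1 K) <= 1 ->
  Pn p x <= 2 * ac_prob x * (INR (length x) + 1) ^ (2 * Mthr x) * lprod cens_step (trace x).
Proof.
  intros Hx Hf Hp Hp1.
  assert (Hl : (1 <= length x)%nat) by (destruct x; [congruence|simpl; lia]).
  pose proof (Pn_le_type_fact p x K Hp Hp1 Hf) as H1.
  pose proof (type_fact_le K x Hx Hf) as H2.
  pose proof (count_prod_le (Mthr x) x) as H3.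
  pose proof (den_prod_le x Hx) as H4.
  set (H := lprod cens_step (trace x)) in *.
  assert (HH : 0 < H).
  { apply lprod_pos; intros [t b] _; unfold cens_step; simpl.
    pose proof (pos_INR (Mthr t)); destruct (_ <? _)%nat; lra. }
  set (N := lprod num_step (trace x)) in *.
  assert (HN : 0 < N).
  { apply lprod_pos; intros [t b] _; unfold num_step; simpl.
    pose proof (pos_INR (count t b)); destruct (_ <? _)%nat; lra. }
  set (D := lprod (fun sa => den (fst sa)) (trace x)) in *.
  assert (HD : 0 < D).
  { apply lprod_pos; intros sa Hsa; apply den_pos, (trace_length _ _ Hsa). }
  pose proof (den_pos x Hl) as Hd.
  assert (Hac : ac_prob x = N / D * ((1 / 2) / den x)).
  { rewrite ac_prob_trace; f_equal.
    - unfold N, D; rewrite <- lprod_div; apply lprod_ext; intros [s a] Hs.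
      assert (Ha : (1 <= a)%nat).
      { unfold trace in Hs; apply in_map_iff in Hs; destruct Hs as (i & E & Hi).
        injection E as <- <-; apply in_seq in Hi; unfold sym.
        rewrite Forall_forall in Hf. specialize (Hf (nth i x 0%nat) ltac:(apply nth_In; lia)); lia. }
      unfold pred_step, num_step, pred_prob, den, cnt; simpl fst; simpl snd.
      destruct (Mthr s <? a)%nat; simpl Nat.eqb.
      + cbv iota; simpl INR; rewrite Rplus_0_l; reflexivity.
      + destruct (Nat.eqb_spec a 0); [lia|reflexivity].
    - unfold pred_prob, den; simpl; rewrite Rplus_0_l; reflexivity. }
  set (F := INR (fact (length x))) in *. assert (HF : 0 < F) by apply INR_fact_lt_0.
  set (B := (INR (length x) + 1) ^ Mthr x) in *.
  replace ((INR (length x) + 1) ^ (2 * Mthr x)) with (B * B)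
    by (unfold B; rewrite <- pow_add; f_equal; lia).
  assert (HB : 0 < B) by (apply pow_lt; pose proof (pos_INR (length x)); lra).
  assert (HNB : N = 2 * ac_prob x * (D * den x)) by (rewrite Hac; field; lra).
  apply Rmult_le_reg_r with F; [assumption|].
  eapply Rle_trans; [exact H1|]; eapply Rle_trans; [exact H2|].
  apply Rle_trans with (N * B * H).
  { apply Rmult_le_compat_r; [lra|]; apply Rmult_le_compat_l; lra. }
  pose proof (ac_prob_pos x Hl).
  apply Rle_trans with (2 * ac_prob x * (F * B) * B * H).
  { apply Rmult_le_compat_r; [lra|]; apply Rmult_le_compat_r; [lra|].
    rewrite HNB; apply Rmult_le_compat_l; lra. }
  apply Req_le; ring.
Qed.

(** * Expected redundancy *)
Lemma log2_le x y : 0 < x -> x <= y -> log2 x <= log2 y.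
Proof.
  intros Hx Hxy; unfold log2; apply Rmult_le_compat_r;
    [apply Rlt_le, Rinv_0_lt_compat, ln2_pos|apply ln_le; assumption].
Qed.

Lemma log2_1 : log2 1 = 0.
Proof. unfold log2; rewrite ln_1; field; pose proof ln2_pos; lra. Qed.

Lemma log2_2 : log2 2 = 1.
Proof. unfold log2; field; pose proof ln2_pos; lra. Qed.

Lemma log2_mult x y : 0 < x -> 0 < y -> log2 (x * y) = log2 x + log2 y.
Proof.
  intros Hx Hy; unfold log2; rewrite ln_mult by assumption; field; pose proof ln2_pos; lra.
Qed.

Lemma log2_pow x n : 0 < x -> log2 (x ^ n) = INR n * log2 x.
Proof.
  intros Hx; unfold log2; rewrite ln_pow by assumption; field; pose proof ln2_pos; lra.
Qed.

Lemma log2_nonneg x : 1 <= x -> 0 <= log2 x.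
Proof. intros Hx; rewrite <- log2_1; apply log2_le; lra. Qed.

(* Tangent line of the logarithm, using 1 / ln 2 <= 2. *)
Lemma log2_tangent x c : 0 < x -> 0 < c -> c <= x -> log2 x <= log2 c + 2 * (x / c - 1).
Proof.
  intros Hx Hc Hcx; pose proof ln_lt_2.
  assert (Hxc : 0 < x / c) by (apply Rdiv_lt_0_compat; assumption).
  assert (H1 : 1 <= x / c) by (apply Rle_div_r; lra).
  replace x with (c * (x / c)) at 1 by (field; lra).
  rewrite log2_mult by assumption.
  apply Rplus_le_compat_l; unfold log2.
  apply (fun Hc => proj2 (Rle_div_l _ _ _ Hc)); [apply ln2_pos|].
  pose proof (ln_le_minus_1 _ Hxc). nra.
Qed.

Lemma log2_le_ratio x c : 0 < x -> 0 < c -> log2 x <= log2 c + 2 * (x / c).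
Proof.
  intros Hx Hc; assert (Hxc : 0 < x / c) by (apply Rdiv_lt_0_compat; assumption).
  destruct (Rle_lt_dec c x) as [H|H].
  - pose proof (log2_tangent x c Hx Hc H); lra.
  - pose proof (log2_le x c Hx); lra.
Qed.

Lemma INR_log2_le n : (1 <= n)%nat -> INR (Nat.log2 n) <= log2 (INR n).
Proof.
  intros Hn. rewrite <- (Rmult_1_r (INR (Nat.log2 n))), <- log2_2, <- log2_pow by lra.
  apply log2_le; [apply pow_lt; lra|].
  change 2 with (INR 2); rewrite <- pow_INR; apply le_INR.
  apply Nat.log2_spec; lia.
Qed.

Lemma elias_len_le b : (1 <= b)%nat -> INR (elias_len b) <= 12/10 * log2 (INR b) + 12.
Proof.
  intros Hb; pose proof (INR_log2_le b Hb) as H1; unfold elias_len.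
  set (l := Nat.log2 b) in *.
  rewrite !plus_INR, mult_INR; change (INR 2) with 2; change (INR 1) with 1.
  pose proof (pos_INR l) as Hl.
  assert (H2 : INR (Nat.log2 (l + 1)) <= log2 (INR (l + 1))) by (apply INR_log2_le; lia).
  rewrite plus_INR in H2; change (INR 1) with 1 in H2.
  (* Tangent at 32: 2 log2 (l + 1) <= 10 + (l + 1) / 8, so the slope is 9/8 <= 12/10 and the
     constant 1 + 10 + 1/8 <= 12. *)
  pose proof (log2_le_ratio (INR l + 1) (2 ^ 5) ltac:(lra) ltac:(lra)) as H3.
  rewrite log2_pow, log2_2 in H3 by lra. simpl in H3. lra.
Qed.

(** Splits the Elias cost into a part depending on mu alone and one linear in the excess over mu,
    whose expectation is small under a geometrically decaying envelope. The slope is that of the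
    tangent at mu, 2 * 12/10 <= 3. *)
Lemma elias_len_excess b a mu :
  (1 <= b)%nat -> (b <= a)%nat -> 1 <= mu ->
  INR (elias_len b) <= 12/10 * log2 mu + 12 + 3 * Rmax (INR a - mu) 0.
Proof.
  intros Hb Hba Hmu; pose proof (elias_len_le b Hb) as H1.
  pose proof (le_INR _ _ Hba) as H2.
  assert (H3 : 1 <= INR b) by (change 1 with (INR 1); apply le_INR, Hb).
  pose proof (Rmax_l (INR a - mu) 0); pose proof (Rmax_r (INR a - mu) 0).
  destruct (Rle_lt_dec (INR b) mu) as [Hle|Hlt].
  - pose proof (log2_le (INR b) mu ltac:(lra) Hle); lra.
  - pose proof (log2_tangent (INR b) mu ltac:(lra) ltac:(lra) ltac:(lra)) as H4.
    assert (INR b / mu - 1 <= INR b - mu).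
    { apply Rmult_le_reg_r with mu; [lra|].
      replace ((INR b / mu - 1) * mu) with (INR b - mu) by (field; lra). nra. }
    lra.
Qed.

Lemma lsum_trace_snd (r : nat -> R) x :
  x <> nil -> lsum r x = r (hd 0%nat x) + lsum (fun sa => r (snd sa)) (trace x).
Proof.
  induction x as [|a s IH] using rev_ind; [congruence|]; intros _.
  destruct (list_eq_dec Nat.eq_dec s nil) as [->|Hs].
  - unfold lsum; simpl; ring.
  - rewrite trace_snoc, !lsum_app, IH by assumption.
    replace (hd 0%nat (s ++ [a])) with (hd 0%nat s) by (destruct s; [congruence|reflexivity]).
    rewrite !lsum_cons; change (lsum r nil) with 0.
    change (lsum (fun sa : list nat * nat => r (snd sa)) nil) with 0; simpl snd; ring.
Qed.

Lemma log2_lprod {A} (g : A -> R) l :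
  (forall a, In a l -> 0 < g a) -> log2 (lprod g l) = lsum (fun a => log2 (g a)) l.
Proof.
  induction l as [|a l IH]; intros H; [apply log2_1|].
  rewrite lprod_cons, lsum_cons, log2_mult, IH; auto with datatypes.
  apply lprod_pos; auto with datatypes.
Qed.

Lemma trace_spec x K sa :
  List.Forall (fun a => (1 <= a <= K)%nat) x -> In sa (trace x) ->
  fst sa <> nil /\ (1 <= snd sa <= K)%nat.
Proof.
  intros Hf Hs; split.
  - pose proof (trace_length _ _ Hs); intros E; rewrite E in *; simpl in *; lia.
  - unfold trace in Hs; apply in_map_iff in Hs; destruct Hs as (i & <- & Hi); simpl.
    apply in_seq in Hi; unfold sym.
    rewrite Forall_forall in Hf; apply Hf, nth_In; lia.
Qed.

(** The 3 is the coder's slack of 2 bits plus the bit of the factor 2 in [Pn_le_ac_prob]; the term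
    in parentheses after it pays for the Elias codeword of the first symbol. *)
Definition redundancy_bound (mu : R) (x : list nat) : R :=
  (3 + (12/10 * log2 mu + 12)) + 2 * log2 (INR (length x) + 1) * INR (Mthr x)
  + lsum (fun sa => if (Mthr (fst sa) <? snd sa)%nat
            then log2 (2 * (INR (Mthr (fst sa)) + 1)) + (12/10 * log2 mu + 12) else 0) (trace x)
  + 3 * lsum (fun a => Rmax (INR a - mu) 0) x.

Lemma kl_term_etac_le lac p n K mu x :
  arith_coder_len lac -> (1 <= n)%nat ->
  (forall j, (1 <= j)%nat -> 0 <= p j) -> lsum p (seq 1 K) <= 1 -> 1 <= mu ->
  length x = n -> List.Forall (fun a => (1 <= a <= K)%nat) x ->
  kl_term (Pn p) (etac_prob lac n) x <= Pn p x * redundancy_bound mu x.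
Proof.
  intros Hlac Hn Hp Hp1 Hmu Hl Hf.
  assert (Hx : x <> nil) by (intros ->; simpl in Hl; lia).
  assert (Hf1 : List.Forall (fun a => (1 <= a)%nat) x).
  { eapply Forall_impl; [|exact Hf]; simpl; intros; lia. }
  unfold kl_term; destruct (Req_EM_T (Pn p x) 0) as [->|E]; [lra|].
  pose proof (Pn_nonneg p x Hp Hf1) as HP. assert (HP0 : 0 < Pn p x) by lra.
  apply Rmult_le_compat_l; [lra|].
  pose proof (etac_prob_pos lac n Hlac Hn x) as HQ.
  pose proof ln2_pos.
  assert (E1 : log2 (Pn p x / etac_prob lac n x) = log2 (Pn p x) - log2 (etac_prob lac n x)).
  { unfold log2; rewrite ln_div by assumption; field; lra. }
  rewrite E1.
  pose proof (etac_prob_log2 lac n Hlac Hn x (conj Hl Hf1)) as H1.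
  pose proof (log2_le _ _ HP0 (Pn_le_ac_prob p x K Hx Hf Hp Hp1)) as H2.
  assert (Hac : 0 < ac_prob x) by (apply ac_prob_pos; lia).
  assert (Hlen : 0 < INR (length x) + 1) by (pose proof (pos_INR (length x)); lra).
  assert (Hcs : forall sa, In sa (trace x) -> 0 < cens_step sa).
  { intros [t b] _; unfold cens_step; simpl.
    pose proof (pos_INR (Mthr t)); destruct (_ <? _)%nat; lra. }
  assert (Hpw : 0 < (INR (length x) + 1) ^ (2 * Mthr x)) by (apply pow_lt; assumption).
  assert (Hlp : 0 < lprod cens_step (trace x)) by (apply lprod_pos; assumption).
  rewrite log2_mult in H2 by (repeat (assumption || apply Rmult_lt_0_compat || lra)).
  rewrite log2_mult in H2 by (repeat (assumption || apply Rmult_lt_0_compat || lra)).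
  rewrite log2_mult, log2_2, log2_pow, log2_lprod, mult_INR in H2 by (assumption || lra).
  change (INR 2) with 2 in H2.
  rewrite elias_total_trace in H1.
  unfold redundancy_bound; rewrite (lsum_trace_snd _ x Hx).
  assert (H3 : INR (elias_len (hd 0%nat x)) <=
     12/10 * log2 mu + 12 + 3 * Rmax (INR (hd 0%nat x) - mu) 0).
  { destruct x as [|a x']; [congruence|]; simpl hd. inversion Hf1; subst.
    apply elias_len_excess; auto. }
  assert (H4 : lsum (fun sa => log2 (cens_step sa)) (trace x) + lsum elias_step (trace x) <=
    lsum (fun sa => if (Mthr (fst sa) <? snd sa)%nat
            then log2 (2 * (INR (Mthr (fst sa)) + 1)) + (12/10 * log2 mu + 12) else 0) (trace x)
    + 3 * lsum (fun sa => Rmax (INR (snd sa) - mu) 0) (trace x)).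
  { rewrite <- lsum_scal, <- !lsum_plus; apply lsum_le; intros [s a] Hs.
    destruct (trace_spec x K _ Hf Hs) as [Hs1 Hs2]; simpl in Hs1, Hs2.
    unfold cens_step, elias_step; simpl fst; simpl snd.
    pose proof (Rmax_r (INR a - mu) 0).
    destruct (Nat.ltb_spec (Mthr s) a).
    - pose proof (Mthr_pos s Hs1).
      pose proof (elias_len_excess (a - Mthr s + 1) a mu ltac:(lia) ltac:(lia) Hmu). lra.
    - rewrite log2_1; lra. }
  lra.
Qed.

(** * Expectations over truncated words *)

Section Expectation.

Variables (p : nat -> R) (K : nat).
Hypotheses (Hp : forall j, (1 <= j)%nat -> 0 <= p j) (Hp1 : lsum p (seq 1 K) <= 1).

Let E (n : nat) (g : list nat -> R) : R := box_sum n K (fun x => Pn p x * g x).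

Lemma Pn_box_nonneg x : List.Forall (fun a => (1 <= a <= K)%nat) x -> 0 <= Pn p x.
Proof.
  intros Hf; apply Pn_nonneg; [assumption|].
  eapply Forall_impl; [|exact Hf]; simpl; intros; lia.
Qed.

Lemma expectation_le n g h :
  (forall x, length x = n -> List.Forall (fun a => (1 <= a <= K)%nat) x -> g x <= h x) ->
  E n g <= E n h.
Proof.
  intros H; apply box_sum_le; intros x Hx Hf.
  apply Rmult_le_compat_l; [apply Pn_box_nonneg, Hf|auto].
Qed.

Lemma expectation_plus n g h : E n (fun x => g x + h x) = E n g + E n h.
Proof. unfold E; rewrite <- box_sum_plus; apply box_sum_ext; intros; ring. Qed.

Lemma expectation_scal n c g : E n (fun x => c * g x) = c * E n g.
Proof. unfold E; rewrite <- box_sum_scal; apply box_sum_ext; intros; ring. Qed.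

Lemma lsum_p_nonneg : 0 <= lsum p (seq 1 K).
Proof. apply lsum_nonneg; intros j Hj; apply in_seq in Hj; apply Hp; lia. Qed.

Lemma box_mass_le n : box_sum n K (Pn p) <= 1.
Proof.
  rewrite box_sum_Pn, <- (pow1 n); apply pow_incr; split; [apply lsum_p_nonneg|assumption].
Qed.

Lemma expectation_const n c : 0 <= c -> E n (fun _ => c) <= c.
Proof.
  intros Hc; unfold E; rewrite (box_sum_ext _ _ _ (fun x => c * Pn p x)) by (intros; ring).
  rewrite box_sum_scal.
  rewrite <- (Rmult_1_r c) at 2; apply Rmult_le_compat_l; [assumption|apply box_mass_le].
Qed.

Lemma expectation_affine n a b g :
  0 <= a -> 0 <= b -> E n g <= 1 -> E n (fun x => a + b * g x) <= a + b.
Proof.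
  intros Ha Hb Hg; rewrite expectation_plus, expectation_scal.
  pose proof (expectation_const n a Ha). nra.
Qed.

(** Only an inequality: appending a symbol multiplies the earlier sum by the truncated mass, which
    is at most 1. *)
Lemma expectation_trace n (phi : list nat * nat -> R) :
  (forall sa, 0 <= phi sa) ->
  E (S n) (fun x => lsum phi (trace x)) <=
  lsum (fun i => E i (fun s => lsum (fun a => p a * phi (s, a)) (seq 1 K))) (seq 1 n).
Proof.
  intros Hphi; induction n as [|n IH].
  - unfold E; rewrite box_sum_S; apply Req_le.
    rewrite (lsum_ext _ (fun _ => 0)); [apply lsum_zero|].
    intros a _; rewrite box_sum_0; unfold lsum; simpl; ring.
  - rewrite seq_S, lsum_app, lsum_cons; simpl Nat.add.
    change (lsum (fun i => E i (fun s => lsum (fun a => p a * phi (s, a)) (seq 1 K))) nil) with 0.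
    rewrite Rplus_0_r.
    apply Rle_trans with (E (S n) (fun x => lsum phi (trace x)) +
       E (S n) (fun s => lsum (fun a => p a * phi (s, a)) (seq 1 K))); [|lra].
    rewrite <- expectation_plus. unfold E at 1; rewrite box_sum_snoc.
    apply box_sum_le; intros s Hs Hf.
    assert (Hn : s <> nil) by (intros ->; discriminate).
    rewrite (lsum_ext _ (fun a => Pn p s * (lsum phi (trace s) * p a + p a * phi (s, a)))).
    + rewrite lsum_scal, lsum_plus, lsum_scal.
      apply Rmult_le_compat_l; [apply Pn_box_nonneg, Hf|].
      apply Rplus_le_compat_r. rewrite <- (Rmult_1_r (lsum phi (trace s))) at 2.
      apply Rmult_le_compat_l; [apply lsum_nonneg; auto|assumption].
    + intros a _; rewrite trace_snoc, lsum_app, Pn_snoc by assumption.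
      unfold lsum at 2; simpl; ring.
Qed.

Lemma expectation_lsum n r :
  (forall a, 0 <= r a) -> E n (lsum r) <= INR n * lsum (fun a => p a * r a) (seq 1 K).
Proof.
  intros Hr; induction n as [|n IH].
  - unfold E; rewrite box_sum_0; unfold lsum at 1; simpl; lra.
  - unfold E; rewrite box_sum_S.
    apply Rle_trans with (lsum (fun a => p a * r a + E n (lsum r) * p a) (seq 1 K)).
    + apply lsum_le; intros a Ha; apply in_seq in Ha.
      rewrite (box_sum_ext _ _ _ (fun l => p a * (Pn p l * r a + Pn p l * lsum r l))).
      2:{ intros l _ _; rewrite Pn_cons, lsum_cons; ring. }
      rewrite box_sum_scal, box_sum_plus; fold (E n (lsum r)).
      pose proof (expectation_const n (r a) (Hr a)) as H; unfold E in H.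
      pose proof (Hp a ltac:(lia)). nra.
    + rewrite lsum_plus, lsum_scal, S_INR.
      assert (0 <= E n (lsum r)).
      { apply box_sum_nonneg; intros x _ Hf; apply Rmult_le_pos; [apply Pn_box_nonneg, Hf|].
        apply lsum_nonneg; auto. }
      nra.
Qed.

(** Each 1 / (i + 1) is at most ln ((i + 1) / i); starting at 1/2 leaves no additive constant. These
    are the censoring probabilities, up to the expected threshold. *)
Lemma harmonic_le_ln n : lsum (fun i => / INR (S i)) (seq 1 n) <= ln (INR (S n)).
Proof.
  induction n as [|n IH].
  - simpl; rewrite ln_1; unfold lsum; simpl; lra.
  - rewrite seq_S, lsum_app, lsum_cons; change (lsum (fun i => / INR (S i)) nil) with 0.
    change (1 + n)%nat with (S n).
    assert (H1 : 0 < INR (S n)) by (apply lt_0_INR; lia).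
    assert (H2 : INR (S (S n)) = INR (S n) + 1) by apply S_INR.
    pose proof (ln_le_minus_1 (INR (S n) / INR (S (S n))) ltac:(apply Rdiv_lt_0_compat; lra)) as H.
    rewrite ln_div in H by lra.
    replace (INR (S n) / INR (S (S n)) - 1) with (- / INR (S (S n))) in H by (rewrite H2; field; lra).
    lra.
Qed.

Lemma expectation_censored n (h : nat -> R) B :
  (forall k, 0 <= h k) -> (forall k l, (k <= l)%nat -> h k <= h l) ->
  (forall i, (2 <= i <= S n)%nat -> E i (fun x => (INR (Mthr x) + 1) * h (Mthr x)) <= B) ->
  0 <= B ->
  E (S n) (fun x => lsum (fun sa => if (Mthr (fst sa) <? snd sa)%nat
                                    then h (Mthr (fst sa)) else 0) (trace x))
  <= B * ln (INR (S n)).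
Proof.
  intros Hh Hmono HB HB0.
  eapply Rle_trans; [apply expectation_trace; intros [s a]; simpl; destruct (_ <? _)%nat; [apply Hh|lra]|].
  apply Rle_trans with (lsum (fun i => B * / INR (S i)) (seq 1 n)).
  - apply lsum_le; intros i Hi; apply in_seq in Hi; simpl fst; simpl snd.
    eapply Rle_trans; [apply (censoring_expectation i K p h); auto; lia|].
    unfold Rdiv; apply Rmult_le_compat_r; [apply Rlt_le, Rinv_0_lt_compat, lt_0_INR; lia|].
    apply HB; lia.
  - rewrite lsum_scal; apply Rmult_le_compat_l; [assumption|apply harmonic_le_ln].
Qed.

(** * Exponential moments of the threshold *)

Lemma exp_le x y : x <= y -> exp x <= exp y.
Proof. intros [H| ->]; [apply Rlt_le, exp_increasing, H|apply Rle_refl]. Qed.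

Lemma exp_pow x n : exp x ^ n = exp (INR n * x).
Proof.
  induction n as [|n IH]; [simpl; rewrite Rmult_0_l, exp_0; reflexivity|].
  rewrite S_INR, Rmult_plus_distr_r, exp_plus, <- IH, Rmult_1_l; simpl; ring.
Qed.

Lemma exp_quarter_le : exp (/ 4) <= 13/10.
Proof.
  pose proof (exp_ineq1_le (- / 16)) as H; rewrite exp_Ropp in H.
  assert (H1 : exp (/ 16) <= 16 / 15).
  { pose proof (exp_pos (/ 16)).
    apply Rmult_le_compat_l with (r := exp (/ 16)) in H; [|lra]. rewrite Rinv_r in H; lra. }
  replace (exp (/ 4)) with (exp (/ 16) ^ 4).
  - apply Rle_trans with ((16 / 15) ^ 4); [|lra].
    apply pow_incr; split; [apply Rlt_le, exp_pos|assumption].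
  - simpl; rewrite Rmult_1_r, <- !exp_plus; f_equal; field.
Qed.

Section Moments.

Variables (n k : nat) (mu : R).
Hypotheses (Hmu : 1 <= mu) (Hk : mu <= INR k <= mu + 1)
  (Htail : INR n * lsum (fun a => p a * (if (k <? a)%nat then 1 else 0)) (seq 1 K) <= mu).

Let Y (x : list nat) : R := exp ((INR (exceed k x) - 12/10 * mu) / 4).

(** Chernoff bound with parameter 1/4. As exp (1/4) - 1 <= 3/10, the moment generating function is
    at most exp (3/10 mu), which the centring 12/10 mu = 4 (3/10) mu cancels exactly. *)
Lemma expectation_exp_exceed i : (i <= n)%nat -> E i Y <= 1.
Proof.
  intros Hi.
  set (t := lsum (fun a => p a * (if (k <? a)%nat then 1 else 0)) (seq 1 K)) in *.
  assert (Ht : 0 <= t).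
  { apply lsum_nonneg; intros a Ha; apply in_seq in Ha.
    pose proof (Hp a ltac:(lia)); destruct (_ <? _)%nat; lra. }
  set (h := fun a => p a * (if (k <? a)%nat then exp (/ 4) else 1)).
  assert (E1 : E i Y = exp (- (12/10 * mu) / 4) * box_sum i K (Pn h)).
  { unfold E; rewrite <- box_sum_scal; apply box_sum_ext; intros x _ _.
    enough (H : Pn p x * exp (INR (exceed k x) / 4) = Pn h x).
    { rewrite <- H; unfold Y; rewrite (Rmult_comm (exp _)), Rmult_assoc, <- exp_plus.
      do 2 f_equal; field. }
    induction x as [|a x IH].
    - unfold Pn; simpl; rewrite Rdiv_0_l, exp_0; ring.
    - rewrite !Pn_cons, <- IH, exceed_cons, plus_INR; unfold h.
      unfold Rdiv; rewrite Rmult_plus_distr_r, exp_plus.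
      destruct (k <? a)%nat; simpl INR; rewrite ?Rmult_1_l, ?Rmult_0_l, ?exp_0; ring. }
  rewrite E1, box_sum_Pn.
  assert (H1 : lsum h (seq 1 K) <= exp (3/10 * t)).
  { eapply Rle_trans; [|apply exp_ineq1_le].
    apply Rle_trans with (lsum (fun a => p a + (3/10) * (p a * (if (k <? a)%nat then 1 else 0))) (seq 1 K)).
    - apply lsum_le; intros a Ha; apply in_seq in Ha; unfold h.
      pose proof (Hp a ltac:(lia)); pose proof exp_quarter_le; destruct (_ <? _)%nat; nra.
    - rewrite lsum_plus, lsum_scal; fold t; lra. }
  assert (H0 : 0 <= lsum h (seq 1 K)).
  { apply lsum_nonneg; intros a Ha; apply in_seq in Ha; unfold h.
    apply Rmult_le_pos; [apply Hp; lia|]. pose proof (exp_pos (/ 4)); destruct (_ <? _)%nat; lra. }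
  apply Rle_trans with (exp (- (12/10 * mu) / 4) * exp (3/10 * mu)).
  - apply Rmult_le_compat_l; [apply Rlt_le, exp_pos|].
    apply Rle_trans with (exp (3/10 * t) ^ i); [apply pow_incr; auto|].
    rewrite exp_pow; apply exp_le.
    pose proof (le_INR _ _ Hi); pose proof (pos_INR i); nra.
  - rewrite <- exp_plus. replace (- (12/10 * mu) / 4 + 3/10 * mu) with 0 by field.
    rewrite exp_0; lra.
Qed.

(** At level max (k, [exceed k x]) + 1 at most [exceed k x] symbols remain above, fewer than the
    level itself. *)
Lemma Mthr_le_exceed x : (Mthr x <= Nat.max k (exceed k x) + 1)%nat.
Proof.
  apply Mthr_le; [lia|].
  pose proof (exceed_antitone k (Nat.max k (exceed k x) + 1) x ltac:(lia)). lia.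
Qed.

(** With u the centred count, u <= 4 exp (u/4), and for u > 0 squaring u/8 <= exp (u/8) gives u^2 <=
    64 exp (u/4). The 128 is 2 * 64, from (a + u)^2 <= 2 a^2 + 2 u^2. *)
Lemma Mthr_moments x :
  INR (Mthr x) <= (12/10 * mu + 2) + 4 * Y x /\
  (INR (Mthr x) + 1) ^ 2 <= 2 * (12/10 * mu + 3) ^ 2 + 128 * Y x.
Proof.
  pose proof (le_INR _ _ (Mthr_le_exceed x)) as H; rewrite plus_INR in H; change (INR 1) with 1 in H.
  pose proof (pos_INR (Mthr x)).
  unfold Y; set (u := INR (exceed k x) - 12/10 * mu).
  pose proof (exp_pos (u / 4)) as HY. pose proof (exp_ineq1_le (u / 4)) as HY1.
  destruct (Nat.max_spec k (exceed k x)) as [[_ E1]|[_ E1]]; rewrite E1 in H.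
  - assert (Hu : INR (Mthr x) <= 12/10 * mu + u + 1) by (unfold u; lra).
    split; [lra|].
    destruct (Rle_lt_dec u 0); [nra|].
    pose proof (exp_ineq1_le (u / 8)) as H8.
    assert (E8 : exp (u / 4) = exp (u / 8) * exp (u / 8)).
    { rewrite <- exp_plus; f_equal; field. }
    assert (u * u <= 64 * exp (u / 4)) by (rewrite E8; nra).
    assert ((INR (Mthr x) + 1) ^ 2 <= (12/10 * mu + 3 + u) ^ 2) by (apply pow_incr; lra).
    pose proof (pow2_ge_0 (12/10 * mu + 3 - u)). simpl in *; nra.
  - split; [lra|].
    assert ((INR (Mthr x) + 1) ^ 2 <= (12/10 * mu + 3) ^ 2) by (apply pow_incr; lra).
    pose proof (pow2_ge_0 (12/10 * mu + 3)); lra.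
Qed.

Lemma expectation_Mthr i : (i <= n)%nat -> E i (fun x => INR (Mthr x)) <= 12/10 * mu + 6.
Proof.
  intros Hi; eapply Rle_trans;
    [apply (expectation_le _ _ (fun x => (12/10 * mu + 2) + 4 * Y x)); intros; apply Mthr_moments|].
  pose proof (expectation_affine i (12/10 * mu + 2) 4 Y ltac:(lra) ltac:(lra)
    (expectation_exp_exceed i Hi)); lra.
Qed.

(** Linearising the logarithm at mu leaves a second moment divided by mu, which is of order mu and
    carries no logarithm. *)
Lemma expectation_Mthr_log2 i c : (i <= n)%nat -> 0 <= c ->
  E i (fun x => (INR (Mthr x) + 1) * (log2 (2 * (INR (Mthr x) + 1)) + c)) <=
  (12/10 * mu + 7) * (log2 mu + 1 + c) + (4 * (12/10 * mu + 3) ^ 2 + 256) / mu.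
Proof.
  intros Hi Hc. pose proof (log2_nonneg mu Hmu) as Hlog.
  assert (Hm : 0 < / mu) by (apply Rinv_0_lt_compat; lra).
  pose proof (pow2_ge_0 (12/10 * mu + 3)) as Hsq.
  eapply Rle_trans; [apply (expectation_le _ _ (fun x =>
     ((log2 mu + 1 + c) * (12/10 * mu + 3) + 4 * / mu * (12/10 * mu + 3) ^ 2)
     + ((log2 mu + 1 + c) * 4 + 256 * / mu) * Y x))|].
  - intros x _ _; destruct (Mthr_moments x) as [H1 H2].
    set (M := INR (Mthr x)) in *. pose proof (pos_INR (Mthr x)) as HM; fold M in HM.
    rewrite log2_mult, log2_2 by lra.
    pose proof (log2_le_ratio (M + 1) mu ltac:(lra) ltac:(lra)) as H3.
    apply Rle_trans with ((M + 1) * (log2 mu + 1 + c) + 2 * / mu * (M + 1) ^ 2).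
    + apply Rle_trans with ((M + 1) * (1 + (log2 mu + 2 * ((M + 1) / mu)) + c)).
      * apply Rmult_le_compat_l; lra.
      * apply Req_le; field; lra.
    + apply Rle_trans with ((log2 mu + 1 + c) * (12/10 * mu + 3 + 4 * Y x)
        + 2 * / mu * (2 * (12/10 * mu + 3) ^ 2 + 128 * Y x)).
      * rewrite (Rmult_comm (M + 1)).
        apply Rplus_le_compat; apply Rmult_le_compat_l; lra.
      * apply Req_le; ring.
  - eapply Rle_trans; [apply expectation_affine|apply Req_le; field; lra].
    + apply Rplus_le_le_0_compat; repeat apply Rmult_le_pos; lra.
    + lra.
    + apply expectation_exp_exceed, Hi.
Qed.

End Moments.

End Expectation.
(** The class enters only through the expected number of symbols above [k] and their expected total
    excess [rho] over [mu]. *)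
Lemma KL_etac_le lac p n k mu rho :
  arith_coder_len lac -> (1 <= n)%nat ->
  (forall j, (1 <= j)%nat -> 0 <= p j) -> (forall K, lsum p (seq 1 K) <= 1) ->
  1 <= mu -> mu <= INR k <= mu + 1 ->
  (forall K, INR n * lsum (fun a => p a * (if (k <? a)%nat then 1 else 0)) (seq 1 K) <= mu) ->
  (forall K, INR n * lsum (fun a => p a * Rmax (INR a - mu) 0) (seq 1 K) <= rho) ->
  Rbar_le (KL n (Pn p) (etac_prob lac n))
   (Finite ((3 + (12/10 * log2 mu + 12)) + 2 * log2 (INR n + 1) * (12/10 * mu + 6)
    + ((12/10 * mu + 7) * (log2 mu + 1 + (12/10 * log2 mu + 12))
       + (4 * (12/10 * mu + 3) ^ 2 + 256) / mu) * ln (INR n)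
    + 3 * rho)).
Proof.
  intros Hlac Hn Hp Hp1 Hmu Hk Htail Hrho.
  pose proof (log2_nonneg mu Hmu) as Hlog.
  assert (Hn1 : 1 <= INR n) by (change 1 with (INR 1); apply le_INR, Hn).
  apply KL_le.
  - intros x [_ Hx]; apply Pn_nonneg; assumption.
  - intros x _; apply etac_prob_pos; assumption.
  - intros K; pose proof (box_sum_le_tsum n (etac_prob lac n) K) as H.
    destruct (etac_is_prob lac n Hlac Hn) as [_ H1]; rewrite H1 in H; exact H.
  - intros K; specialize (Hp1 K); specialize (Htail K); specialize (Hrho K).
    set (alpha := 12/10 * log2 mu + 12) in *.
    assert (Halpha : 0 <= alpha) by (unfold alpha; lra).
    apply Rle_trans with (box_sum n K (fun x => Pn p x * redundancy_bound mu x)).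
    { apply box_sum_le; intros x Hx Hf; apply kl_term_etac_le with K; assumption. }
    set (h := fun m : nat => log2 (2 * (INR m + 1)) + alpha).
    rewrite (box_sum_ext _ _ _ (fun x => (Pn p x * (3 + alpha)
       + 2 * log2 (INR n + 1) * (Pn p x * INR (Mthr x)))
       + (Pn p x * lsum (fun sa => if (Mthr (fst sa) <? snd sa)%nat then h (Mthr (fst sa)) else 0) (trace x)
       + 3 * (Pn p x * lsum (fun a => Rmax (INR a - mu) 0) x)))).
    2:{ intros x Hx _; unfold redundancy_bound; rewrite Hx; fold alpha; unfold h; ring. }
    rewrite !box_sum_plus, !box_sum_scal.
    pose proof (expectation_const p K Hp Hp1 n (3 + alpha) ltac:(lra)) as B1.
    pose proof (expectation_Mthr p K Hp Hp1 n k mu Hmu Hk Htail n (Nat.le_refl n)) as B2.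
    assert (B3 : box_sum n K (fun x => Pn p x * lsum (fun sa =>
       if (Mthr (fst sa) <? snd sa)%nat then h (Mthr (fst sa)) else 0) (trace x)) <=
       ((12/10 * mu + 7) * (log2 mu + 1 + alpha) + (4 * (12/10 * mu + 3) ^ 2 + 256) / mu) * ln (INR n)).
    { destruct n as [|n']; [lia|].
      apply (expectation_censored p K Hp Hp1 n' h).
      - intros m; unfold h. pose proof (pos_INR m).
        pose proof (log2_nonneg (2 * (INR m + 1)) ltac:(lra)); lra.
      - intros m l Hml; unfold h; apply Rplus_le_compat_r, log2_le.
        + pose proof (pos_INR m); lra.
        + pose proof (le_INR _ _ Hml); lra.
      - intros i Hi.
        apply (expectation_Mthr_log2 p K Hp Hp1 (S n') k mu Hmu Hk Htail i alpha); [lia|assumption].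
      - apply Rplus_le_le_0_compat; [apply Rmult_le_pos; lra|].
        pose proof (pow2_ge_0 (12/10 * mu + 3)).
        apply Rmult_le_pos; [lra|apply Rlt_le, Rinv_0_lt_compat; lra]. }
    pose proof (expectation_lsum p K Hp Hp1 n (fun a => Rmax (INR a - mu) 0) (fun a => Rmax_r _ _)) as B4.
    pose proof (log2_nonneg (INR n + 1) ltac:(lra)) as Hl.
    apply Rmult_le_compat_l with (r := 2 * log2 (INR n + 1)) in B2; [|lra].
    lra.
Qed.

(** * Envelopes and hazard rates *)
Lemma env_tail_ex (f : nat -> R) k :
  ex_series (fun i => f (S i)) -> ex_series (fun i => f (S (k + i))).
Proof. intros H; apply (ex_series_incr_n (fun i => f (S i)) k) in H; exact H. Qed.

Lemma env_tail_S (f : nat -> R) k :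
  ex_series (fun i => f (S i)) -> env_tail f k = f (S k) + env_tail f (S k).
Proof.
  intros H; unfold env_tail; rewrite Series_incr_1 by (apply env_tail_ex, H).
  rewrite Nat.add_0_r; f_equal; apply Series_ext; intros i; do 2 f_equal; lia.
Qed.

Lemma lsum_env_tail (f : nat -> R) K k :
  ex_series (fun i => f (S i)) -> lsum f (seq (S k) K) + env_tail f (k + K) = env_tail f k.
Proof.
  intros H; induction K as [|K IH].
  - rewrite Nat.add_0_r; unfold lsum; simpl; ring.
  - rewrite <- IH, seq_S, lsum_app, (env_tail_S f (k + K)) by assumption.
    replace (k + S K)%nat with (S (k + K)) by lia.
    rewrite lsum_cons; change (lsum f nil) with 0; simpl Nat.add; ring.
Qed.

Lemma env_tail_nonneg (f : nat -> R) k :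
  ex_series (fun i => f (S i)) -> (forall j, (1 <= j)%nat -> 0 <= f j) -> 0 <= env_tail f k.
Proof.
  intros H Hf; unfold env_tail.
  rewrite <- (Rmult_0_l (Series (fun i => f (S (k + i))))), <- Series_scal_l.
  apply Series_le; [|apply env_tail_ex, H].
  intros i; rewrite Rmult_0_l; split; [lra|apply Hf; lia].
Qed.

Lemma lsum_seq_le_env_tail (f : nat -> R) K k :
  ex_series (fun i => f (S i)) -> (forall j, (1 <= j)%nat -> 0 <= f j) ->
  lsum f (seq (S k) K) <= env_tail f k.
Proof.
  intros H Hf; pose proof (lsum_env_tail f K k H); pose proof (env_tail_nonneg f (k + K) H Hf); lra.
Qed.

Lemma in_Lambda_mass f p K : in_Lambda f p -> lsum p (seq 1 K) <= 1.
Proof.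
  intros [H1 H2]. rewrite <- (is_series_unique _ _ H2).
  apply (lsum_seq_le_env_tail p K 0); [exists 1; exact H2|intros; apply H1; assumption].
Qed.

Lemma lsum_above (g : nat -> R) k K :
  (forall a, (a <= k)%nat -> g a = 0) -> (forall a, 0 <= g a) ->
  lsum g (seq 1 K) <= lsum g (seq (S k) K).
Proof.
  intros H0 Hg; eapply Rle_trans; [apply (lsum_seq_widen g 1 K (k + K)); [lia|assumption]|].
  rewrite seq_app, lsum_app, (lsum_ext _ (fun _ => 0) (seq 1 k)), lsum_zero; [simpl Nat.add; lra|].
  intros a Ha; apply in_seq in Ha; apply H0; lia.
Qed.

Lemma lsum_restrict (g : nat -> R) k K :
  (forall a, (k < a)%nat -> 0 <= g a) ->
  lsum (fun a => if (k <? a)%nat then g a else 0) (seq 1 K) <= lsum g (seq (S k) K).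
Proof.
  intros Hg.
  eapply Rle_trans; [apply (lsum_above _ k)|].
  - intros a Ha; destruct (Nat.ltb_spec k a); [lia|reflexivity].
  - intros a; destruct (Nat.ltb_spec k a); [auto|lra].
  - apply lsum_le; intros a Ha; apply in_seq in Ha; destruct (Nat.ltb_spec k a); [lra|lia].
Qed.

Lemma in_Lambda_tail f p k K :
  is_envelope f -> in_Lambda f p ->
  lsum (fun a => p a * (if (k <? a)%nat then 1 else 0)) (seq 1 K) <= env_tail f k.
Proof.
  intros (Hf & Hex & _) [Hp _].
  assert (Hf0 : forall j, (1 <= j)%nat -> 0 <= f j) by (intros; apply Rlt_le, Hf; assumption).
  eapply Rle_trans; [|apply (lsum_seq_le_env_tail f K k Hex Hf0)].
  eapply Rle_trans; [|apply lsum_restrict; intros; apply Hf0; lia].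
  apply lsum_le; intros a Ha; apply in_seq in Ha.
  pose proof (Hp a ltac:(lia)); destruct (k <? a)%nat; lra.
Qed.

(** The partial sum times (1 - q)^2 has an explicit closed form, 1 minus a nonnegative remainder. *)
Lemma arith_geometric_le q R :
  0 < q < 1 -> lsum (fun r => INR (S r) * q ^ r) (seq 0 R) <= / (1 - q) ^ 2.
Proof.
  intros Hq.
  assert (H : lsum (fun r => INR (S r) * q ^ r) (seq 0 R) * (1 - q) ^ 2
            = 1 - q ^ R * (1 + INR R * (1 - q))).
  { induction R as [|R IH]; [unfold lsum; simpl; ring|].
    rewrite seq_S, lsum_app, Rmult_plus_distr_r, IH, lsum_cons, S_INR.
    change (lsum (fun r => INR (S r) * q ^ r) nil) with 0.
    simpl Nat.add; rewrite S_INR; simpl; ring. }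
  assert (H2 : 0 < (1 - q) ^ 2) by (apply pow_lt; lra).
  apply Rmult_le_reg_r with ((1 - q) ^ 2); [assumption|].
  rewrite H, Rinv_l by lra.
  pose proof (pow_lt q R ltac:(lra)). pose proof (pos_INR R).
  assert (0 <= q ^ R * (1 + INR R * (1 - q))) by (apply Rmult_le_pos; nra). lra.
Qed.

(** * Envelope tails under a non-decreasing hazard rate *)

Section Envelope.

Variables (f : nat -> R) (Fs dFs : R -> R) (m : nat -> R).
Hypotheses (Henv : is_envelope f) (HFs : smoothed_envelope f Fs dFs)
  (Hhaz : nondecreasing_hazard Fs dFs) (Hm : is_threshold Fs m).

Lemma envelope_nonneg j : (1 <= j)%nat -> 0 <= f j.
Proof. intros Hj; apply Rlt_le, Henv, Hj. Qed.

Lemma env_tail_pos k : 0 < env_tail f k.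
Proof.
  destruct Henv as (Hf & Hex & _); rewrite env_tail_S by assumption.
  pose proof (env_tail_nonneg f (S k) Hex envelope_nonneg).
  pose proof (Hf (S k) ltac:(lia)); lra.
Qed.

Lemma env_tail_small eps : 0 < eps -> exists k0, forall k, (k0 <= k)%nat -> env_tail f k < eps.
Proof.
  intros He; destruct HFs as (Hint & _ & _ & Hlim & _).
  (* A deviation below 1 from the limit 1 excludes the default value 0 of [env_cdf]. *)
  assert (He' : 0 < Rmin eps 1) by (apply Rmin_pos; lra).
  apply is_lim_spec in Hlim; destruct (Hlim (mkposreal _ He')) as [M HM]; simpl in HM.
  destruct (INR_unbounded M) as [k0 Hk0].
  exists k0; intros k Hk; specialize (HM (INR k)).
  apply le_INR in Hk; specialize (HM ltac:(lra)).
  rewrite Hint in HM; unfold env_cdf in HM.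
  pose proof (Rmin_l eps 1); pose proof (Rmin_r eps 1).
  apply Rabs_def2 in HM; destruct (Rlt_dec _ _); lra.
Qed.

Lemma survival_INR k : env_tail f k < 1 -> 1 - Fs (INR k) = env_tail f k.
Proof.
  intros Hk; destruct HFs as (Hint & _); rewrite Hint; unfold env_cdf.
  destruct (Rlt_dec _ _); lra.
Qed.

Lemma survival_pos x : 0 <= x -> 0 < 1 - Fs x.
Proof.
  intros Hx; destruct (env_tail_small 1 Rlt_0_1) as [k0 Hk0].
  destruct (INR_unbounded x) as [k1 Hk1].
  destruct HFs as (_ & _ & Hmono & _).
  pose proof (Hk0 (k0 + k1)%nat ltac:(lia)) as H.
  pose proof (survival_INR _ H). pose proof (env_tail_pos (k0 + k1)).
  assert (x <= INR (k0 + k1)) by (rewrite plus_INR; pose proof (pos_INR k0); lra).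
  pose proof (Hmono x (INR (k0 + k1)) ltac:(lra)). lra.
Qed.

Definition hazard (x : R) : R := dFs x / (1 - Fs x).

(** Mean value theorem for the cumulative hazard -ln (1 - Fs), whose derivative is the hazard
    rate. *)
Lemma log_survival_increment x y : 0 < x < y ->
  exists c, x <= c <= y /\ ln (1 - Fs x) - ln (1 - Fs y) = hazard c * (y - x).
Proof.
  intros Hxy.
  assert (Hd : forall z, 0 < z -> is_derive (fun t => - ln (1 - Fs t)) z (hazard z)).
  { intros z Hz; destruct HFs as (_ & _ & _ & _ & _ & HD & _).
    destruct (HD z Hz) as [HD1 _]; pose proof (survival_pos z ltac:(lra)).
    evar_last.
    - apply @is_derive_opp. apply (is_derive_comp ln (fun t => 1 - Fs t)).
      + apply is_derive_ln; assumption.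
      + apply @is_derive_minus; [apply @is_derive_const|exact HD1].
    - unfold hazard, opp, minus, plus, opp, scal, zero, mult; simpl.
      unfold mult; simpl; field; lra. }
  destruct (MVT_gen (fun t => - ln (1 - Fs t)) x y hazard) as (c & Hc & E).
  - intros z Hz; apply Hd; rewrite Rmin_left in Hz; lra.
  - intros z Hz; rewrite Rmin_left in Hz by lra.
    apply derivable_continuous_pt. exists (hazard z); apply is_derive_Reals, Hd; lra.
  - rewrite Rmin_left, Rmax_right in Hc by lra. exists c; split; [assumption|lra].
Qed.

Lemma hazard_mono x y : 0 < x <= y -> hazard x <= hazard y.
Proof. apply Hhaz. Qed.

Lemma nfloor_INR k : Defs.nfloor (INR k) = k.
Proof.
  unfold Defs.nfloor; rewrite <- (Nat2Z.id k) at 2; f_equal.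
  symmetry; apply Int_part_spec; rewrite <- INR_IZR_INZ; lra.
Qed.

Section Tail.

Variable k1 : nat.
Hypotheses (Hk1 : (1 <= k1)%nat) (Htail : forall k, (k1 <= k)%nat -> env_tail f k < 1).

Lemma INR_k1 : 1 <= INR k1.
Proof. change 1 with (INR 1); apply le_INR, Hk1. Qed.

(** By monotonicity the hazard stays above this positive value beyond [k1], so tails decay
    geometrically with ratio exp (-hazard) there. *)
Lemma hazard_pos : 0 < hazard (INR k1).
Proof.
  pose proof INR_k1. unfold hazard; apply Rdiv_lt_0_compat; [|apply survival_pos; lra].
  destruct HFs as (_ & _ & _ & _ & _ & _ & Hpos); apply Hpos; [lra|].
  rewrite nfloor_INR; unfold env_cdf; pose proof (Htail k1 (Nat.le_refl _)).
  pose proof (env_tail_pos k1); destruct (Rlt_dec _ _); lra.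
Qed.

Lemma log_survival_decay x y : INR k1 <= x <= y ->
  hazard (INR k1) * (y - x) <= ln (1 - Fs x) - ln (1 - Fs y).
Proof.
  intros Hxy; pose proof INR_k1. destruct (Req_dec x y) as [->|Hne]; [lra|].
  destruct (log_survival_increment x y ltac:(lra)) as (c & Hc & ->).
  apply Rmult_le_compat_r; [lra|apply hazard_mono; lra].
Qed.

Lemma env_tail_ratio k : (k1 <= k)%nat ->
  env_tail f (S k) <= exp (- hazard (INR k1)) * env_tail f k.
Proof.
  intros Hk. pose proof (le_INR _ _ Hk). pose proof (S_INR k).
  pose proof (log_survival_decay (INR k) (INR (S k)) ltac:(lra)) as H1.
  rewrite !survival_INR in H1 by (apply Htail; lia).
  pose proof (env_tail_pos k); pose proof (env_tail_pos (S k)).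
  rewrite <- (exp_ln (env_tail f k)), <- (exp_ln (env_tail f (S k))), <- exp_plus by assumption.
  apply exp_le; nra.
Qed.

(* The logarithm of the survival function is concave, hence above its chord. *)
Lemma log_survival_chord x y : INR k1 <= x -> x <= y -> INR k1 < y ->
  ln (1 - Fs x) >= ln (1 - Fs (INR k1))
    - (x - INR k1) / (y - INR k1) * (ln (1 - Fs (INR k1)) - ln (1 - Fs y)).
Proof.
  intros H1 H2 H3; pose proof INR_k1.
  set (a := INR k1) in *. set (G := fun z => ln (1 - Fs z)).
  change (G x >= G a - (x - a) / (y - a) * (G a - G y)).
  enough (H4 : (G a - G x) * (y - a) <= (x - a) * (G a - G y)).
  { enough (G a - G x <= (x - a) / (y - a) * (G a - G y)) by lra.
    apply Rmult_le_reg_r with (y - a); [lra|].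
    replace ((x - a) / (y - a) * (G a - G y) * (y - a)) with ((x - a) * (G a - G y)) by (field; lra).
    assumption. }
  destruct (Req_dec a x) as [->|Hax]; [lra|].
  destruct (Req_dec x y) as [->|Hxy]; [lra|].
  destruct (log_survival_increment a x ltac:(lra)) as (c & Hc & Ec).
  destruct (log_survival_increment x y ltac:(lra)) as (d & Hd & Ed).
  fold (G a) (G x) in Ec; fold (G x) (G y) in Ed.
  pose proof (hazard_mono c d ltac:(lra)) as Hcd.
  assert (G a - G y = hazard c * (x - a) + hazard d * (y - x)) by lra.
  assert (0 <= (hazard d - hazard c) * ((y - x) * (x - a))).
  { apply Rmult_le_pos; [lra|]; apply Rmult_le_pos; lra. }
  rewrite H0, Ec; lra.
Qed.

Lemma threshold_survival n : (1 <= n)%nat -> 0 < m n /\ ln (1 - Fs (m n)) = ln (m n) - ln (INR n).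
Proof.
  intros Hn; destruct (Hm n Hn) as [H0 H1].
  assert (Hn0 : 0 < INR n) by (apply lt_0_INR; lia).
  pose proof (survival_pos (m n) H0) as Hp; rewrite H1 in *.
  assert (0 < m n).
  { destruct H0 as [H0|H0]; [assumption|]. rewrite <- H0 in Hp; lra. }
  split; [assumption|apply ln_div; assumption].
Qed.

Lemma threshold_tail n k : (1 <= n)%nat -> (k1 <= k)%nat -> m n <= INR k ->
  INR n * env_tail f k <= m n.
Proof.
  intros Hn Hk Hmk; destruct (Hm n Hn) as [H0 H1].
  assert (Hn0 : 0 < INR n) by (apply lt_0_INR; lia).
  destruct HFs as (_ & _ & Hmono & _). specialize (Hmono (m n) (INR k) ltac:(lra)).
  rewrite <- survival_INR by (apply Htail, Hk).
  apply Rle_trans with (INR n * (m n / INR n)); [apply Rmult_le_compat_l; lra|].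
  apply Req_le; field; lra.
Qed.

(** If m_n stayed at most B < k, the tail at k would be at most k / n, which is false for large n
    because the tail is positive. *)
Lemma threshold_unbounded (B : R) : exists N, forall n, (N <= n)%nat -> B < m n.
Proof.
  destruct (INR_unbounded B) as [b Hb].
  set (k := (k1 + b)%nat). pose proof (env_tail_pos k) as Hpos.
  destruct (INR_unbounded (INR k / env_tail f k)) as [N HN].
  exists (S N); intros n Hn.
  assert (HB : B < INR k) by (unfold k; rewrite plus_INR; pose proof (pos_INR k1); lra).
  destruct (Rlt_dec B (m n)) as [|Hlt]; [assumption|exfalso].
  pose proof (Hm n ltac:(lia)) as [H0 H1].
  destruct HFs as (_ & _ & Hmono & _). specialize (Hmono (m n) (INR k) ltac:(lra)).
  pose proof (survival_INR k (Htail k ltac:(unfold k; lia))).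
  assert (HnN : INR N < INR n) by (apply lt_INR; lia).
  assert (Hn0 : 0 < INR n) by (pose proof (pos_INR N); lra).
  assert (H2 : env_tail f k <= INR k / INR n).
  { apply Rle_trans with (m n / INR n); [lra|].
    apply Rmult_le_compat_r; [apply Rlt_le, Rinv_0_lt_compat; assumption|lra]. }
  apply (fun Hc => proj2 (Rle_div_r _ _ _ Hc)) in H2; [|lra].
  assert (INR k / env_tail f k < INR n) by lra.
  apply (fun Hc => proj1 (Rlt_div_l _ _ _ Hc)) in H3; [|lra]. lra.
Qed.

(** The log-survival at m_n is ln m_n - ln n, while a positive hazard makes it fall at least
    linearly; hence m_n = O(log n). *)
Lemma threshold_le_ln n : (1 <= n)%nat -> INR k1 <= m n ->
  hazard (INR k1) * (m n - INR k1) <= ln (INR n).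
Proof.
  intros Hn Hmn; destruct (threshold_survival n Hn) as [H0 H1].
  pose proof (log_survival_decay (INR k1) (m n) ltac:(lra)) as H2.
  pose proof INR_k1. rewrite H1, survival_INR in H2 by (apply Htail; lia).
  assert (ln (env_tail f k1) <= 0).
  { rewrite <- ln_1; apply ln_le; [apply env_tail_pos|apply Rlt_le, Htail; lia]. }
  assert (0 <= ln (m n)) by (rewrite <- ln_1; apply ln_le; lra). lra.
Qed.

(** Chord between [k1] and m_n, where the survival is m_n / n >= 1 / n. Replacing (j - k1) / (m_n -
    k1) by the larger j / m_n only lowers the bound. *)
Lemma env_tail_ge n j : (1 <= n)%nat -> (k1 <= j)%nat -> INR j <= m n -> INR k1 < m n ->
  env_tail f k1 * exp (- (INR j / m n * ln (INR n))) <= env_tail f j.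
Proof.
  intros Hn Hj Hjm Hkm; destruct (threshold_survival n Hn) as [H0 H1].
  pose proof INR_k1. pose proof (le_INR _ _ Hj) as HjR.
  pose proof (log_survival_chord (INR j) (m n) HjR Hjm Hkm) as H2.
  rewrite H1, !survival_INR in H2 by (apply Htail; lia).
  pose proof (env_tail_pos k1) as Hp1; pose proof (env_tail_pos j) as Hpj.
  rewrite <- (exp_ln (env_tail f j)) by assumption.
  rewrite <- (exp_ln (env_tail f k1)) at 1 by assumption.
  rewrite <- exp_plus; apply exp_le.
  assert (Hl1 : ln (env_tail f k1) <= 0).
  { rewrite <- ln_1; apply ln_le; [assumption|apply Rlt_le, Htail; lia]. }
  assert (Hl2 : 0 <= ln (m n)) by (rewrite <- ln_1; apply ln_le; lra).
  assert (Hn1 : 0 <= ln (INR n)).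
  { rewrite <- ln_1; apply ln_le; [lra|]; change 1 with (INR 1); apply le_INR, Hn. }
  set (t := (INR j - INR k1) / (m n - INR k1)) in *.
  assert (Ht0 : 0 <= t) by (apply Rmult_le_pos; [lra|apply Rlt_le, Rinv_0_lt_compat; lra]).
  assert (Ht : t <= INR j / m n).
  { unfold t. apply (fun Hc => proj2 (Rle_div_l _ _ _ Hc)); [lra|].
    apply Rmult_le_reg_r with (m n); [lra|].
    replace (INR j / m n * (m n - INR k1) * m n) with (INR j * (m n - INR k1)) by (field; lra). nra. }
  assert (t * (ln (env_tail f k1) - (ln (m n) - ln (INR n))) <= INR j / m n * ln (INR n)).
  { apply Rle_trans with (t * ln (INR n)); [apply Rmult_le_compat_l; lra|].
    apply Rmult_le_compat_r; lra. }
  lra.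
Qed.

(** Geometric decay turns the tail bound into a bound on the increment f (j + 1) of the tail, at the
    price of a constant factor. *)
Lemma envelope_ge n j : (1 <= n)%nat -> (k1 <= j)%nat -> INR j <= m n -> INR k1 < m n ->
  (1 - exp (- hazard (INR k1))) * env_tail f k1 * exp (- (INR j / m n * ln (INR n))) <= f (S j).
Proof.
  intros Hn Hj Hjm Hkm; destruct Henv as (_ & Hex & _).
  pose proof (env_tail_S f j Hex); pose proof (env_tail_ratio j Hj).
  pose proof (env_tail_ge n j Hn Hj Hjm Hkm).
  assert (exp (- hazard (INR k1)) < 1).
  { rewrite <- exp_0; apply exp_increasing; pose proof hazard_pos; lra. }
  rewrite Rmult_assoc.
  apply Rle_trans with ((1 - exp (- hazard (INR k1))) * env_tail f j); [|lra].
  apply Rmult_le_compat_l; lra.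
Qed.

(** f (k + r + 1) is at most q^r times the tail at k, so the excess is an arithmetico-geometric sum.
    With k just above m_n, n times it is O(m_n). *)
Lemma in_Lambda_excess p k K : in_Lambda f p -> (k1 <= k)%nat ->
  lsum (fun a => p a * Rmax (INR a - INR k) 0) (seq 1 K) <=
  env_tail f k * / (1 - exp (- hazard (INR k1))) ^ 2.
Proof.
  intros [Hp _] Hk; set (q := exp (- hazard (INR k1))).
  assert (Hq : 0 < q < 1).
  { split; [apply exp_pos|]. rewrite <- exp_0; apply exp_increasing; pose proof hazard_pos; lra. }
  destruct Henv as (_ & Hex & _).
  assert (Hgeo : forall r, env_tail f (k + r) <= q ^ r * env_tail f k).
  { induction r as [|r IH]; [rewrite Nat.add_0_r; simpl; lra|].
    replace (k + S r)%nat with (S (k + r)) by lia.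
    eapply Rle_trans; [apply env_tail_ratio; lia|]; fold q. simpl; rewrite Rmult_assoc.
    apply Rmult_le_compat_l; lra. }
  apply Rle_trans with (lsum (fun a => if (k <? a)%nat then f a * (INR a - INR k) else 0) (seq 1 K)).
  - apply lsum_le; intros a Ha; apply in_seq in Ha; pose proof (Hp a ltac:(lia)).
    destruct (Nat.ltb_spec k a) as [Hka|Hka].
    + apply lt_INR in Hka. rewrite Rmax_left by lra. apply Rmult_le_compat_r; lra.
    + apply le_INR in Hka. rewrite Rmax_right by lra. lra.
  - eapply Rle_trans; [apply lsum_restrict|].
    + intros a Hka; apply Rmult_le_pos; [apply envelope_nonneg; lia|].
      apply lt_INR in Hka; lra.
    + replace (seq (S k) K) with (map (fun r => S (k + r)) (seq 0 K)).
      2:{ transitivity (map S (map (Nat.add k) (seq 0 K))); [rewrite map_map; reflexivity|].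
          rewrite <- seq_shift. f_equal. clear. 
          induction K as [|K IH]; [reflexivity|].
          rewrite !seq_S, map_app, IH; reflexivity. }
      rewrite lsum_map.
      apply Rle_trans with (env_tail f k * lsum (fun r => INR (S r) * q ^ r) (seq 0 K)).
      * rewrite <- lsum_scal; apply lsum_le; intros r _.
        specialize (Hgeo r). rewrite (env_tail_S f (k + r) Hex) in Hgeo.
        pose proof (env_tail_pos (S (k + r))).
        replace (INR (S (k + r)) - INR k) with (INR (S r)) by (rewrite !S_INR, plus_INR; ring).
        pose proof (pos_INR (S r)). nra.
      * apply Rmult_le_compat_l; [apply Rlt_le, env_tail_pos|apply arith_geometric_le, Hq].
Qed.

End Tail.

End Envelope.

(** * Decoding quantised sources *)
Lemma lsum_pigeonhole (g : nat -> R) L B :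
  (1 <= L)%nat -> lsum g (seq 0 L) <= B -> exists u, (u < L)%nat /\ INR L * g u <= B.
Proof.
  intros HL HB.
  destruct (Classical_Prop.classic (exists u, (u < L)%nat /\ INR L * g u <= B)) as [|Hn]; [assumption|].
  exfalso. assert (HL0 : 0 < INR L) by (apply lt_0_INR; lia).
  assert (H : forall u, In u (seq 0 L) -> B / INR L < g u).
  { intros u Hu; apply in_seq in Hu. apply Rnot_le_lt; intros Hle; apply Hn.
    exists u; split; [lia|]. apply Rle_trans with (INR L * (B / INR L)).
    - apply Rmult_le_compat_l; lra.
    - apply Req_le; field; lra. }
  assert (H1 : lsum (fun _ => B / INR L) (seq 0 L) < lsum g (seq 0 L)).
  { destruct L as [|L']; [lia|]. cbn [seq]; rewrite !lsum_cons.
    apply Rplus_lt_le_compat; [apply H; left; reflexivity|].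
    apply lsum_le; intros u Hu; apply Rlt_le, H; right; assumption. }
  rewrite lsum_const, length_seq in H1.
  replace (INR L * (B / INR L)) with B in H1 by (field; lra). lra.
Qed.

(** The decoder rounds the count of j down to a bin of width [w j]; the word decodes to [t] when
    each count lies in bin number [t j]. *)
Definition decoded (w t : nat -> nat) (js x : list nat) : bool :=
  forallb (fun j => (count x j / w j =? t j)%nat) js.

Lemma level_choice n K (Q : list nat -> R) (w L : nat -> nat) js :
  (forall x, 0 <= Q x) -> NoDup js -> (forall j, In j js -> (1 <= L j)%nat) ->
  exists t, (forall j, In j js -> (t j < L j)%nat) /\
    lprod (fun j => INR (L j)) js * box_sum n K (fun x => if decoded w t js x then Q x else 0)
    <= box_sum n K Q.
Proof.
  intros HQ; induction js as [|j js IH]; intros Hnd HL.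
  - exists (fun _ => 0%nat); split; [intros _ []|].
    change (1 * box_sum n K Q <= box_sum n K Q); lra.
  - inversion Hnd as [|? ? Hj Hnd']; subst.
    destruct (IH Hnd' (fun i Hi => HL i (or_intror Hi))) as (t & Ht & Hbox).
    destruct (lsum_pigeonhole (fun u => box_sum n K (fun x =>
        if decoded w t js x then (if (u =? count x j / w j)%nat then Q x else 0) else 0)) (L j)
        (box_sum n K (fun x => if decoded w t js x then Q x else 0))) as (u & Hu & Hle).
    { apply HL; left; reflexivity. }
    { change (lsum (fun u => lsum (fun x => if decoded w t js x then
        (if (u =? count x j / w j)%nat then Q x else 0) else 0) (boxes n K)) (seq 0 (L j))
        <= box_sum n K (fun x => if decoded w t js x then Q x else 0)).
      rewrite lsum_swap; apply lsum_le; intros x _.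
      destruct (decoded w t js x); [|rewrite lsum_zero; lra].
      destruct (in_dec Nat.eq_dec (count x j / w j)%nat (seq 0 (L j))) as [Hin|Hin].
      - rewrite lsum_indicator; [lra|apply seq_NoDup|assumption].
      - rewrite (lsum_ext _ (fun _ => 0)), lsum_zero; [apply HQ|].
        intros v Hv; destruct (Nat.eqb_spec v (count x j / w j)%nat) as [E|E]; [|reflexivity].
        subst v; contradiction. }
    exists (fun i => if (i =? j)%nat then u else t i); split.
    + intros i [<-|Hi]; [rewrite Nat.eqb_refl; assumption|].
      destruct (Nat.eqb_spec i j); [subst; contradiction|auto].
    + assert (HLp : 0 <= lprod (fun j => INR (L j)) js).
      { apply Rlt_le, lprod_pos; intros i Hi; apply lt_0_INR.
        pose proof (HL i (or_intror Hi)); lia. }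
      rewrite lprod_cons, (Rmult_comm (INR (L j))), Rmult_assoc.
      eapply Rle_trans; [|exact Hbox]. apply Rmult_le_compat_l; [assumption|].
      eapply Rle_trans; [|exact Hle]. apply Rmult_le_compat_l; [apply pos_INR|].
      apply Req_le, box_sum_ext; intros x _ _.
      cbn [decoded forallb]; rewrite Nat.eqb_refl.
      assert (E : forallb (fun i => (count x i / w i =? (if (i =? j)%nat then u else t i))%nat) js
                = decoded w t js x).
      { unfold decoded; clear -Hj; induction js as [|i js IH]; [reflexivity|]; simpl.
        destruct (Nat.eqb_spec i j) as [->|]; [exfalso; apply Hj; left; reflexivity|].
        rewrite IH; [reflexivity|]; intros H; apply Hj; right; assumption. }
      fold (decoded w t js x); rewrite E, (Nat.eqb_sym u).
      destruct (count x j / w j =? u)%nat, (decoded w t js x); reflexivity.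
Qed.

(** * Chebyshev bound for the decoder *)

Section Variance.

Variables (p : nat -> R) (K j : nat).
Hypotheses (Hp1 : lsum p (seq 1 K) = 1) (Hj : (1 <= j <= K)%nat).

Let d (a : nat) : R := (if (a =? j)%nat then 1 else 0) - p j.

Lemma count_cons_real a l :
  INR (count (a :: l) j) = (if (a =? j)%nat then 1 else 0) + INR (count l j).
Proof.
  simpl; destruct (Nat.eqb_spec a j), (Nat.eq_dec a j); try congruence; rewrite ?S_INR; lra.
Qed.

Lemma lsum_p_indicator : lsum (fun a => p a * (if (a =? j)%nat then 1 else 0)) (seq 1 K) = p j.
Proof.
  rewrite (lsum_ext _ (fun a => if (a =? j)%nat then p j else 0)).
  - apply lsum_indicator; [apply seq_NoDup|apply in_seq; lia].
  - intros a _; destruct (Nat.eqb_spec a j) as [->|]; ring.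
Qed.

Lemma deviation_mean : lsum (fun a => p a * d a) (seq 1 K) = 0.
Proof.
  unfold d.
  rewrite (lsum_ext _ (fun a => p a * (if (a =? j)%nat then 1 else 0) + (- p j) * p a)) by (intros; ring).
  rewrite lsum_plus, lsum_scal, Hp1, lsum_p_indicator; ring.
Qed.

Lemma deviation_square : lsum (fun a => p a * d a ^ 2) (seq 1 K) = p j * (1 - p j).
Proof.
  unfold d.
  rewrite (lsum_ext _ (fun a => (1 - 2 * p j) * (p a * (if (a =? j)%nat then 1 else 0)) + (p j * p j) * p a)).
  - rewrite lsum_plus, !lsum_scal, Hp1, lsum_p_indicator; ring.
  - intros a _; destruct (a =? j)%nat; ring.
Qed.

Lemma box_mass_1 n : box_sum n K (Pn p) = 1.
Proof. rewrite box_sum_Pn, Hp1, pow1; reflexivity. Qed.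

Lemma count_mean n : box_sum n K (fun x => Pn p x * (INR (count x j) - INR n * p j)) = 0.
Proof.
  induction n as [|n IH]; [rewrite box_sum_0; simpl; ring|].
  rewrite box_sum_S.
  rewrite (lsum_ext _ (fun a => p a * d a)); [apply deviation_mean|].
  intros a _.
  rewrite (box_sum_ext _ _ _ (fun l => (p a * d a) * Pn p l
     + p a * (Pn p l * (INR (count l j) - INR n * p j)))).
  - rewrite box_sum_plus, !box_sum_scal, IH, box_mass_1; ring.
  - intros l _ _; rewrite Pn_cons, count_cons_real, S_INR; unfold d; ring.
Qed.

Lemma count_variance n :
  box_sum n K (fun x => Pn p x * (INR (count x j) - INR n * p j) ^ 2) = INR n * (p j * (1 - p j)).
Proof.
  induction n as [|n IH]; [rewrite box_sum_0; simpl; ring|].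
  rewrite box_sum_S.
  rewrite (lsum_ext _ (fun a => p a * d a ^ 2 + (INR n * (p j * (1 - p j))) * p a)).
  - rewrite lsum_plus, lsum_scal, Hp1, deviation_square, S_INR; ring.
  - intros a _.
    rewrite (box_sum_ext _ _ _ (fun l => (p a * d a ^ 2) * Pn p l
       + ((2 * p a * d a) * (Pn p l * (INR (count l j) - INR n * p j))
       + p a * (Pn p l * (INR (count l j) - INR n * p j) ^ 2)))).
    + rewrite !box_sum_plus, !box_sum_scal, IH, count_mean, box_mass_1; ring.
    + intros l _ _; rewrite Pn_cons, count_cons_real, S_INR; unfold d; ring.
Qed.

End Variance.

(** The expected count will be the midpoint of its bin, so a count outside the bin is at least w / 2
    away. The right-hand side is scaled to dominate the error indicator. *)
Lemma decoding_deviation (c w t : nat) :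
  (1 <= w)%nat -> (c / w)%nat <> t ->
  1 <= 4 / INR w ^ 2 * (INR c - (INR t + 1/2) * INR w) ^ 2.
Proof.
  intros Hw Hne.
  assert (Hw0 : 0 < INR w) by (apply lt_0_INR; lia).
  assert (H : (INR w / 2) ^ 2 <= (INR c - (INR t + 1/2) * INR w) ^ 2).
  { destruct (Nat.lt_ge_cases c (t * w)) as [Hc|Hc].
    - apply lt_INR in Hc; rewrite mult_INR in Hc.
      replace ((INR c - (INR t + 1/2) * INR w) ^ 2) with (((INR t + 1/2) * INR w - INR c) ^ 2) by ring.
      apply pow_incr; lra.
    - assert (Hc2 : (S t * w <= c)%nat).
      { destruct (Nat.le_gt_cases (S t * w) c) as [|Hlt]; [assumption|].
        exfalso; apply Hne; symmetry; apply Nat.div_unique with (c - t * w)%nat; nia. }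
      apply le_INR in Hc2; rewrite mult_INR, S_INR in Hc2. apply pow_incr; lra. }
  apply Rmult_le_reg_l with (INR w ^ 2); [apply pow_lt; assumption|].
  replace (INR w ^ 2 * (4 / INR w ^ 2 * (INR c - (INR t + 1 / 2) * INR w) ^ 2))
    with (4 * (INR c - (INR t + 1 / 2) * INR w) ^ 2) by (field; lra).
  simpl in *; lra.
Qed.

(** Union bound over [js] of Chebyshev's inequality: symbol j fails with probability at most 4 n p_j
    (1 - p_j) / w_j^2, and n p_j is the midpoint (t_j + 1/2) w_j. *)
Lemma decoding_probability p n K (w t : nat -> nat) js eta :
  (forall a, (1 <= a)%nat -> 0 <= p a) -> lsum p (seq 1 K) = 1 ->
  (forall j, In j js -> (1 <= j <= K)%nat /\ (1 <= w j)%nat /\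
      INR n * p j = (INR (t j) + 1/2) * INR (w j) /\ 4 * (INR (t j) + 1/2) / INR (w j) <= eta) ->
  1 - INR (length js) * eta <= box_sum n K (fun x => if decoded w t js x then Pn p x else 0).
Proof.
  intros Hp Hp1 Hjs.
  enough (H : 1 - box_sum n K (fun x => if decoded w t js x then Pn p x else 0) <= INR (length js) * eta) by lra.
  rewrite <- (box_mass_1 p K Hp1 n).
  replace (box_sum n K (Pn p) - box_sum n K (fun x => if decoded w t js x then Pn p x else 0))
    with (box_sum n K (fun x => Pn p x * (if decoded w t js x then 0 else 1))).
  2:{ apply Rplus_eq_reg_r with (box_sum n K (fun x => if decoded w t js x then Pn p x else 0)).
      rewrite <- box_sum_plus; ring_simplify.
      apply box_sum_ext; intros x _ _; destruct (decoded w t js x); ring. }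
  apply Rle_trans with (box_sum n K (fun x => lsum (fun j =>
     4 / INR (w j) ^ 2 * (Pn p x * (INR (count x j) - INR n * p j) ^ 2)) js)).
  - apply box_sum_le; intros x _ Hf.
    assert (HP : 0 <= Pn p x).
    { apply Pn_nonneg; [assumption|]. eapply Forall_impl; [|exact Hf]; simpl; intros; lia. }
    rewrite (lsum_ext _ (fun j => Pn p x * (4 / INR (w j) ^ 2 * (INR (count x j) - INR n * p j) ^ 2)))
      by (intros; ring).
    rewrite lsum_scal; apply Rmult_le_compat_l; [assumption|].
    assert (Hnn : forall j, In j js -> 0 <= 4 / INR (w j) ^ 2 * (INR (count x j) - INR n * p j) ^ 2).
    { intros j Hj; destruct (Hjs j Hj) as (_ & Hw & _).
      apply Rmult_le_pos; [|apply pow2_ge_0].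
      apply Rmult_le_pos; [lra|]. apply Rlt_le, Rinv_0_lt_compat, pow_lt, lt_0_INR; lia. }
    destruct (decoded w t js x) eqn:E; [apply lsum_nonneg; assumption|].
    assert (He : exists j, In j js /\ (count x j / w j)%nat <> t j).
    { clear -E; unfold decoded in E; induction js as [|j js IH]; [discriminate|]; simpl in E.
      destruct (Nat.eqb_spec (count x j / w j) (t j)) as [H|H].
      - destruct (IH E) as (i & Hi & Hne); exists i; split; [right|]; assumption.
      - exists j; split; [left; reflexivity|assumption]. }
    destruct He as (j & Hj & Hne); destruct (Hjs j Hj) as (_ & Hw & Hth & _).
    eapply Rle_trans; [|apply (lsum_term _ _ j Hnn Hj)].
    rewrite Hth; apply decoding_deviation; assumption.
  - change (lsum (fun x => lsum (fun j => 4 / INR (w j) ^ 2 *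
       (Pn p x * (INR (count x j) - INR n * p j) ^ 2)) js) (boxes n K) <= INR (length js) * eta).
    rewrite lsum_swap, <- lsum_const.
    apply lsum_le; intros j Hj; destruct (Hjs j Hj) as (HjK & Hw & Hth & Heta).
    rewrite lsum_scal.
    change (4 / INR (w j) ^ 2 * box_sum n K (fun x => Pn p x * (INR (count x j) - INR n * p j) ^ 2) <= eta).
    rewrite (count_variance p K j Hp1 HjK n), <- Rmult_assoc.
    eapply Rle_trans; [|exact Heta].
    assert (Hw0 : 0 < INR (w j)) by (apply lt_0_INR; lia).
    pose proof (pos_INR (t j)). pose proof (Hp j ltac:(lia)).
    replace (4 / INR (w j) ^ 2 * INR n * (p j * (1 - p j)))
      with (4 / INR (w j) ^ 2 * (INR n * p j) * (1 - p j)) by ring.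
    rewrite Hth.
    replace (4 / INR (w j) ^ 2 * ((INR (t j) + 1 / 2) * INR (w j)))
      with (4 * (INR (t j) + 1 / 2) / INR (w j)) by (field; lra).
    rewrite <- (Rmult_1_r (4 * (INR (t j) + 1 / 2) / INR (w j))) at 2.
    apply Rmult_le_compat_l; [|lra].
    apply Rmult_le_pos; [lra|apply Rlt_le, Rinv_0_lt_compat; assumption].
Qed.

(** * Sources with prescribed levels and the minimax redundancy *)

Lemma ln_lprod {A} (g : A -> R) l :
  (forall a, In a l -> 0 < g a) -> ln (lprod g l) = lsum (fun a => ln (g a)) l.
Proof.
  induction l as [|a l IH]; intros H; [apply ln_1|].
  rewrite lprod_cons, lsum_cons, ln_mult, IH; auto with datatypes.
  apply lprod_pos; auto with datatypes.
Qed.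

Lemma sum_n_lsum (p : nat -> R) N : sum_n (fun k => p (S k)) N = lsum p (seq 1 (S N)).
Proof.
  induction N as [|N IH].
  - rewrite sum_O; unfold lsum; simpl; ring.
  - rewrite sum_Sn, IH, (seq_S (S N)), lsum_app, lsum_cons.
    change (lsum p nil) with 0; simpl Nat.add; rewrite Rplus_0_r; reflexivity.
Qed.

Lemma is_series_finite_support (p : nat -> R) J l :
  (forall j, (J < j)%nat -> p j = 0) -> lsum p (seq 1 J) = l -> is_series (fun k => p (S k)) l.
Proof.
  intros Hp Hl.
  apply (filterlim_ext_loc (fun _ => l)); [|apply filterlim_const].
  exists J; intros N HN.
  rewrite sum_n_lsum, <- Hl.
  replace (S N) with (J + (S N - J))%nat by lia.
  rewrite seq_app, lsum_app, (lsum_ext _ (fun _ => 0) (seq (1 + J) (S N - J))), lsum_zero; [ring|].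
  intros a Ha; apply in_seq in Ha; apply Hp; lia.
Qed.

(** The first [j0] symbols receive the remaining mass in proportion to the envelope. As their
    envelope sums to at least 1, the proportion is at most 1 and the source stays in the class. *)
Lemma source_with_tail f (theta : nat -> R) j0 D :
  (forall j, (1 <= j)%nat -> 0 < f j <= 1) -> ex_series (fun i => f (S i)) ->
  1 <= lsum f (seq 1 j0) -> env_tail f j0 <= 1 ->
  (forall j, In j (seq (S j0) D) -> 0 <= theta j <= f j) ->
  exists p, in_Lambda f p /\ lsum p (seq 1 (j0 + D)) = 1 /\
    (forall j, (j0 + D < j)%nat -> p j = 0) /\
    (forall j, In j (seq (S j0) D) -> p j = theta j).
Proof.
  intros Hf Hex HS Htail Hth.
  assert (Hf0 : forall j, (1 <= j)%nat -> 0 <= f j) by (intros j Hj; pose proof (Hf j Hj); lra).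
  set (S0 := lsum f (seq 1 j0)) in *.
  set (T := lsum theta (seq (S j0) D)).
  assert (HT0 : 0 <= T) by (apply lsum_nonneg; intros; apply Hth; assumption).
  assert (HT1 : T <= 1).
  { apply Rle_trans with (lsum f (seq (S j0) D)); [apply lsum_le; intros; apply Hth; assumption|].
    pose proof (lsum_seq_le_env_tail f D j0 Hex Hf0); lra. }
  assert (Hc : 0 <= (1 - T) / S0 <= 1).
  { split; [apply Rmult_le_pos; [lra|apply Rlt_le, Rinv_0_lt_compat; lra]|].
    apply (fun Hc => proj2 (Rle_div_l _ _ _ Hc)); lra. }
  set (p := fun j => if (j <=? j0)%nat then (1 - T) / S0 * f j
                     else if (j <=? j0 + D)%nat then theta j else 0).
  assert (Hp1 : forall j, In j (seq (S j0) D) -> p j = theta j).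
  { intros j Hj; apply in_seq in Hj; unfold p.
    destruct (Nat.leb_spec j j0); [lia|]; destruct (Nat.leb_spec j (j0 + D)); [reflexivity|lia]. }
  assert (Hp2 : forall j, (j0 + D < j)%nat -> p j = 0).
  { intros j Hj; unfold p.
    destruct (Nat.leb_spec j j0); [lia|]; destruct (Nat.leb_spec j (j0 + D)); [lia|reflexivity]. }
  assert (Hsum : lsum p (seq 1 (j0 + D)) = 1).
  { rewrite seq_app, lsum_app, (lsum_ext p (fun j => (1 - T) / S0 * f j) (seq 1 j0)).
    - rewrite lsum_scal; fold S0; simpl Nat.add.
      rewrite (lsum_ext p theta) by assumption; fold T; field; lra.
    - intros j Hj; apply in_seq in Hj; unfold p; destruct (Nat.leb_spec j j0); [reflexivity|lia]. }
  exists p; split; [|split; [|split]]; try assumption.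
  split; [|apply is_series_finite_support with (j0 + D)%nat; assumption].
  intros j Hj; pose proof (Hf j Hj) as Hfj; unfold p.
  destruct (Nat.leb_spec j j0).
  - split; [apply Rmult_le_pos; lra|].
    rewrite <- (Rmult_1_l (f j)) at 2; apply Rmult_le_compat_r; lra.
  - destruct (Nat.leb_spec j (j0 + D)); [apply Hth, in_seq; lia|lra].
Qed.

Lemma le_minimax_red f n v :
  (forall Q, is_prob n Q -> exists p, in_Lambda f p /\ Rbar_le v (KL n (Pn p) Q)) ->
  Rbar_le v (minimax_red f n).
Proof.
  intros H; unfold minimax_red, Rbar_glb.
  destruct (Rbar_ex_glb _) as (l & Hlb & Hl); simpl; apply Hl.
  intros r (Q & HQ & ->); destruct (H Q HQ) as (p & Hp & Hv).
  eapply Rbar_le_trans; [exact Hv|].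
  unfold Rmax_red, Rbar_lub; destruct (Rbar_ex_lub _) as (u & Hu & Hlub); simpl; apply Hu.
  exists p; split; [assumption|reflexivity].
Qed.

Lemma Pn_zero_factor p J x :
  (forall j, (J < j)%nat -> p j = 0) ->
  ~ List.Forall (fun a => (a <= J)%nat) x -> Pn p x = 0.
Proof.
  intros Hp; induction x as [|a x IH]; intros Hx; [exfalso; apply Hx; constructor|].
  rewrite Pn_cons; destruct (Nat.le_gt_cases a J) as [Ha|Ha].
  - rewrite IH; [ring|]; intros Hf; apply Hx; constructor; assumption.
  - rewrite Hp by assumption; ring.
Qed.

(** Symbol j has L j bins of width V L j, so expected counts stay below V (L j)^2 <= n f j. Their
    standard deviation is at most sqrt V times L j, a fraction 1 / sqrt V of the width; each symbol
    is thus misread with probability at most 4 / V. *)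
Lemma minimax_red_ge f n j0 D V (L : nat -> nat) :
  is_envelope f -> (1 <= n)%nat -> (1 <= V)%nat ->
  1 <= lsum f (seq 1 j0) -> env_tail f j0 <= 1 ->
  (forall j, In j (seq (S j0) D) -> (1 <= L j)%nat /\ INR V * INR (L j) ^ 2 <= INR n * f j) ->
  Rbar_le (Finite (((1 - INR D * (4 / INR V)) * lsum (fun j => ln (INR (L j))) (seq (S j0) D) - 1) / ln 2))
    (minimax_red f n).
Proof.
  intros (Hf & Hex & _) Hn HV HS Htail HL; apply le_minimax_red; intros Q [HQ HQ1].
  assert (Hn0 : 0 < INR n) by (apply lt_0_INR; lia).
  assert (HV0 : 0 < INR V) by (apply lt_0_INR; lia).
  assert (HQbox : box_sum n (j0 + D) Q <= 1).
  { pose proof (box_sum_le_tsum n Q (j0 + D)) as H; rewrite HQ1 in H; exact H. }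
  set (w := fun j => (V * L j)%nat).
  destruct (level_choice n (j0 + D) Q w L (seq (S j0) D) HQ (seq_NoDup _ _)) as (t & Ht & Hbox).
  { intros j Hj; apply HL, Hj. }
  assert (HLp : forall j, In j (seq (S j0) D) -> 0 < INR (L j)).
  { intros j Hj; apply lt_0_INR; destruct (HL j Hj); lia. }
  assert (Htl : forall j, In j (seq (S j0) D) -> INR (t j) + 1 / 2 <= INR (L j)).
  { intros j Hj; pose proof (Ht j Hj) as Hlt; apply le_INR in Hlt; rewrite S_INR in Hlt; lra. }
  destruct (source_with_tail f (fun j => (INR (t j) + 1/2) * INR (w j) / INR n) j0 D Hf Hex HS Htail)
    as (p & Hp & Hp1 & Hp0 & Hpth).
  { intros j Hj; pose proof (HLp j Hj); pose proof (Htl j Hj); pose proof (pos_INR (t j)).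
    destruct (HL j Hj) as [_ HLf]. unfold w; rewrite mult_INR.
    assert (0 < INR V * INR (L j)) by (apply Rmult_lt_0_compat; assumption).
    split.
    - apply Rmult_le_pos; [apply Rmult_le_pos; lra|apply Rlt_le, Rinv_0_lt_compat; assumption].
    - apply (fun Hc => proj2 (Rle_div_l _ _ _ Hc)); [assumption|].
      apply Rle_trans with (INR (L j) * (INR V * INR (L j))).
      + apply Rmult_le_compat_r; lra.
      + simpl in HLf; lra. }
  exists p; split; [assumption|].
  assert (Hpn : forall j, (1 <= j)%nat -> 0 <= p j) by (intros j Hj; apply (proj1 Hp), Hj).
  set (js := seq (S j0) D) in *.
  set (Lam := lprod (fun j => INR (L j)) js) in *.
  assert (HLam : 1 <= Lam).
  { unfold Lam; clear -HL; induction js as [|j js IH]; [apply Rle_refl|].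
    rewrite lprod_cons, <- (Rmult_1_r 1). apply Rmult_le_compat; try lra.
    - change 1 with (INR 1); apply le_INR, HL; left; reflexivity.
    - apply IH; intros i Hi; apply HL; right; assumption. }
  rewrite <- (ln_lprod (fun j => INR (L j))) by assumption; fold Lam.
  apply KL_ge with (J := (j0 + D)%nat) (A := decoded w t js); try assumption.
  - intros x Hx; apply Pn_nonneg; assumption.
  - intros x Hx; apply Pn_zero_factor with (j0 + D)%nat; assumption.
  - rewrite box_sum_Pn, Hp1, pow1; reflexivity.
  - apply Rmult_le_reg_l with Lam; [lra|]. rewrite Rinv_r by lra. lra.
  - replace (INR D) with (INR (length js)) by (unfold js; rewrite length_seq; reflexivity).
    apply decoding_probability; try assumption.
    intros j Hj; pose proof (HLp j Hj); pose proof (Htl j Hj).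
    destruct (HL j Hj) as [HL1 _]. repeat split.
    + unfold js in Hj; apply in_seq in Hj; lia.
    + unfold js in Hj; apply in_seq in Hj; lia.
    + unfold w; nia.
    + rewrite Hpth by assumption; field; lra.
    + unfold w; rewrite mult_INR.
      apply Rmult_le_reg_r with (INR V * INR (L j)); [apply Rmult_lt_0_compat; assumption|].
      replace (4 * (INR (t j) + 1 / 2) / (INR V * INR (L j)) * (INR V * INR (L j)))
        with (4 * (INR (t j) + 1 / 2)) by (field; lra).
      replace (4 / INR V * (INR V * INR (L j))) with (4 * INR (L j)) by (field; lra). lra.
Qed.

(** * Asymptotics *)
Lemma nfloor_spec x : 0 <= x -> INR (Defs.nfloor x) <= x < INR (Defs.nfloor x) + 1.
Proof.
  intros Hx; unfold Defs.nfloor.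
  destruct (base_Int_part x) as [H1 H2].
  assert (0 <= Int_part x)%Z.
  { apply Z.lt_succ_r, lt_IZR; rewrite succ_IZR; lra. }
  rewrite INR_IZR_INZ, Z2Nat.id by assumption; lra.
Qed.

Lemma ln_INR_unbounded B : exists N, forall n, (N <= n)%nat -> B < ln (INR n).
Proof.
  destruct (INR_unbounded (exp B)) as [N HN]; exists N; intros n Hn.
  apply le_INR in Hn. rewrite <- (ln_exp B); apply ln_increasing; [apply exp_pos|lra].
Qed.

(** Splitting the exponent into eight parts makes 1 + x <= exp x sharp enough. The value 3/4
    suffices for (121/100) (22/10) (3/4) = 1.9965 < 2. *)
Lemma ln2_le : ln 2 <= 3/4.
Proof.
  rewrite <- (ln_exp (3/4)); apply ln_le; [lra|].
  replace (3/4) with (INR 8 * (3/32)) by (simpl; field).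
  rewrite <- exp_pow.
  apply Rle_trans with ((1 + 3/32) ^ 8); [lra|].
  apply pow_incr; split; [lra|apply exp_ineq1_le].
Qed.

Lemma lsum_seq_chord j0 D mu : 0 < mu ->
  lsum (fun j => 1 - INR (pred j) / mu) (seq (S j0) D) >=
  INR D - INR D * INR j0 / mu - INR D * INR D / (2 * mu).
Proof.
  intros Hmu; apply Rle_ge; induction D as [|D IH].
  - unfold lsum; simpl; apply Req_le; field; lra.
  - rewrite seq_S, lsum_app, lsum_cons.
    change (lsum (fun j => 1 - INR (pred j) / mu) nil) with 0.
    simpl Nat.add; simpl Nat.pred; rewrite plus_INR, S_INR.
    eapply Rle_trans; [|apply Rplus_le_compat_r, IH].
    apply Rmult_le_reg_r with mu; [assumption|].
    apply Rminus_le_0. 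
    replace ((INR D - INR D * INR j0 / mu - INR D * INR D / (2 * mu) + (1 - (INR j0 + INR D) / mu + 0)) * mu -
      (INR D + 1 - (INR D + 1) * INR j0 / mu - (INR D + 1) * (INR D + 1) / (2 * mu)) * mu)
      with (1 / 2) by (field; lra). lra.
Qed.

(** Here y = ln n, S is the sum of ln (L j), and E the loss per symbol. With D close to m the main
    term is (1/2) y m (1/2). The losses are delta from the window, delta / 2 from E, and the rest
    from the decoding error and the final -1; together less than 3 delta. *)
Lemma lower_estimate m y S delta D j0 E :
  0 < delta < 1/10 -> 1 <= y -> 1 + INR j0 <= delta * m -> 2 <= delta * m ->
  (1 - delta) * m - 1 < INR (j0 + D) <= (1 - delta) * m ->
  0 <= E <= delta / 2 * y ->
  1/2 * y * (INR D - INR D * INR j0 / m - INR D * INR D / (2 * m)) - INR D * E <= S ->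
  (1/4 - 3 * delta) * m * y <= (1 - delta) * S - 1.
Proof.
  intros Hd Hy Hj0 Hm HD HE HS.
  assert (Hm0 : 0 < m) by nra.
  rewrite plus_INR in HD; pose proof (pos_INR j0); pose proof (pos_INR D).
  assert (HD1 : (1 - 2 * delta) * m <= INR D) by lra.
  assert (HD2 : INR D <= m) by nra.
  assert (Hj : INR j0 / m <= delta) by (apply (fun Hc => proj2 (Rle_div_l _ _ _ Hc)); lra).
  assert (HDm : INR D / (2 * m) <= 1/2) by (apply (fun Hc => proj2 (Rle_div_l _ _ _ Hc)); lra).
  assert (H1 : (1 - 2 * delta) * m * (1/2 - delta) <=
     INR D - INR D * INR j0 / m - INR D * INR D / (2 * m)).
  { replace (INR D - INR D * INR j0 / m - INR D * INR D / (2 * m))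
      with (INR D * (1 - INR j0 / m - INR D / (2 * m))) by (field; lra).
    apply Rmult_le_compat; try lra. apply Rmult_le_pos; lra. }
  assert (H2 : INR D * E <= m * (delta / 2 * y)) by (apply Rmult_le_compat; lra).
  assert (H3 : 1/2 * y * ((1 - 2 * delta) * m * (1/2 - delta)) - m * (delta / 2 * y) <= S).
  { eapply Rle_trans; [|exact HS].
    assert (1/2 * y * ((1 - 2 * delta) * m * (1/2 - delta)) <=
      1/2 * y * (INR D - INR D * INR j0 / m - INR D * INR D / (2 * m))).
    { apply Rmult_le_compat_l; lra. } lra. }
  assert (Hmy : 2 <= delta * (m * y)) by nra.
  set (z := m * y) in *. assert (Hz : 0 < z) by (apply Rmult_lt_0_compat; lra).
  assert (H4 : (1/4 - 3/2 * delta) * z <= S).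
  { eapply Rle_trans; [|exact H3]. unfold z.
    replace (1/2 * y * ((1 - 2 * delta) * m * (1/2 - delta)) - m * (delta / 2 * y))
      with ((1/4 - 3/2 * delta) * (m * y) + delta * delta * (m * y)) by field.
    assert (0 <= delta * delta * (m * y)) by (fold z; apply Rmult_le_pos; nra). lra. }
  replace ((1 / 4 - 3 * delta) * m * y) with ((1/4 - 3 * delta) * z) by (unfold z; ring).
  assert ((1 - delta) * ((1/4 - 3/2 * delta) * z) <= (1 - delta) * S) by (apply Rmult_le_compat_l; lra).
  assert (0 <= delta * delta * z) by (apply Rmult_le_pos; nra).
  nra.
Qed.

Section Asymptotics.

Variables (f : nat -> R) (Fs dFs : R -> R) (m : nat -> R) (lac : list nat -> R).
Hypotheses (Henv : is_envelope f) (HFs : smoothed_envelope f Fs dFs)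
  (Hhaz : nondecreasing_hazard Fs dFs) (Hm : is_threshold Fs m) (Hlac : arith_coder_len lac).

(** Once the tail is below the excess of the total over 1, the head of the envelope still sums to at
    least 1; the minimum with 1 gives both properties at one cut-off. *)
Lemma envelope_start : exists k1, (1 <= k1)%nat /\
  (forall k, (k1 <= k)%nat -> env_tail f k < 1) /\ 1 <= lsum f (seq 1 k1).
Proof.
  destruct Henv as (Hf & Hex & H1).
  assert (H0 : env_tail f 0 = Series (fun k => f (S k))) by reflexivity.
  destruct (env_tail_small f Fs dFs HFs (Rmin 1 (env_tail f 0 - 1))) as [k0 Hk0].
  { apply Rmin_pos; lra. }
  exists (S k0); split; [lia|split].
  - intros k Hk; pose proof (Hk0 k ltac:(lia)); pose proof (Rmin_l 1 (env_tail f 0 - 1)); lra.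
  - pose proof (Hk0 (S k0) ltac:(lia)); pose proof (Rmin_r 1 (env_tail f 0 - 1)).
    pose proof (lsum_env_tail f (S k0) 0 Hex) as E; simpl Nat.add in E. lra.
Qed.

Lemma threshold_log : exists C, 0 < C /\ exists N, forall n, (N <= n)%nat -> m n <= C * ln (INR n).
Proof.
  destruct envelope_start as (k1 & Hk1 & Htail & _).
  pose proof (hazard_pos f Fs dFs Henv HFs k1 Hk1 Htail) as Hh.
  set (h0 := hazard Fs dFs (INR k1)) in *.
  pose proof (INR_k1 k1 Hk1) as Hk.
  assert (Hi : 0 < / h0) by (apply Rinv_0_lt_compat; assumption).
  exists (INR k1 + / h0); split; [lra|].
  destruct (threshold_unbounded f Fs dFs m Henv HFs Hm k1 Hk1 Htail (INR k1)) as [N1 HN1].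
  destruct (ln_INR_unbounded 1) as [N2 HN2].
  exists (1 + N1 + N2)%nat; intros n Hn.
  pose proof (HN1 n ltac:(lia)); pose proof (HN2 n ltac:(lia)).
  pose proof (threshold_le_ln f Fs dFs m Henv HFs Hhaz Hm k1 Hk1 Htail n ltac:(lia) ltac:(lra)) as H1.
  fold h0 in H1.
  assert (m n - INR k1 <= / h0 * ln (INR n)).
  { apply Rmult_le_reg_l with h0; [assumption|]. rewrite <- Rmult_assoc, Rinv_r by lra. lra. }
  nra.
Qed.

Lemma lower_bound eps : 0 < eps -> exists N, forall n, (N <= n)%nat ->
  Rbar_le (Finite ((1/4 - eps) * m n * log2 (INR n))) (minimax_red f n).
Proof.
  intros Heps.
  set (delta := Rmin (eps / 3) (1/20)).
  assert (Hd : 0 < delta < 1/10 /\ 3 * delta <= eps).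
  { unfold delta; pose proof (Rmin_l (eps / 3) (1/20)); pose proof (Rmin_r (eps / 3) (1/20)).
    assert (0 < Rmin (eps / 3) (1/20)) by (apply Rmin_pos; lra). lra. }
  destruct Hd as [Hd Hde].
  destruct envelope_start as (k1 & Hk1 & Htail & HS1).
  destruct threshold_log as (C & HC & N0 & HN0).
  (* V will be W D, so the union bound D (4 / V) = 4 / W is at most delta however large the window
     is. *)
  destruct (INR_unbounded (4 / delta)) as [W HW].
  assert (HWp : 0 < 4 / delta) by (apply Rdiv_lt_0_compat; lra).
  pose proof (hazard_pos f Fs dFs Henv HFs k1 Hk1 Htail) as Hh.
  pose proof (INR_k1 k1 Hk1) as Hk.
  set (c := (1 - exp (- hazard Fs dFs (INR k1))) * env_tail f k1).
  assert (Hc : 0 < c < 1).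
  { assert (0 < exp (- hazard Fs dFs (INR k1)) < 1).
    { split; [apply exp_pos|]. rewrite <- exp_0; apply exp_increasing; lra. }
    pose proof (env_tail_pos f Henv k1); pose proof (Htail k1 (Nat.le_refl _)).
    unfold c; split; [apply Rmult_lt_0_compat; lra|]. nra. }
  destruct (threshold_unbounded f Fs dFs m Henv HFs Hm k1 Hk1 Htail (Rmax ((1 + INR k1) / delta) (2 / delta)))
    as [N1 HN1].
  (* For ln n above B the bounded terms fit into half of delta ln n; the other half absorbs ln V,
     which is O(ln ln n) because D <= m_n = O(ln n). *)
  set (B := 2 / delta * (ln (INR W * C) - ln c + 2 * ln 2 - 1 - ln (delta / 2))).
  destruct (ln_INR_unbounded (Rmax 1 B)) as [N2 HN2].
  exists (1 + N0 + N1 + N2)%nat; intros n Hn.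
  specialize (HN0 n ltac:(lia)); specialize (HN1 n ltac:(lia)); specialize (HN2 n ltac:(lia)).
  set (mu := m n) in *. set (y := ln (INR n)) in *.
  assert (Hm1 : 1 + INR k1 <= delta * mu).
  { pose proof (Rmax_l ((1 + INR k1) / delta) (2 / delta)).
    assert (Hlt : (1 + INR k1) / delta <= mu) by lra.
    apply (fun Hc => proj1 (Rle_div_l _ _ _ Hc)) in Hlt; lra. }
  assert (Hm2 : 2 <= delta * mu).
  { pose proof (Rmax_r ((1 + INR k1) / delta) (2 / delta)).
    assert (Hlt : 2 / delta <= mu) by lra.
    apply (fun Hc => proj1 (Rle_div_l _ _ _ Hc)) in Hlt; lra. }
  assert (Hy1 : 1 <= y) by (pose proof (Rmax_l 1 B); lra).
  assert (HyB : B <= y) by (pose proof (Rmax_r 1 B); lra).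
  assert (Hmu0 : 0 < mu) by nra.
  assert (Hn0 : 0 < INR n) by (apply lt_0_INR; lia).
  destruct (nfloor_spec ((1 - delta) * mu) ltac:(nra)) as [HJ1 HJ2].
  set (J := Defs.nfloor ((1 - delta) * mu)) in *.
  assert (HJk : (k1 < J)%nat).
  { apply INR_lt. nra. }
  set (D := (J - k1)%nat). assert (HJD : J = (k1 + D)%nat) by (unfold D; lia).
  assert (HD0 : (1 <= D)%nat) by (unfold D; lia).
  assert (HD0R : 1 <= INR D) by (change 1 with (INR 1); apply le_INR, HD0).
  assert (HDm : INR D <= mu).
  { assert (INR D <= INR J) by (apply le_INR; unfold D; lia). nra. }
  assert (HWR : 0 < INR W) by lra.
  assert (HW0 : (1 <= W)%nat) by (destruct W; [simpl in HWR; lra|lia]).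
  set (V := (W * D)%nat).
  assert (HV0 : (1 <= V)%nat) by (unfold V; nia).
  assert (HVR : 0 < INR V) by (apply lt_0_INR; lia).
  assert (HlnV : ln (INR V) - ln c + 2 * ln 2 <= delta * y).
  { assert (H1 : ln (INR V) <= ln (INR W * C) + ln y).
    { rewrite <- ln_mult; [|apply Rmult_lt_0_compat; lra|lra].
      apply ln_le; [assumption|]. unfold V; rewrite mult_INR, Rmult_assoc.
      apply Rmult_le_compat_l; lra. }
    pose proof (ln_le_minus_1 (delta / 2 * y) ltac:(nra)) as H2.
    rewrite ln_mult in H2 by lra.
    assert (H3 : ln (INR W * C) - ln c + 2 * ln 2 - 1 - ln (delta / 2) <= delta / 2 * y).
    { apply Rmult_le_reg_l with (2 / delta); [apply Rdiv_lt_0_compat; lra|].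
      fold B. replace (2 / delta * (delta / 2 * y)) with y by (field; lra). assumption. }
    lra. }
  (* The loss in ln (L j): half of ln V - ln c inside the square root, and ln 2 for rounding down a
     real number that is at least 1. *)
  set (E := 1/2 * (ln (INR V) - ln c) + ln 2).
  assert (HE : 0 <= E <= delta / 2 * y).
  { unfold E; split; [|lra].
    assert (0 <= ln (INR V)).
    { rewrite <- ln_1; apply ln_le; [lra|]. change 1 with (INR 1); apply le_INR, HV0. }
    assert (ln c < 0) by (rewrite <- ln_1; apply ln_increasing; lra).
    pose proof ln2_pos; lra. }
  (* The largest real number of levels compatible with V (L j)^2 <= n f j. *)
  set (r := fun j => sqrt (INR n * f j / INR V)).
  set (L := fun j => Defs.nfloor (r j)).
  assert (Hr : forall j, In j (seq (S k1) D) ->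
     0 < INR n * f j / INR V /\ 1/2 * (y * (1 - INR (pred j) / mu) + ln c - ln (INR V)) <= ln (r j) /\ 1 <= r j).
  { intros j Hj; apply in_seq in Hj.
    assert (Hi1 : INR (pred j) <= INR J) by (apply le_INR; lia).
    pose proof (envelope_ge f Fs dFs m Henv HFs Hhaz Hm k1 Hk1 Htail n (pred j)
      ltac:(lia) ltac:(lia)) as H1.
    assert (Hdm : 0 < delta * mu) by lra.
    specialize (H1 ltac:(fold mu; lra) ltac:(fold mu; nra)).
    replace (S (pred j)) with j in H1 by lia. fold c mu y in H1.
    assert (Hf0 : 0 < f j) by (apply Henv; lia).
    assert (Hpos : 0 < INR n * f j / INR V).
    { apply Rdiv_lt_0_compat; [apply Rmult_lt_0_compat|]; assumption. }
    assert (Hln : ln c - INR (pred j) / mu * y <= ln (f j)).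
    { apply Rle_trans with (ln (c * exp (- (INR (pred j) / mu * y)))).
      - rewrite ln_mult, ln_exp; [lra|lra|apply exp_pos].
      - apply ln_le; [apply Rmult_lt_0_compat; [lra|apply exp_pos]|assumption]. }
    assert (Hlr : ln (r j) = 1/2 * (y + ln (f j) - ln (INR V))).
    { unfold r; rewrite <- Rpower_sqrt by assumption.
      unfold Rpower; rewrite ln_exp, ln_div, ln_mult; try assumption.
      - unfold y; field.
      - apply Rmult_lt_0_compat; assumption. }
    assert (Hlow : 1/2 * (y * (1 - INR (pred j) / mu) + ln c - ln (INR V)) <= ln (r j)) by (rewrite Hlr; lra).
    repeat split; try assumption.
    assert (Hfrac : INR (pred j) / mu <= 1 - delta).
    { apply (fun Hc => proj2 (Rle_div_l _ _ _ Hc)); lra. }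
    assert (H0 : 0 <= ln (r j)).
    { eapply Rle_trans; [|exact Hlow]. pose proof ln2_pos.
      assert (y * delta <= y * (1 - INR (pred j) / mu)) by (apply Rmult_le_compat_l; lra). lra. }
    assert (Hr0 : 0 < r j) by (apply sqrt_lt_R0; assumption).
    rewrite <- (exp_ln (r j)), <- exp_0 by assumption. apply exp_le; assumption. }
  assert (HL : forall j, In j (seq (S k1) D) -> (1 <= L j)%nat /\
     r j / 2 <= INR (L j) <= r j).
  { intros j Hj; destruct (Hr j Hj) as (_ & _ & Hr1).
    destruct (nfloor_spec (r j) ltac:(lra)) as [Hl1 Hl2]; fold (L j) in Hl1, Hl2.
    assert (HL1 : (1 <= L j)%nat).
    { destruct (L j) eqn:EL; [simpl in Hl2; lra|lia]. }
    assert (1 <= INR (L j)) by (change 1 with (INR 1); apply le_INR, HL1).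
    repeat split; try assumption; lra. }
  pose proof (minimax_red_ge f n k1 D V L Henv ltac:(lia) HV0 HS1
    ltac:(apply Rlt_le, Htail; lia)) as Hmain.
  eapply Rbar_le_trans; [|apply Hmain].
  - simpl. set (S := lsum (fun j => ln (INR (L j))) (seq (Datatypes.S k1) D)).
    unfold log2; fold y; rewrite Rmult_div_assoc.
    apply Rmult_le_compat_r; [apply Rlt_le, Rinv_0_lt_compat, ln2_pos|].
    assert (HSlow : 1/2 * y * (INR D - INR D * INR k1 / mu - INR D * INR D / (2 * mu)) - INR D * E <= S).
    { apply Rle_trans with (lsum (fun j => 1/2 * y * (1 - INR (pred j) / mu) + (- E)) (seq (Datatypes.S k1) D)).
      - rewrite lsum_plus, lsum_scal, lsum_const, length_seq.
        pose proof (lsum_seq_chord k1 D mu Hmu0).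
        assert (1/2 * y * (INR D - INR D * INR k1 / mu - INR D * INR D / (2 * mu)) <=
          1/2 * y * lsum (fun j => 1 - INR (pred j) / mu) (seq (Datatypes.S k1) D)).
        { apply Rmult_le_compat_l; lra. } lra.
      - apply lsum_le; intros j Hj; destruct (Hr j Hj) as (_ & Hlow & Hr1).
        destruct (HL j Hj) as (_ & Hl & _).
        apply Rle_trans with (ln (r j / 2)); [|apply ln_le; lra].
        rewrite ln_div by lra. unfold E. lra. }
    pose proof (lower_estimate mu y S delta D k1 E Hd Hy1 Hm1 Hm2
      ltac:(rewrite <- HJD; lra) HE HSlow) as Hest.
    apply Rle_trans with ((1/4 - 3 * delta) * mu * y).
    { assert (0 <= mu * y) by nra. rewrite !Rmult_assoc. apply Rmult_le_compat_r; lra. }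
    eapply Rle_trans; [exact Hest|].
    apply Rplus_le_compat_r, Rmult_le_compat_r.
    + apply lsum_nonneg; intros j Hj; destruct (HL j Hj) as (Hl & _).
      rewrite <- ln_1; apply ln_le; [lra|]; change 1 with (INR 1); apply le_INR, Hl.
    + unfold V; rewrite mult_INR.
      replace (INR D * (4 / (INR W * INR D))) with (4 / INR W) by (field; lra).
      assert (4 / INR W <= delta); [|lra].
      apply (fun Hc => proj2 (Rle_div_l _ _ _ Hc)); [lra|].
      assert (Hle : 4 / delta <= INR W) by lra.
      apply (fun Hc => proj1 (Rle_div_l _ _ _ Hc)) in Hle; lra.
  - intros j Hj; destruct (HL j Hj) as (Hl1 & Hl2 & Hl3). split; [assumption|].
    destruct (Hr j Hj) as (Hpos & _ & Hr1).
    apply Rle_trans with (INR V * r j ^ 2).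
    + apply Rmult_le_compat_l; [lra|]. apply pow_incr; split; [apply pos_INR|assumption].
    + unfold r; rewrite pow2_sqrt by lra. apply Req_le; field; lra.
Qed.

Lemma etac_redundancy_le n : (1 <= n)%nat -> Rbar_le (minimax_red f n) (Rmax_red f n (etac_prob lac n)).
Proof.
  intros Hn; unfold minimax_red, Rbar_glb.
  destruct (Rbar_ex_glb _) as (l & Hlb & Hl); simpl; apply Hlb.
  exists (etac_prob lac n); split; [apply etac_is_prob; assumption|reflexivity].
Qed.

Lemma Rmax_red_le n Q B :
  (forall p, in_Lambda f p -> Rbar_le (KL n (Pn p) Q) B) -> Rbar_le (Rmax_red f n Q) B.
Proof.
  intros H; unfold Rmax_red, Rbar_lub; destruct (Rbar_ex_lub _) as (u & Hu & Hlub); simpl.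
  apply Hlub; intros r (p & Hp & ->); auto.
Qed.

(** Here mm = m_n, y = log2 n, lambda = log2 m_n, l = log2 mu and ly1 = log2 (n + 1). The bound 820
    makes 12/10 (mm + 1) + 7 <= 121/100 mm. The leading coefficient is 1.9965, and 10000 (1 + Cq) <=
    lambda turns the gap 0.0035 lambda into at least 35 (1 + Cq), more than the lower-order
    coefficients, below 30 + 3 Cq in total. *)
Lemma upper_estimate mm mu y lambda l Cq lnn ly1 :
  820 <= mm -> mm <= mu <= mm + 1 -> 1 <= y -> 0 <= lnn <= 3/4 * y -> ly1 <= 2 * y ->
  l <= lambda + 1 -> 0 <= l -> lambda <= 2 + mm / 2 -> 0 <= Cq -> 10000 * (1 + Cq) <= lambda ->
  (3 + (12/10 * l + 12)) + 2 * ly1 * (12/10 * mu + 6)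
    + ((12/10 * mu + 7) * (l + 1 + (12/10 * l + 12))
       + (4 * (12/10 * mu + 3) ^ 2 + 256) / mu) * lnn
    + 3 * (Cq * mm) <= 2 * mm * y * lambda.
Proof.
  intros Hmm Hmu Hy Hln Hly Hl Hl0 Hlam HCq HB.
  assert (H1 : (4 * (12/10 * mu + 3) ^ 2 + 256) / mu <= 8 * mm).
  { apply (fun Hc => proj2 (Rle_div_l _ _ _ Hc)); [lra|]. nra. }
  assert (H2 : (12/10 * mu + 7) * (l + 1 + (12/10 * l + 12)) <= 121/100 * mm * (22/10 * lambda + 16)).
  { apply Rmult_le_compat; lra. }
  assert (Hmy : mm <= mm * y) by nra.
  assert (H3 : ((12/10 * mu + 7) * (l + 1 + (12/10 * l + 12)) + (4 * (12/10 * mu + 3) ^ 2 + 256) / mu) * lnn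
     <= (121/100 * mm * (22/10 * lambda + 16) + 8 * mm) * (3/4 * y)).
  { apply Rle_trans with ((121/100 * mm * (22/10 * lambda + 16) + 8 * mm) * lnn).
    - apply Rmult_le_compat_r; lra.
    - apply Rmult_le_compat_l; [|lra]. nra. }
  assert (H4 : 2 * ly1 * (12/10 * mu + 6) <= 8 * (mm * y)).
  { apply Rle_trans with (4 * y * (12/10 * mu + 6)); [apply Rmult_le_compat_r; lra|].
    apply Rle_trans with (4 * y * (2 * mm)); [apply Rmult_le_compat_l; lra|lra]. }
  set (z := mm * y) in *. assert (Hz : 0 < z) by nra.
  assert (H5 : 3 + (12/10 * l + 12) <= z) by lra.
  assert (H6 : Cq * mm <= Cq * z) by (apply Rmult_le_compat_l; lra).
  assert (H7 : 10000 * (1 + Cq) * z <= lambda * z) by (apply Rmult_le_compat_r; lra).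
  assert (H8 : (121/100 * mm * (22/10 * lambda + 16) + 8 * mm) * (3/4 * y) =
     (121/100 * (22/10) * (3/4)) * (lambda * z) + (121/100 * 16 * (3/4) + 6) * z) by (unfold z; field).
  replace (2 * mm * y * lambda) with (2 * (lambda * z)) by (unfold z; ring).
  assert (0 <= Cq * z) by (apply Rmult_le_pos; lra).
  lra.
Qed.

Lemma upper_bound : exists N, forall n, (N <= n)%nat ->
  Rbar_le (Rmax_red f n (etac_prob lac n)) (Finite (2 * m n * log2 (INR n) * log2 (m n))).
Proof.
  destruct envelope_start as (k1 & Hk1 & Htail & _).
  set (Cq := / (1 - exp (- hazard Fs dFs (INR k1))) ^ 2).
  pose proof (hazard_pos f Fs dFs Henv HFs k1 Hk1 Htail) as Hh.
  pose proof (INR_k1 k1 Hk1) as Hk.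
  assert (HCq : 0 <= Cq).
  { assert (exp (- hazard Fs dFs (INR k1)) < 1) by (rewrite <- exp_0; apply exp_increasing; lra).
    apply Rlt_le, Rinv_0_lt_compat, pow_lt; lra. }
  set (B := exp (10000 * (1 + Cq) * ln 2)).
  destruct (threshold_unbounded f Fs dFs m Henv HFs Hm k1 Hk1 Htail (Rmax (Rmax 820 (INR k1)) B)) as [N1 HN1].
  destruct (ln_INR_unbounded (ln 2)) as [N2 HN2].
  exists (1 + N1 + N2)%nat; intros n Hn.
  specialize (HN1 n ltac:(lia)); specialize (HN2 n ltac:(lia)).
  pose proof (Rmax_l (Rmax 820 (INR k1)) B); pose proof (Rmax_r (Rmax 820 (INR k1)) B).
  pose proof (Rmax_l 820 (INR k1)); pose proof (Rmax_r 820 (INR k1)).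
  assert (Hn1 : 1 <= INR n) by (change 1 with (INR 1); apply le_INR; lia).
  destruct (nfloor_spec (m n) ltac:(lra)) as [Hf1 Hf2].
  (* An integer just above m_n: tails are controlled at integers only, and mu = k costs at most 1
     over m_n. *)
  set (k := S (Defs.nfloor (m n))).
  assert (HkR : INR k = INR (Defs.nfloor (m n)) + 1) by apply S_INR.
  assert (Hkk : (k1 <= k)%nat) by (apply INR_le; lra).
  pose proof (threshold_tail f Fs dFs m HFs Hm k1 Hk1 Htail n k ltac:(lia) Hkk ltac:(lra)) as Htl.
  apply Rmax_red_le; intros p Hp.
  eapply Rbar_le_trans.
  - apply (KL_etac_le lac p n k (INR k) (Cq * m n) Hlac ltac:(lia)).
    + intros j Hj; apply (proj1 Hp), Hj.
    + intros K; apply in_Lambda_mass with f; assumption.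
    + lra.
    + lra.
    + intros K; eapply Rle_trans; [apply Rmult_le_compat_l; [lra|apply (in_Lambda_tail f p k K Henv Hp)]|lra].
    + intros K; eapply Rle_trans;
        [apply Rmult_le_compat_l; [lra|
          apply (in_Lambda_excess f Fs dFs Henv HFs Hhaz k1 Hk1 Htail p k K Hp Hkk)]|].
      fold Cq. rewrite <- Rmult_assoc, (Rmult_comm Cq). apply Rmult_le_compat_r; lra.
  - pose proof ln2_pos; pose proof ln2_le.
    assert (Hy : 1 <= log2 (INR n)).
    { unfold log2; apply (fun Hc => proj1 (Rle_div_r _ _ _ Hc)); lra. }
    assert (Hlny : ln (INR n) = log2 (INR n) * ln 2) by (unfold log2; field; lra).
    unfold Rbar_le; apply upper_estimate; try lra.
    + rewrite Hlny. split; [nra|]. rewrite Rmult_comm. apply Rmult_le_compat_r; lra.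
    + apply Rle_trans with (log2 (2 * INR n)); [apply log2_le; lra|].
      rewrite log2_mult, log2_2 by lra. lra.
    + apply Rle_trans with (log2 (2 * m n)); [apply log2_le; lra|].
      rewrite log2_mult, log2_2 by lra. lra.
    + apply log2_nonneg; lra.
    (* Tangent at 4, giving log2 m_n <= 2 + m_n / 2. *)
    + pose proof (log2_le_ratio (m n) (2 ^ 2) ltac:(lra) ltac:(lra)) as Hr.
      rewrite log2_pow, log2_2 in Hr by lra. simpl in Hr. lra.
    + unfold log2; apply (fun Hc => proj1 (Rle_div_r _ _ _ Hc)); [lra|].
      rewrite <- (ln_exp (10000 * (1 + Cq) * ln 2)).
      apply ln_le; [apply exp_pos|fold B; lra].
Qed.

(** As m_n <= C ln n and ln n eventually exceeds C, m_n is at most the square of log2 n; the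
    constant is 2. *)
Lemma threshold_log2_order : exists C, exists N, forall n, (N <= n)%nat ->
  Rabs (log2 (m n)) <= C * Rabs (log2 (log2 (INR n))).
Proof.
  destruct envelope_start as (k1 & Hk1 & Htail & _).
  destruct threshold_log as (C & HC & N0 & HN0).
  destruct (threshold_unbounded f Fs dFs m Henv HFs Hm k1 Hk1 Htail 1) as [N1 HN1].
  destruct (ln_INR_unbounded (1 + C)) as [N2 HN2].
  exists 2, (N0 + N1 + N2)%nat; intros n Hn.
  specialize (HN0 n ltac:(lia)); specialize (HN1 n ltac:(lia)); specialize (HN2 n ltac:(lia)).
  pose proof ln2_pos; pose proof ln2_le.
  set (y := log2 (INR n)).
  assert (Hlny : ln (INR n) = y * ln 2) by (unfold y, log2; field; lra).
  assert (Hy : ln (INR n) <= y).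
  { assert (1 * ln (INR n) <= y * ln 2 / ln 2).
    { rewrite <- Hlny; apply (fun Hc => proj1 (Rle_div_r _ _ _ Hc)); [lra|]. nra. }
    replace (y * ln 2 / ln 2) with y in H1 by (field; lra). lra. }
  rewrite !Rabs_right by (apply Rle_ge, log2_nonneg; lra).
  apply Rle_trans with (log2 (y * y)).
  - apply log2_le; [lra|]. nra.
  - rewrite log2_mult by lra; lra.
Qed.

End Asymptotics.

Theorem theorem4 (f : nat -> R) (Fs dFs : R -> R) (m : nat -> R)
  (lac : list nat -> R) :
  is_envelope f ->
  smoothed_envelope f Fs dFs ->
  nondecreasing_hazard Fs dFs ->
  is_threshold Fs m ->
  arith_coder_len lac ->
  (forall eps : R, 0 < eps -> exists N : nat, forall n : nat, (N <= n)%nat ->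
     Rbar_le (Finite ((1/4 - eps) * m n * log2 (INR n))) (minimax_red f n)) /\
  (forall n : nat, (1 <= n)%nat ->
     Rbar_le (minimax_red f n) (Rmax_red f n (etac_prob lac n))) /\
  (forall eps : R, 0 < eps -> exists N : nat, forall n : nat, (N <= n)%nat ->
     Rbar_le (Rmax_red f n (etac_prob lac n))
             (Finite ((2 + eps) * m n * log2 (INR n) * log2 (m n)))) /\
  (forall eps : R, 0 < eps -> exists N : nat, forall n : nat, (N <= n)%nat ->
     Rbar_le (Rmax_red f n (etac_prob lac n))
             (Rbar_mult (Finite ((8 + eps) * log2 (m n))) (minimax_red f n))) /\
  (exists C : R, exists N : nat, forall n : nat, (N <= n)%nat ->
     Rabs (log2 (m n)) <= C * Rabs (log2 (log2 (INR n)))).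
Proof.
  intros Henv HFs Hhaz Hm Hlac.
  destruct (upper_bound f Fs dFs m lac Henv HFs Hhaz Hm Hlac) as [N1 HN1].
  destruct (envelope_start f Fs dFs Henv HFs) as (k1 & Hk1 & Htail & _).
  destruct (threshold_unbounded f Fs dFs m Henv HFs Hm k1 Hk1 Htail 1) as [N2 HN2].
  assert (Hpos : forall n, (1 + N2 <= n)%nat -> 1 < m n /\ 0 <= log2 (INR n) /\ 0 <= log2 (m n)).
  { intros n Hn; specialize (HN2 n ltac:(lia)); repeat split; [assumption| |apply log2_nonneg; lra].
    apply log2_nonneg; change 1 with (INR 1); apply le_INR; lia. }
  split; [exact (lower_bound f Fs dFs m Henv HFs Hhaz Hm)|].
  split; [exact (etac_redundancy_le f lac Hlac)|].
  split; [|split; [|exact (threshold_log2_order f Fs dFs m Henv HFs Hhaz Hm)]].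
  - intros eps Heps; exists (1 + N1 + N2)%nat; intros n Hn.
    destruct (Hpos n ltac:(lia)) as (H1 & H2 & H3).
    eapply Rbar_le_trans; [apply HN1; lia|]; simpl.
    assert (0 <= m n * log2 (INR n) * log2 (m n)) by (repeat (assumption || lra || apply Rmult_le_pos)).
    rewrite !(Rmult_assoc _ (m n)), !(Rmult_assoc _ (m n * _)); apply Rmult_le_compat_r; lra.
  - intros eps Heps.
    (* With this deficit the lower constant is 2 / (8 + eps), and multiplying by 8 + eps returns
       exactly the constant 2 of [upper_bound]. *)
    destruct (lower_bound f Fs dFs m Henv HFs Hhaz Hm (1/4 - 2 / (8 + eps))) as [N3 HN3].
    { assert (2 / (8 + eps) < 1/4); [|lra].
      apply (fun Hc => proj2 (Rlt_div_l _ _ _ Hc)); lra. }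
    exists (1 + N1 + N2 + N3)%nat; intros n Hn.
    destruct (Hpos n ltac:(lia)) as (H1 & H2 & H3).
    specialize (HN1 n ltac:(lia)); specialize (HN3 n ltac:(lia)).
    pose proof (etac_redundancy_le f lac Hlac n ltac:(lia)) as Hle.
    eapply Rbar_le_trans; [exact HN1|].
    pose proof (Rbar_le_trans _ _ _ Hle HN1) as Hup.
    (* The two bounds exclude both infinite values, so [Rbar_mult] is an ordinary product. *)
    destruct (minimax_red f n) as [r| |]; simpl in *; try contradiction.
    apply Rle_trans with ((8 + eps) * log2 (m n) * ((1 / 4 - (1 / 4 - 2 / (8 + eps))) * m n * log2 (INR n))).
    + apply Req_le; field; lra.
    + apply Rmult_le_compat_l; [apply Rmult_le_pos; lra|assumption].
Qed.
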